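(* Let $G$ be a compact Lie group with Lie algebra $\mathfrak g$ and a bi-invariant metric $g_0$, let $H\subset G$ be a torus with Lie algebra $\mathfrak h\subset\mathfrak g$, let $\mathfrak u$ be the $g_0$-orthogonal complement of the centralizer $\mathfrak z(\mathfrak h)$ of $\mathfrak h$ in $\mathfrak g$, and let $\{Z_1,\ldots,Z_r\}$ be a $g_0$-orthonormal basis of $\mathfrak h$. Let $\lambda,\lambda':\mathfrak g\to\mathfrak h\subset\mathfrak g$ be two linear maps with $\lambda|_{\mathfrak h\oplus\mathfrak u}=\lambda'|_{\mathfrak h\oplus\mathfrak u}=0$ such that for every $Z\in\mathfrak h$ there exists $a_Z\in G$ with $\lambda'_Z=\mathrm{Ad}_{a_Z}^*\lambda_Z$ and $\mathrm{Ad}_{a_Z}|_{\mathfrak h}=\mathrm{Id}|_{\mathfrak h}$. Then $$\|\mathrm{Ric}^\lambda\|_\lambda^2-\|\mathrm{Ric}^{\lambda'}\|_{\lambda'}^2=\frac14\Bigl(\sum_{i,k=1}^r\mathrm{tr}\bigl((\mathrm{ad}_{j_{Z_i}})^2(\mathrm{ad}_{j_{Z_k}})^2\bigr)-\sum_{i,k=1}^r\mathrm{tr}\bigl((\mathrm{ad}_{j'_{Z_i}})^2(\mathrm{ad}_{j'_{Z_k}})^2\bigr)\Bigr).$$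
   Context: A torus is a compact connected abelian Lie group. $\langle\,,\rangle_0$ denotes the scalar product on $\mathfrak g$ given by $g_0$. For $Z\in\mathfrak h$, $\lambda_Z:=\langle\lambda(\,.\,),Z\rangle_0\in\mathfrak g^*$. $g_\lambda$ is the left invariant metric on $G$ corresponding to the scalar product $(\mathrm{Id}+\lambda)^*g_0$, i.e. $(X,Y)\mapsto\langle X+\lambda(X),Y+\lambda(Y)\rangle_0$, on $\mathfrak g$; $\mathrm{Ric}^\lambda$ is the Ricci tensor of $g_\lambda$ and $\|\,.\,\|_\lambda$ is the euclidean norm on tensors induced by $g_\lambda$ (so $\|\mathrm{Ric}^\lambda\|^2_\lambda$ is a constant function on $G$). $j:\mathfrak g\to\mathfrak g$ is the transpose of $\lambda:\mathfrak g\to\mathfrak g$ with respect to $\langle\,,\rangle_0$, and $j_Z:=j(Z)$; similarly $j'$ is the transpose of $\lambda'$. $\mathrm{ad}$ is the adjoint representation of $\mathfrak g$. *)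

(* Defs.v *)
From HB Require Import structures.
From mathcomp Require Import all_boot all_order all_algebra.
From mathcomp Require Import all_classical all_reals all_analysis.
Import Order.TTheory GRing.Theory Num.Theory.
Import numFieldNormedType.Exports.

Set Implicit Arguments.
Unset Strict Implicit.
Unset Printing Implicit Defensive.

Local Open Scope classical_set_scope.
Local Open Scope ring_scope.

(* Lie groups are smooth manifolds with smooth group operations, and a vector
   field is represented by its action on functions, so that the Lie bracket is
   the commutator and the Lie algebra is the set of left invariant fields. *)

(** * Smooth functions on open subsets of normed spaces *)

(* For finite-dimensional V and open U, this is the usual class C^k(U). *)
Fixpoint Ck (R : realType) (V W : normedModType R) (k : nat) (U : set V)
    (f : V -> W) : Prop :=
  match k with
  | 0 => forall x, U x -> {for x, continuous f}
  | k'.+1 => (forall x, U x -> differentiable f x) /\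
             (forall v : V, Ck k' U ('D_v f))
  end.

Definition smooth_on (R : realType) (V W : normedModType R) (U : set V)
  (f : V -> W) : Prop := forall k, Ck k U f.

(** * Smooth manifolds *)

(* A chart is a homeomorphism, with its inverse, between open sets; the values
   of chart_map and chart_inv outside these sets are irrelevant. *)
Record chart (R : realType) (n : nat) (M : topologicalType) := Chart {
  chart_dom : set M ;
  chart_map : M -> 'rV[R]_n ;
  chart_inv : 'rV[R]_n -> M }.

Definition chart_img (R : realType) (n : nat) (M : topologicalType)
  (c : chart R n M) : set 'rV[R]_n := chart_map c @` chart_dom c.

Definition is_chart (R : realType) (n : nat) (M : topologicalType)
    (c : chart R n M) : Prop :=
  [/\ open (chart_dom c), open (chart_img c),
      (forall x, chart_dom c x -> chart_inv c (chart_map c x) = x),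
      (forall x, chart_dom c x -> {for x, continuous (chart_map c)}) &
      (forall u, chart_img c u -> {for u, continuous (chart_inv c)})].

Definition smooth_transition (R : realType) (n : nat) (M : topologicalType)
    (c d : chart R n M) : Prop :=
  smooth_on (chart_map c @` (chart_dom c `&` chart_dom d))
            (chart_map d \o chart_inv c).

HB.mixin Record isManifold (R : realType) (n : nat) M of Topological M := {
  atlas : set (chart R n M) ;
  atlas_chart : forall c, atlas c -> is_chart c ;
  atlas_cover : forall x : M, exists2 c, atlas c & chart_dom c x ;
  atlas_compat : forall c d, atlas c -> atlas d -> smooth_transition c d ;
  manifold_hausdorff : hausdorff_space M ;
  manifold_second_countable : @second_countable M
}.

#[short(type="manifoldType")]
HB.structure Definition Manifold (R : realType) (n : nat) :=
  {M of isManifold R n M & Topological M}.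

(* C^oo(M). *)
Definition smooth_fun (R : realType) (n : nat) (M : manifoldType R n)
    (f : M -> R) : Prop :=
  forall c : chart R n M, atlas c -> smooth_on (chart_img c) (f \o chart_inv c).

Definition smooth_map (R : realType) (n k : nat) (M : manifoldType R n)
    (N : manifoldType R k) (F : M -> N) : Prop :=
  continuous F /\
  forall (c : chart R n M) (d : chart R k N), atlas c -> atlas d ->
    smooth_on (chart_map c @` (chart_dom c `&` F @^-1` chart_dom d))
              (chart_map d \o F \o chart_inv c).

(** * Lie groups *)

HB.mixin Record isLieGroup (R : realType) (n : nat) G
    of Manifold R n G & Group G := {
  mulg_continuous : continuous (fun xy : G * G => (xy.1 * xy.2)%g) ;
  mulg_smooth : forall c1 c2 d : chart R n G, atlas c1 -> atlas c2 -> atlas d ->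
    smooth_on [set uv : 'rV[R]_n * 'rV[R]_n |
                [/\ chart_img c1 uv.1, chart_img c2 uv.2 &
                    chart_dom d (chart_inv c1 uv.1 * chart_inv c2 uv.2)%g]]
      (fun uv => chart_map d (chart_inv c1 uv.1 * chart_inv c2 uv.2)%g) ;
  invg_smooth : @smooth_map R n n G G (fun x : G => (x^-1)%g)
}.

#[short(type="lieGroupType")]
HB.structure Definition LieGroup (R : realType) (n : nat) :=
  {G of isLieGroup R n G & Manifold R n G & Group G}.

Definition torus (R : realType) (k : nat) (T : lieGroupType R k) : Prop :=
  [/\ compact [set: T], connected [set: T] &
      forall x y : T, (x * y = y * x)%g].

(** * Vector fields *)

(* Operators on functions. Tangent vectors and vector fields are only relevant
   on C^oo(M); requiring them to vanish on the other functions makes an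
   operator representing a vector field unique. *)
Notation operator R M := ((M -> R) -> (M -> R)).

(* The tangent vectors at p are the directional derivatives at p. *)
Definition tangent (R : realType) (n : nat) (M : manifoldType R n) (p : M)
    (v : (M -> R) -> R) : Prop :=
  (exists (c : chart R n M) (w : 'rV[R]_n),
    [/\ atlas c, chart_dom c p &
        forall f, smooth_fun f ->
          v f = 'D_w (f \o chart_inv c : 'rV[R]_n -> R) (chart_map c p)]) /\
  (forall f, ~ smooth_fun f -> v f = 0).

Definition vector_field (R : realType) (n : nat) (M : manifoldType R n) :
    set (operator R M) :=
  [set X | (forall p, tangent p (fun f => X f p)) /\
           (forall f, smooth_fun f -> smooth_fun (X f))].

Definition fscale (R : realType) (M : Type) (f : M -> R) (X : operator R M) :
  operator R M := fun g p => f p * X g p.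

Definition bracket (R : realType) (M : Type) (X Y : operator R M) :
  operator R M := fun f => X (Y f) - Y (X f).

(* Pushforward of a vector field by a diffeomorphism F with inverse F'. *)
Definition push (R : realType) (M : Type) (F F' : M -> M) (X : operator R M) :
  operator R M := fun f => X (f \o F) \o F'.

(** * Riemannian geometry *)

(* A covariant 2-tensor is a C^oo(M)-bilinear map from pairs of vector fields
   to C^oo(M). *)
Notation tensor2 R M := (operator R M -> operator R M -> (M -> R)).

Definition riemannian_metric (R : realType) (n : nat) (M : manifoldType R n)
    (g : tensor2 R M) : Prop :=
  [/\ forall X Y, vector_field X -> vector_field Y -> smooth_fun (g X Y),
      forall X Y, vector_field X -> vector_field Y -> g X Y = g Y X,
      forall f X Y Z, smooth_fun f ->
        vector_field X -> vector_field Y -> vector_field Z ->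
        g (fscale f X + Y) Z = f * g X Z + g Y Z &
      forall X p, vector_field X -> (exists f, X f p != 0) -> 0 < g X X p].

Definition affine_connection (R : realType) (n : nat) (M : manifoldType R n)
    (D : operator R M -> operator R M -> operator R M) : Prop :=
  [/\ forall X Y, vector_field X -> vector_field Y -> vector_field (D X Y),
      forall f X Y Z, smooth_fun f ->
        vector_field X -> vector_field Y -> vector_field Z ->
        D (fscale f X + Y) Z = fscale f (D X Z) + D Y Z,
      forall X Y Z, vector_field X -> vector_field Y -> vector_field Z ->
        D X (Y + Z) = D X Y + D X Z &
      forall f X Y, smooth_fun f -> vector_field X -> vector_field Y ->
        D X (fscale f Y) = fscale (X f) Y + fscale f (D X Y)].

Definition levi_civita (R : realType) (n : nat) (M : manifoldType R n)
    (g : tensor2 R M) (D : operator R M -> operator R M -> operator R M) :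
    Prop :=
  [/\ affine_connection D,
      forall X Y, vector_field X -> vector_field Y ->
        D X Y - D Y X = bracket X Y &
      forall X Y Z, vector_field X -> vector_field Y -> vector_field Z ->
        X (g Y Z) = g (D X Y) Z + g Y (D X Z)].

Definition curvature (R : realType) (M : Type)
    (D : operator R M -> operator R M -> operator R M)
    (X Y Z : operator R M) : operator R M :=
  D X (D Y Z) - D Y (D X Z) - D (bracket X Y) Z.

(* For D the Levi-Civita connection of g and F a g-orthonormal frame,
   Ric(Y, Z) is the trace of X |-> R(X, Y) Z. *)
Definition ricci (R : realType) (n : nat) (M : manifoldType R n)
    (g : tensor2 R M) (D : operator R M -> operator R M -> operator R M)
    (F : 'I_n -> operator R M) : tensor2 R M :=
  fun Y Z => \sum_i g (curvature D (F i) Y Z) (F i).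

(* Squared euclidean norm of a covariant 2-tensor, F being an orthonormal
   frame. *)
Definition normsq (R : realType) (n : nat) (M : manifoldType R n)
    (F : 'I_n -> operator R M) (S : tensor2 R M) : M -> R :=
  \sum_i \sum_k (S (F i) (F k)) ^+ 2.

(** * Lie algebra and invariant metrics *)

Section LieAlgebra.
Context {R : realType} {n : nat} {G : lieGroupType R n}.
Implicit Types (X Y Z : operator R G) (g : tensor2 R G) (V : set (operator R G)).

Definition ltrans (a : G) : operator R G -> operator R G :=
  push (fun x : G => a * x)%g (fun x : G => a^-1 * x)%g.

Definition rtrans (a : G) : operator R G -> operator R G :=
  push (fun x : G => x * a)%g (fun x : G => x * a^-1)%g.

Definition lie_algebra : set (operator R G) :=
  [set X | vector_field X /\ forall a : G, ltrans a X = X].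

Definition Ad (a : G) : operator R G -> operator R G :=
  push (fun x : G => a * x * a^-1)%g (fun x : G => a^-1 * x * a)%g.

Definition ad (X : operator R G) : operator R G -> operator R G := bracket X.

Definition left_invariant_metric g : Prop :=
  riemannian_metric g /\
  forall (a : G) X Y, vector_field X -> vector_field Y ->
    forall x : G, g (ltrans a X) (ltrans a Y) (a * x)%g = g X Y x.

Definition bi_invariant_metric g : Prop :=
  left_invariant_metric g /\
  forall (a : G) X Y, vector_field X -> vector_field Y ->
    forall x : G, g (rtrans a X) (rtrans a Y) (x * a)%g = g X Y x.

(* The scalar product that a left invariant metric induces on the Lie
   algebra. *)
Definition scal g X Y : R := g X Y 1%g.

(* g is the left invariant metric corresponding to the scalar product s. *)
Definition metric_of (s : operator R G -> operator R G -> R) g : Prop :=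
  left_invariant_metric g /\
  forall X Y, lie_algebra X -> lie_algebra Y -> scal g X Y = s X Y.

Definition orthonormal_basis g V (r : nat) (b : 'I_r -> operator R G) : Prop :=
  [/\ forall i, V (b i),
      forall i k, scal g (b i) (b k) = (i == k)%:R &
      forall X, V X -> exists c : 'I_r -> R, X = \sum_i c i *: b i].

(* Trace of an endomorphism of the Lie algebra, E being a g-orthonormal
   basis. *)
Definition trace g (E : 'I_n -> operator R G)
    (A : operator R G -> operator R G) : R :=
  \sum_i scal g (A (E i)) (E i).

Definition centralizer V : set (operator R G) :=
  [set X | lie_algebra X /\ forall Z, V Z -> bracket X Z = 0].

Definition orthogonal_complement g V : set (operator R G) :=
  [set X | lie_algebra X /\ forall Y, V Y -> scal g X Y = 0].

Definition linear_into (l : operator R G -> operator R G) V : Prop :=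
  (forall (t : R) X Y, lie_algebra X -> lie_algebra Y ->
     l (t *: X + Y) = t *: l X + l Y) /\
  (forall X, lie_algebra X -> V (l X)).

Definition transpose_of g (l j : operator R G -> operator R G) : Prop :=
  (forall X, lie_algebra X -> lie_algebra (j X)) /\
  (forall X Y, lie_algebra X -> lie_algebra Y ->
     scal g (j X) Y = scal g X (l Y)).

End LieAlgebra.

Arguments lie_algebra {R n} G.

(** * Lie subgroups *)

(* An injective immersion iota that is a group morphism presents T as a Lie
   subgroup of G. *)
Definition lie_subgroup (R : realType) (n k : nat) (T : lieGroupType R k)
    (G : lieGroupType R n) (iota : T -> G) : Prop :=
  [/\ smooth_map iota, {morph iota : x y / (x * y)%g}, injective iota &
      forall (p : T) (v : (T -> R) -> R), tangent p v ->
        (forall f : G -> R, smooth_fun f -> v (f \o iota) = 0) ->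
        forall h : T -> R, v h = 0].

(* Image of the Lie algebra of T under the differential of iota: the left
   invariant fields on G that are iota-related to one on T. *)
Definition sub_lie_algebra (R : realType) (n k : nat) (T : lieGroupType R k)
    (G : lieGroupType R n) (iota : T -> G) : set (operator R G) :=
  [set X | lie_algebra G X /\
     exists2 Y, lie_algebra T Y &
       forall f : G -> R, smooth_fun f -> Y (f \o iota) = X f \o iota].

(* Main.v *)
(* Put L = lambda, J = j (its transpose) and let a_k, z_k be the adjoint maps of
   j_{Z_k} and Z_k. Since Id + lambda is an isometry from g_lambda to g_0, the
   Ricci tensor of g_lambda is that of the transported bracket
   (1 + L) [(1 - L) x, (1 - L) y] on the euclidean space (Lie(G), g_0). The
   relations L L = 0, L z_k = z_k L = z_k J = a_k L = 0 and [a_k, z_l] = 0 reduce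
   it to
     Q = - 1/4 (1 + L) K (1 + J) + \sum_k a_k z_k + 1/2 \sum_k a_k^2,
   where K is the matrix of the Killing form. In tr(Q^2) the square of the last
   summand gives the right-hand side of the theorem. All the other terms are
   polynomials of degree at most four in the j_{Z_k} that are combinations of
   polarizations of functions of a single vector j_Z, each invariant under the
   maps Ad_a fixing h pointwise; they agree for lambda and lambda'.

   Smooth tensoriality of a metric is obtained without bump functions: if the
   E_i are a left invariant frame and d = det(E_i f_k) for smooth functions f_k,
   then d V is a combination of the E_i with globally smooth coefficients, for
   every vector field V (Cramer's rule). The skewness of ad for a bi-invariant
   metric follows by expanding right invariant fields, which commute with the
   left invariant ones, in such a frame. *)
Require Import Defs.
From HB Require Import structures.
From mathcomp Require Import all_boot all_order all_algebra.
From mathcomp Require Import all_classical all_reals all_analysis.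
From mathcomp Require Import perm ring lra.
Import Order.TTheory GRing.Theory Num.Theory.
Import numFieldNormedType.Exports.

Set Implicit Arguments.
Unset Strict Implicit.
Unset Printing Implicit Defensive.

Local Open Scope classical_set_scope.
Local Open Scope ring_scope.

(** * C^k functions *)

(** The element a in the hypothesis depends on Z, so lambda and lambda' need not be conjugate as a
    whole: only functions of a single vector j_Z, and what polarization extracts from them, can be
    compared. In degree two a symmetric bilinear form is recovered from its quadratic form, and the
    terms of degree four coming from the Killing form are squares of such values. A cubic trace with
    one factor z_l also works, because z_l commutes with all a_k and the trace is cyclic. For the
    pure quartic trace this fails: polarizing tr(a^4) controls only 4 tr(a_i^2 a_k^2) + 2 tr(a_i a_k
    a_i a_k), so tr(a_i^2 a_k^2) survives, with the factor (1/2)^2. The geometric half needs that a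
    commutator of vector fields is a vector field; this is read off from a torsion-free connection
    instead of a computation in charts. The frame E_i - lambda E_i then identifies g_lambda with the
    standard scalar product of R^n, where only matrix identities remain. *)

Section CkCalculus.
Variable R : realType.
Implicit Types V W : normedModType R.

Lemma near_eq_differentiable V W (f g : V -> W) (x : V) :
  (\near x, f x = g x) -> differentiable f x -> differentiable g x.
Proof.
move=> fg df; have gfx : g x = f x by rewrite (nbhs_singleton fg).
have key : g \o shift x = cst (g x) + 'd f x +o_ 0 id.
  have := diff_locally df.
  move=> /eqaddoP fo; apply/eqaddoP => e e0.
  have := fo e e0; apply: filter_app.
  have : \forall y \near (0 : V), f (y + x) = g (y + x).
    by move: fg; rewrite (near_shift 0 x) /=; apply: filterS => y; rewrite subr0.
  apply: filterS => y fgy.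
  by rewrite /= ![(_ + _ : _ -> _) _]/(_ + _) ![(- _ : _ -> _) _]/(- _) /cst /=
     gfx fgy.
have dfc := diff_continuous df.
apply/diff_locallyP; rewrite (diff_unique dfc key); split => //.
Qed.

(** Each clause of [Ck] concerns the germ of the function at the points of the set, one point at a
    time, so regularity can be studied on singletons. *)
Lemma CkP V W k (U : set V) (f : V -> W) :
  Ck k U f <-> forall x, U x -> Ck k [set x] f.
Proof.
elim: k f => [|k IH] f /=.
  split=> [H x Ux y ->|H x Ux]; first exact: H.
  by apply: H Ux _ _.
split=> [[Hd HD] x Ux|H].
  split=> [y ->|v]; first exact: Hd.
  by have := HD v; rewrite IH; apply.
split=> [x Ux|v]; first by have [/(_ x erefl)] := H x Ux.
by rewrite IH => x Ux; have [_ ] := H x Ux.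
Qed.

Lemma near_eq_Ck V W k (f g : V -> W) (x : V) :
  (\near x, f x = g x) -> Ck k [set x] f -> Ck k [set x] g.
Proof.
elim: k f g => [|k IH] f g fg /=.
  move=> H y ->; have := H x erefl.
  rewrite /prop_for /continuous_at -(nbhs_singleton fg) => cf.
  exact: cvg_trans (near_eq_cvg _) cf.
move=> [H1 H2]; split=> [y ->|v].
  by apply: near_eq_differentiable fg _; exact: H1.
apply: IH (H2 v); have := near_join fg; apply: filterS => y.
exact: near_eq_derive.
Qed.

Lemma CkW V W k (U : set V) (f : V -> W) : Ck k.+1 U f -> Ck k U f.
Proof.
elim: k f => [|k IH] f; first by move=> [H _] x Ux; exact/differentiable_continuous/H.
by move=> [H1 H2]; split=> // v; apply: IH; exact: H2.
Qed.

Lemma Ck_continuous V W k (U : set V) (f : V -> W) :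
  Ck k U f -> forall x, U x -> {for x, continuous f}.
Proof. by elim: k f => [//|k IH] f /CkW; exact: IH. Qed.

(** On a singleton [Ck] bounds iterated derivatives at one point only, whereas the sum, product and
    chain rules must compute a derivative on a whole neighbourhood before it is differentiated
    again. Hence the rules below assume regularity near [x] and conclude at [x]; [near_join] then
    gives the conclusion near [x]. *)
Definition Ck_near V W k (f : V -> W) (x : V) := \forall y \near x, Ck k [set y] f.

Lemma Ck_near_point V W k (f : V -> W) (x : V) : Ck_near k f x -> Ck k [set x] f.
Proof. exact: nbhs_singleton. Qed.

Lemma Ck_nearW V W k (f : V -> W) (x : V) : Ck_near k.+1 f x -> Ck_near k f x.
Proof. by apply: filterS => y; exact: CkW. Qed.

Lemma Ck_near_diff V W k (f : V -> W) (x : V) : Ck_near k.+1 f x ->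
  \forall y \near x, differentiable f y.
Proof. by apply: filterS => y -[/(_ y erefl)]. Qed.

Lemma Ck_nearD V W k (f : V -> W) (x v : V) : Ck_near k.+1 f x ->
  Ck_near k ('D_v f) x.
Proof. by apply: filterS => y -[_ /(_ v)]. Qed.

Lemma Ck_cst V W k (U : set V) (c : W) : Ck k U (cst c).
Proof.
elim: k c => [|k IH] c; first by move=> x _; exact: cst_continuous.
split=> [x _|v]; first exact: differentiable_cst.
by rewrite (_ : 'D_v (cst c) = cst 0) // funeqE => x; rewrite derive_cst.
Qed.

Lemma Ck_add V W k (f g : V -> W) (x : V) :
  Ck_near k f x -> Ck_near k g x -> Ck k [set x] (f + g).
Proof.
elim: k f g => [|k IH] f g fx gx.
  move=> y ->; apply: continuousD.
    exact: (Ck_near_point fx).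
  exact: (Ck_near_point gx).
split=> [y ->|v].
  apply: differentiableD.
    exact: nbhs_singleton (Ck_near_diff fx).
  exact: nbhs_singleton (Ck_near_diff gx).
apply: (@near_eq_Ck _ _ _ ('D_v f + 'D_v g)); last by apply: IH; exact: Ck_nearD.
near=> y; rewrite deriveD //; apply: diff_derivable; near: y.
  exact: Ck_near_diff fx.
exact: Ck_near_diff gx.
Unshelve. all: by end_near. Qed.

Lemma Ck_mul V k (f g : V -> R) (x : V) :
  Ck_near k f x -> Ck_near k g x -> Ck k [set x] (f * g).
Proof.
elim: k f g x => [|k IH] f g x fx gx.
  move=> y ->; apply: continuousM.
    exact: (Ck_near_point fx).
  exact: (Ck_near_point gx).
split=> [y ->|v].
  apply: differentiableM.
    exact: nbhs_singleton (Ck_near_diff fx).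
  exact: nbhs_singleton (Ck_near_diff gx).
apply: (@near_eq_Ck _ _ _ (f * 'D_v g + g * 'D_v f)).
  near=> y; rewrite deriveM //; apply: diff_derivable; near: y.
    exact: Ck_near_diff fx.
  exact: Ck_near_diff gx.
apply: Ck_add.
  move: (near_join (Ck_nearW fx)) (near_join (Ck_nearD v gx)).
  by apply: filterS2 => y; exact: IH.
move: (near_join (Ck_nearW gx)) (near_join (Ck_nearD v fx)).
by apply: filterS2 => y; exact: IH.
Unshelve. all: by end_near. Qed.

Lemma Ck_near_add V W k (f g : V -> W) (x : V) :
  Ck_near k f x -> Ck_near k g x -> Ck_near k (f + g) x.
Proof.
by move=> /near_join + /near_join; apply: filterS2 => y; exact: Ck_add.
Qed.

Lemma Ck_near_mul V k (f g : V -> R) (x : V) :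
  Ck_near k f x -> Ck_near k g x -> Ck_near k (f * g) x.
Proof.
by move=> /near_join + /near_join; apply: filterS2 => y; exact: Ck_mul.
Qed.

Lemma Ck_near_sum V W k m (f : 'I_m -> V -> W) (x : V) :
  (forall i, Ck_near k (f i) x) -> Ck_near k (\sum_i f i) x.
Proof.
move=> H; elim/big_ind: _ => //; last by move=> *; exact: Ck_near_add.
by near=> y; exact: (@Ck_cst _ _ _ _ 0).
Unshelve. all: by end_near. Qed.

Lemma derive_coord V m (g : V -> 'rV[R]_m) (x v : V) i :
  differentiable g x -> 'D_v (fun y => g y ord0 i) x = ('D_v g x) ord0 i.
Proof. by move=> /diff_derivable dg; rewrite derive_mx ?mxE. Qed.

Lemma Ck_coord V k m (g : V -> 'rV[R]_m) (x : V) i :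
  Ck_near k g x -> Ck k [set x] (fun y => g y ord0 i).
Proof.
elim: k g => [|k IH] g gx.
  move=> y ->; apply: (@continuous_comp _ _ _ g (fun N : 'rV[R]_m => N ord0 i)).
    exact: (Ck_near_point gx).
  exact: coord_continuous.
split=> [y ->|v].
  apply: (@differentiable_comp _ _ _ _ g (fun N : 'rV[R]_m => N ord0 i)).
    exact: nbhs_singleton (Ck_near_diff gx).
  exact: differentiable_coord.
apply: (@near_eq_Ck _ _ _ (fun y => ('D_v g y) ord0 i)).
  near=> y; rewrite derive_coord //; near: y; exact: Ck_near_diff gx.
by apply: IH; exact: Ck_nearD.
Unshelve. all: by end_near. Qed.

Lemma Ck_near_coord V k m (g : V -> 'rV[R]_m) (x : V) i :
  Ck_near k g x -> Ck_near k (fun y => g y ord0 i) x.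
Proof. by move=> /near_join; apply: filterS => y; exact: Ck_coord. Qed.

Lemma derive_comp V W (W' : normedModType R) (f : W -> W') (g : V -> W)
    (x v : V) : differentiable g x -> differentiable f (g x) ->
  'D_v (f \o g) x = 'D_('D_v g x) f (g x).
Proof.
move=> dg df; rewrite deriveE; last exact: differentiable_comp.
by rewrite diff_comp //= !deriveE.
Qed.

Lemma derive_rV_sum m (f : 'rV[R]_m -> R) (x v : 'rV[R]_m) :
  differentiable f x ->
  'D_v f x = \sum_i v ord0 i * 'D_(delta_mx ord0 i) f x.
Proof.
move=> df; rewrite deriveE // {1}[v]row_sum_delta linear_sum.
by apply: eq_bigr => i _; rewrite linearZ deriveE.
Qed.

(** In D_v(f o g) the direction D_v g varies with the point. Written with partial derivatives of f,
    the chain rule involves only sums and products of scalar functions of lower order, to which the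
    induction applies. *)
Lemma Ck_comp V k m (f : 'rV[R]_m -> R) (g : V -> 'rV[R]_m) (x : V) :
  Ck_near k g x -> Ck_near k f (g x) -> Ck k [set x] (f \o g).
Proof.
elim: k f g x => [|k IH] f g x gx fx.
  move=> y ->; apply: continuous_comp.
    exact: (Ck_near_point gx).
  exact: (Ck_near_point fx).
have gc : {for x, continuous g} by apply: (Ck_continuous (Ck_near_point gx)).
have dg : \forall y \near x, differentiable g y by exact: Ck_near_diff gx.
have df : \forall y \near x, differentiable f (g y).
  exact: (gc _ (Ck_near_diff fx)).
split=> [y ->|v].
  apply: differentiable_comp; first exact: nbhs_singleton dg.
  exact: nbhs_singleton df.
apply: (@near_eq_Ck _ _ _ (\sum_i (fun y => 'D_v g y ord0 i) *
          ('D_(delta_mx ord0 i) f \o g))).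
  apply: filterS2 dg df => y dgy dfy.
  by rewrite derive_comp // derive_rV_sum // fct_sumE.
apply: Ck_near_point; apply: Ck_near_sum => i.
apply: Ck_near_mul; first by apply: Ck_near_coord; exact: Ck_nearD.
have fx' := near_join (Ck_nearD (delta_mx ord0 i) fx).
move: (near_join (Ck_nearW gx)) (gc _ fx'); apply: filterS2 => y.
exact: IH.
Qed.

Lemma Ck_near_comp V k m (f : 'rV[R]_m -> R) (g : V -> 'rV[R]_m) (x : V) :
  Ck_near k g x -> Ck_near k f (g x) -> Ck_near k (f \o g) x.
Proof.
move=> gx fx.
have gc : {for x, continuous g} by apply: (Ck_continuous (Ck_near_point gx)).
move: (near_join gx) (gc _ (near_join fx)); apply: filterS2 => y.
exact: Ck_comp.
Qed.

Lemma Ck_near_open V W k (U : set V) (f : V -> W) x : open U -> U x ->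
  Ck k U f -> Ck_near k f x.
Proof.
move=> oU Ux /CkP H; have : nbhs x U by exact: open_nbhs_nbhs.
exact: filterS.
Qed.

End CkCalculus.

(** * Symmetry of second derivatives *)

Section Schwarz.
Variable R : realType.
Implicit Types V W : normedModType R.

Lemma derive_translate V W (f : V -> W) (x v c : V) :
  'D_v (fun y => f (y + c)) x = 'D_v f (x + c).
Proof.
rewrite /derive (_ : (fun h : R => _) =
  (fun h => h^-1 *: ((f \o shift (x + c)) (h *: v) - f (x + c)))) //.
by apply/funext => h /=; rewrite addrA.
Qed.

Lemma differentiable_translate V W (f : V -> W) (x c : V) :
  differentiable f (x + c) -> differentiable (fun y => f (y + c)) x.
Proof.
move=> df; apply: (@differentiable_comp _ _ _ _ (id + cst c) f); last exact: df.
by apply: differentiableD; [exact: ex_diff|exact: differentiable_cst].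
Qed.

Lemma is_derive_line V (y w : V) (t : R) :
  is_derive t 1 (fun s : R => s *: w + y) w.
Proof.
have d : is_diff t (fun s : R => s *: w + y) (fun s => s *: w) by apply: is_diff_eq; rewrite addr0.
have dd : differentiable (fun s : R => s *: w + y) t by [].
apply: DeriveDef; first exact: diff_derivable.
by rewrite deriveE // diff_val scale1r.
Qed.

Lemma MVT_line V (f : V -> R) (y w : V) (h : R) : 0 < h ->
  (forall t, t \in `[0, h] -> differentiable f (t *: w + y)) ->
  exists2 t, t \in `]0, h[ & f (h *: w + y) - f y = 'D_w f (t *: w + y) * h.
Proof.
move=> h0 df; pose g (s : R) := s *: w + y.
have dg t : differentiable g t by apply/derivable1_diffP; have [] := is_derive_line y w t.
have dfg t : t \in `[0, h] -> differentiable (f \o g) t.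
  by move=> th; apply: differentiable_comp; [exact: dg|exact: df].
have [] := @MVT R (f \o g) (fun t => 'D_w f (t *: w + y)) 0 h h0.
- move=> t /subset_itv_oo_cc th; apply: DeriveDef; first exact/diff_derivable/dfg.
  rewrite derive_comp //; last exact: df.
  by have [_ ->] := is_derive_line y w t.
- by apply: derivable_within_continuous => t th; apply/derivable1_diffP; exact: dfg.
move=> t th; rewrite /= /g scale0r add0r subr0 => E; by exists t.
Qed.

(** The mean value theorem is used twice: along [v] for the increment f(y + h w) - f(y), then along
    [w] for D_v f. *)
Lemma second_difference V (f : V -> R) (x v w : V) (h : R) : 0 < h ->
  (forall s t, s \in `[0, h] -> t \in `[0, h] ->
     differentiable f (s *: v + (t *: w + x)) /\
     differentiable ('D_v f) (s *: v + (t *: w + x))) ->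
  exists s t, [/\ s \in `[0, h], t \in `[0, h] &
    f (h *: v + (h *: w + x)) - f (h *: w + x) - (f (h *: v + x) - f x) =
    'D_w ('D_v f) (s *: v + (t *: w + x)) * h * h].
Proof.
move=> h0 H; have hh : h \in `[0, h] by rewrite in_itv /= lexx ltW.
have h00 : 0 \in `[0, h] by rewrite in_itv /= lexx ltW.
pose g y := f (y + h *: w) - f y.
have gE : g = (fun y => f (y + h *: w)) - f by [].
have d1 s : s \in `[0, h] -> differentiable f (s *: v + x).
  by move=> sh; have [] := H s 0 sh h00; rewrite scale0r add0r.
have d2 s : s \in `[0, h] -> differentiable f (s *: v + x + h *: w).
  by move=> sh; have [] := H s h sh hh; rewrite [_ + x]addrC addrA.
have dg s : s \in `[0, h] -> differentiable g (s *: v + x).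
  move=> sh; rewrite gE; apply: differentiableB; last exact: d1.
  by apply: differentiable_translate; exact: d2.
have [s sh] := MVT_line h0 dg.
have sh' := subset_itv_oo_cc sh.
have -> : 'D_v g (s *: v + x) = 'D_v f (s *: v + x + h *: w) - 'D_v f (s *: v + x).
  rewrite gE deriveB ?derive_translate //; apply: diff_derivable; last exact: d1.
  by apply: differentiable_translate; exact: d2.
move=> E.
have [|t th E2] := @MVT_line _ ('D_v f) (s *: v + x) w h h0.
  by move=> t th; have [_] := H s t sh' th; rewrite addrCA.
exists s, t; split => //; first exact: subset_itv_oo_cc.
rewrite -[s *: v + _]addrCA -E2 [h *: w + (s *: v + x)]addrC -E.
rewrite /g -[h *: v + x + h *: w]addrA [x + h *: w]addrC.
have subACA (a b c d : R) : a - b - (c - d) = a - c - (b - d) by ring.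
exact: subACA.
Qed.

(** The two orders of differentiation produce different intermediate points, so equality at x must
    be deduced from common values taken at distinct nearby points. *)
Lemma continuous_eq V (A B : V -> R) (x : V) :
  {for x, continuous A} -> {for x, continuous B} ->
  (forall r, 0 < r -> exists y z, [/\ ball x r y, ball x r z & A y = B z]) ->
  A x = B x.
Proof.
move=> cA cB H; apply/eqP; rewrite -subr_eq0 -normr_le0.
apply/ler_addgt0Pl => e e0; rewrite addr0.
have e2 : 0 < e / 2 by rewrite divr_gt0.
have : \forall y \near x, `|A x - A y| <= e / 2 /\ `|B x - B y| <= e / 2.
  near=> y; split; near: y; first by move/cvgrPdist_le : cA; apply.
  by move/cvgrPdist_le : cB; apply.
move=> /nbhs_ballP[r /= r0 Hr]; have [y [z [yr zr E]]] := H r r0.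
rewrite (_ : A x - B x = (A x - A y) - (B x - B z)); last first.
  by rewrite E opprB addrA subrK.
rewrite (le_trans (ler_normB _ _)) // (splitr e) lerD //.
  by have [] := Hr _ yr.
by have [] := Hr _ zr.
Unshelve. all: by end_near. Qed.

(** The second difference over a parallelogram is symmetric in [v] and [w]; dividing it by h^2 gives
    values of both mixed derivatives at points close to [x], and both are continuous there. *)
Lemma derive_comm V (f : V -> R) (x v w : V) : Ck_near 2%N f x ->
  'D_v ('D_w f) x = 'D_w ('D_v f) x.
Proof.
move=> fx.
have fv : Ck_near 1%N ('D_v f) x by apply: Ck_nearD fx.
have fw : Ck_near 1%N ('D_w f) x by apply: Ck_nearD fx.
apply: (@continuous_eq _ ('D_v ('D_w f)) ('D_w ('D_v f))).
- exact: (Ck_near_point (Ck_nearD v fw)).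
- exact: (Ck_near_point (Ck_nearD w fv)).
move=> r r0.
have : \forall y \near x, ball x r y /\ [/\ differentiable f y,
    differentiable ('D_v f) y & differentiable ('D_w f) y].
  near=> y; split; first by near: y; exact: nbhsx_ballx.
  split; near: y; [exact: (Ck_near_diff fx) | exact: (Ck_near_diff fv)
    | exact: (Ck_near_diff fw)].
move=> /nbhs_ballP[q /= q0 Hq].
(* With this side the whole parallelogram lies in the ball of radius [q]; the summand 1 makes the
   denominator positive even for zero directions. *)
pose h := q / (`|v| + `|w| + 1).
have n0 : 0 < `|v| + `|w| + 1 by rewrite ltr_wpDl // addr_ge0.
have h0 : 0 < h by rewrite divr_gt0.
have Hst s t : s \in `[0, h] -> t \in `[0, h] ->
    ball x q (s *: v + (t *: w + x)).
  rewrite !in_itv /= => /andP[s0 sh] /andP[t0 th].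
  rewrite -ball_normE /= addrA opprD addrCA subrr addr0 normrN.
  rewrite (le_lt_trans (ler_normD _ _)) // !normrZ !ger0_norm //.
  apply: (@le_lt_trans _ _ (h * (`|v| + `|w|))).
    by rewrite mulrDr lerD // ler_wpM2r.
  by rewrite /h mulrAC ltr_pdivrMr // ltr_pM2l // ltrDl.
have [|s [t [sh th E1]]] := @second_difference V f x v w h h0.
  by move=> s t sh th; have [_ []] := Hq _ (Hst s t sh th).
have [|s' [t' [sh' th' E2]]] := @second_difference V f x w v h h0.
  by move=> a b ah bh; rewrite addrCA; have [_ []] := Hq _ (Hst b a bh ah).
exists (s' *: w + (t' *: v + x)), (s *: v + (t *: w + x)); split.
- by rewrite addrCA; have [] := Hq _ (Hst t' s' th' sh').
- by have [] := Hq _ (Hst s t sh th).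
have hn : h != 0 by rewrite gt_eqF.
have fin (a b p1 p2 p3 p4 : R) : p1 - p2 - (p3 - p4) = a * h * h ->
    p1 - p3 - (p2 - p4) = b * h * h -> b = a.
  move=> Ea Eb; apply: (mulIf hn); apply: (mulIf hn); rewrite -Ea -Eb; ring.
move: E2; rewrite [h *: w + (h *: v + x)]addrCA => E2.
exact: fin E1 E2.
Unshelve. all: by end_near. Qed.

End Schwarz.

(** * Smooth manifolds *)

Section Manifolds.
Variable R : realType.

Section Charts.
Variables (n : nat) (M : manifoldType R n).
Implicit Types (c d : chart R n M) (p : M) (f g : M -> R).

Lemma chart_imgP c p : chart_dom c p -> chart_img c (chart_map c p).
Proof. by move=> cp; exists p. Qed.

Lemma chart_mapK c p : atlas c -> chart_dom c p ->
  chart_inv c (chart_map c p) = p.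
Proof. by move=> /atlas_chart[_ _ H _ _] /H. Qed.

Lemma chart_invK c u : atlas c -> chart_img c u ->
  chart_dom c (chart_inv c u) /\ chart_map c (chart_inv c u) = u.
Proof. by move=> ac [x cx <-]; rewrite chart_mapK. Qed.

Lemma chart_inv_continuous c p : atlas c -> chart_dom c p ->
  {for chart_map c p, continuous (chart_inv c)}.
Proof. by move=> /atlas_chart[_ _ _ _ H] cp; apply: H; exact: chart_imgP. Qed.

Lemma near_chart_img c p : atlas c -> chart_dom c p ->
  \forall u \near chart_map c p, chart_img c u.
Proof.
move=> /atlas_chart[_ H _ _ _] cp; apply: open_nbhs_nbhs; split => //.
exact: chart_imgP.
Qed.

Lemma near_chart_inv c p (P : set M) : atlas c -> chart_dom c p ->
  nbhs p P -> \forall u \near chart_map c p, P (chart_inv c u).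
Proof.
move=> ac cp Pp; apply: (chart_inv_continuous ac cp).
by rewrite chart_mapK.
Qed.

Lemma near_chart_dom c p : atlas c -> chart_dom c p -> nbhs p (chart_dom c).
Proof. by move=> /atlas_chart[H _ _ _ _] cp; exact: open_nbhs_nbhs. Qed.

Lemma smooth_fun_near f c p k : smooth_fun f -> atlas c -> chart_dom c p ->
  Ck_near k (f \o chart_inv c) (chart_map c p).
Proof.
move=> sf ac cp; have /atlas_chart[_ oi _ _ _] := ac.
apply: (Ck_near_open oi); first exact: chart_imgP.
exact: sf.
Qed.

Lemma smooth_funP f :
  (forall c p k, atlas c -> chart_dom c p ->
    Ck_near k (f \o chart_inv c) (chart_map c p)) -> smooth_fun f.
Proof.
move=> H c ac k; apply/CkP => _ [p cp <-].
exact: Ck_near_point (H c p k ac cp).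
Qed.

Lemma smooth_fun_diff f c p : smooth_fun f -> atlas c -> chart_dom c p ->
  differentiable (f \o chart_inv c : 'rV[R]_n -> R) (chart_map c p).
Proof.
move=> sf ac cp; exact: nbhs_singleton (Ck_near_diff (smooth_fun_near 1%N sf ac cp)).
Qed.

Lemma smooth_fun_cst (a : R) : smooth_fun (cst a : M -> R).
Proof. by move=> c ac k; exact: Ck_cst. Qed.

Lemma smooth_funD f g : smooth_fun f -> smooth_fun g -> smooth_fun (f + g).
Proof.
move=> sf sg; apply: smooth_funP => c p k ac cp.
apply: (@Ck_near_add _ _ _ k (f \o chart_inv c) (g \o chart_inv c));
  exact: smooth_fun_near.
Qed.

Lemma smooth_funM f g : smooth_fun f -> smooth_fun g -> smooth_fun (f * g).
Proof.
move=> sf sg; apply: smooth_funP => c p k ac cp.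
apply: (@Ck_near_mul _ _ k (f \o chart_inv c) (g \o chart_inv c));
  exact: smooth_fun_near.
Qed.

Lemma smooth_funZ (a : R) f : smooth_fun f -> smooth_fun (a *: f).
Proof. by move=> sf; apply: (@smooth_funM (cst a) f) => //; exact: smooth_fun_cst. Qed.

Lemma smooth_fun_sum (I : Type) (r : seq I) (P : pred I) (f : I -> M -> R) :
  (forall i, P i -> smooth_fun (f i)) -> smooth_fun (\sum_(i <- r | P i) f i).
Proof.
move=> H; elim/big_ind: _ => //; first exact: smooth_fun_cst.
exact: smooth_funD.
Qed.

Lemma smooth_fun_prod (I : Type) (r : seq I) (P : pred I) (f : I -> M -> R) :
  (forall i, P i -> smooth_fun (f i)) -> smooth_fun (\prod_(i <- r | P i) f i).
Proof.
move=> H; elim/big_ind: _ => //; first exact: smooth_fun_cst.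
exact: smooth_funM.
Qed.

End Charts.

Section SmoothMaps.
Variables (n m : nat) (M : manifoldType R n) (N : manifoldType R m).
Variable F : M -> N.
Hypothesis smF : smooth_map F.
Implicit Types (c : chart R n M) (d : chart R m N) (p : M) (f : N -> R).

Lemma smooth_map_near c d p k : atlas c -> atlas d -> chart_dom c p ->
  chart_dom d (F p) ->
  Ck_near k (chart_map d \o F \o chart_inv c) (chart_map c p).
Proof.
move=> ac ad cp dp; have [cF /(_ c d ac ad k)/CkP H] := smF.
have : nbhs p (F @^-1` chart_dom d) by apply: cF; exact: near_chart_dom.
move=> /(near_chart_inv ac cp).
have := near_chart_img ac cp; apply: filterS2 => u iu du; apply: H.
by have [? <-] := chart_invK ac iu; exists (chart_inv c u).
Qed.

Lemma near_smooth_map c d p f : atlas c -> atlas d -> chart_dom c p ->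
  chart_dom d (F p) ->
  \forall u \near chart_map c p, (f \o chart_inv d) ((chart_map d \o F \o chart_inv c) u) =
    (f \o F \o chart_inv c) u.
Proof.
move=> ac ad cp dp; have [cF _] := smF.
have : nbhs p (F @^-1` chart_dom d) by apply: cF; exact: near_chart_dom.
move=> /(near_chart_inv ac cp); apply: filterS => u du /=.
by rewrite chart_mapK.
Qed.

Lemma smooth_fun_comp f : smooth_fun f -> smooth_fun (f \o F).
Proof.
move=> sf; apply: smooth_funP => c p k ac cp.
have [d ad dp] := atlas_cover (F p).
have H : Ck_near k ((f \o chart_inv d) \o (chart_map d \o F \o chart_inv c))
    (chart_map c p).
  apply: Ck_near_comp; first exact: smooth_map_near.
  by rewrite /= chart_mapK //; apply: smooth_fun_near.
have E := near_join (near_smooth_map f ac ad cp dp).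
by move: H E; apply: filterS2 => u Hu Eu; exact: near_eq_Ck Hu.
Qed.

Lemma tangent_comp p v d : tangent p v -> atlas d -> chart_dom d (F p) ->
  exists w, forall f, smooth_fun f ->
    v (f \o F) = 'D_w (f \o chart_inv d : 'rV[R]_m -> R) (chart_map d (F p)).
Proof.
move=> [[c [w [ac cp Hv]]] _] ad dp.
exists ('D_w (chart_map d \o F \o chart_inv c) (chart_map c p)) => f sf.
rewrite Hv; last exact: smooth_fun_comp.
rewrite -(near_eq_derive _ (near_smooth_map f ac ad cp dp)).
have dg := nbhs_singleton (Ck_near_diff (smooth_map_near 1%N ac ad cp dp)).
rewrite (derive_comp w dg) /= ?chart_mapK //.
exact: smooth_fun_diff.
Qed.

End SmoothMaps.

Section Tangent.
Variables (n : nat) (M : manifoldType R n).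
Implicit Types (c d : chart R n M) (p : M) (f g : M -> R) (v : (M -> R) -> R).

Lemma smooth_map_id : smooth_map (id : M -> M).
Proof. by split=> [x //|c d ac ad]; exact: atlas_compat. Qed.

(** This is the change of charts, obtained as the case of the identity map, whose smoothness is the
    compatibility of the atlas. *)
Lemma tangent_chart p v d : tangent p v -> atlas d -> chart_dom d p ->
  exists w, forall f, smooth_fun f ->
    v f = 'D_w (f \o chart_inv d : 'rV[R]_n -> R) (chart_map d p).
Proof. exact: (tangent_comp smooth_map_id). Qed.

Lemma tangentD p v v' : tangent p v -> tangent p v' ->
  tangent p (fun f => v f + v' f).
Proof.
move=> tv tv'; have [c ac cp] := atlas_cover p.
have [w Hw] := tangent_chart tv ac cp; have [w' Hw'] := tangent_chart tv' ac cp.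
split; last first.
  by move=> f nf; rewrite (tv.2 _ nf) (tv'.2 _ nf) addr0.
exists c, (w + w'); split=> // f sf; rewrite Hw // Hw' //.
by have df := smooth_fun_diff sf ac cp; rewrite !deriveE // linearD.
Qed.

Lemma tangentZ (a : R) p v : tangent p v -> tangent p (fun f => a * v f).
Proof.
move=> tv; have [c ac cp] := atlas_cover p.
have [w Hw] := tangent_chart tv ac cp.
split; last by move=> f nf; rewrite (tv.2 _ nf) mulr0.
exists c, (a *: w); split=> // f sf; rewrite Hw //.
by have df := smooth_fun_diff sf ac cp; rewrite !deriveE // linearZ.
Qed.

Lemma tangent0 p : tangent p (fun _ => 0 : R).
Proof.
split=> //; have [c ac cp] := atlas_cover p.
by exists c, 0; split=> // f sf; rewrite derive0.
Qed.

Lemma tangent_cst p v (a : R) : tangent p v -> v (cst a) = 0.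
Proof.
move=> [[c [w [ac cp H]]] _]; rewrite H; last exact: smooth_fun_cst.
by rewrite (_ : _ \o _ = cst a) // derive_cst.
Qed.

Lemma tangent_add p v f g : tangent p v -> smooth_fun f -> smooth_fun g ->
  v (f + g) = v f + v g.
Proof.
move=> [[c [w [ac cp H]]] _] sf sg; rewrite !H //; last exact: smooth_funD.
rewrite (_ : _ \o _ = (f \o chart_inv c : 'rV[R]_n -> R) + (g \o chart_inv c)) //.
by rewrite deriveD //; apply: diff_derivable; exact: smooth_fun_diff.
Qed.

Lemma tangent_mul p v f g : tangent p v -> smooth_fun f -> smooth_fun g ->
  v (f * g) = f p * v g + g p * v f.
Proof.
move=> [[c [w [ac cp H]]] _] sf sg; rewrite !H //; last exact: smooth_funM.
rewrite (_ : _ \o _ = (f \o chart_inv c : 'rV[R]_n -> R) * (g \o chart_inv c)) //.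
rewrite deriveM /=; last 2 first.
- by apply: diff_derivable; exact: smooth_fun_diff.
- by apply: diff_derivable; exact: smooth_fun_diff.
by rewrite !chart_mapK.
Qed.

Lemma tangent_scale p v (a : R) f : tangent p v -> smooth_fun f ->
  v (a *: f) = a * v f.
Proof.
move=> tv sf; have := tangent_mul tv (smooth_fun_cst (M := M) a) sf.
by rewrite (tangent_cst _ tv) mulr0 addr0.
Qed.

End Tangent.

End Manifolds.

(** * Vector fields as derivations, and their brackets *)

Section VectorFields.
Variables (R : realType) (n : nat) (M : manifoldType R n).
Implicit Types (p : M) (f g : M -> R) (X Y Z : operator R M).

Lemma vf_smooth X f : vector_field X -> smooth_fun f -> smooth_fun (X f).
Proof. by move=> [_ H]; exact: H. Qed.

Lemma vf_nonsmooth X f : vector_field X -> ~ smooth_fun f -> X f = 0.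
Proof. by move=> [H _] nf; apply/funext => p; exact: (H p).2. Qed.

Lemma vf_cst X (a : R) : vector_field X -> X (cst a) = 0.
Proof. by move=> [H _]; apply/funext => p; exact: (tangent_cst a (H p)). Qed.

Lemma vf0 X : vector_field X -> X 0 = 0.
Proof. exact: (@vf_cst X 0). Qed.

Lemma vf_add X f g : vector_field X -> smooth_fun f -> smooth_fun g ->
  X (f + g) = X f + X g.
Proof. by move=> [H _] sf sg; apply/funext => p; exact: (tangent_add (H p)). Qed.

Lemma vf_mul X f g : vector_field X -> smooth_fun f -> smooth_fun g ->
  X (f * g) = f * X g + g * X f.
Proof. by move=> [H _] sf sg; apply/funext => p; exact: (tangent_mul (H p)). Qed.

Lemma vf_scale X (a : R) f : vector_field X -> smooth_fun f ->
  X (a *: f) = a *: X f.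
Proof. by move=> [H _] sf; apply/funext => p; exact: (tangent_scale a (H p)). Qed.

Lemma vf_sub X f g : vector_field X -> smooth_fun f -> smooth_fun g ->
  X (f - g) = X f - X g.
Proof.
move=> vX sf sg; rewrite -(scaleN1r g) vf_add //; last exact: smooth_funZ.
by rewrite vf_scale // scaleN1r.
Qed.

Lemma vf_sum X (I : Type) (r : seq I) (f : I -> M -> R) : vector_field X ->
  (forall i, smooth_fun (f i)) ->
  X (\sum_(i <- r) f i) = \sum_(i <- r) X (f i).
Proof.
move=> vX sf; elim: r => [|i r IH]; first by rewrite !big_nil vf0.
by rewrite !big_cons vf_add // ?IH //; apply: smooth_fun_sum.
Qed.

Lemma vector_field0 : vector_field (0 : operator R M).
Proof. by split=> [p|f sf]; [exact: tangent0|exact: smooth_fun_cst]. Qed.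

Lemma vector_fieldD X Y : vector_field X -> vector_field Y -> vector_field (X + Y).
Proof.
move=> [X1 X2] [Y1 Y2]; split=> [p|f sf]; first exact: (tangentD (X1 p) (Y1 p)).
exact: (smooth_funD (X2 _ sf) (Y2 _ sf)).
Qed.

Lemma vector_fieldM f X : smooth_fun f -> vector_field X ->
  vector_field (fscale f X).
Proof.
move=> sf [X1 X2]; split=> [p|g sg]; first exact: (tangentZ (f p) (X1 p)).
exact: (smooth_funM sf (X2 _ sg)).
Qed.

Lemma fscale_cst (a : R) X : fscale (cst a) X = a *: X.
Proof. by []. Qed.

Lemma vector_fieldZ (a : R) X : vector_field X -> vector_field (a *: X).
Proof. by move=> vX; apply: (@vector_fieldM (cst a)) => //; exact: smooth_fun_cst. Qed.

Lemma vector_fieldB X Y : vector_field X -> vector_field Y -> vector_field (X - Y).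
Proof.
by move=> vX vY; rewrite -scaleN1r; apply: vector_fieldD => //; exact: vector_fieldZ.
Qed.

Lemma vector_field_sum (I : Type) (r : seq I) (X : I -> operator R M) :
  (forall i, vector_field (X i)) -> vector_field (\sum_(i <- r) X i).
Proof.
move=> H; elim/big_ind: _ => //; first exact: vector_field0.
exact: vector_fieldD.
Qed.

Lemma push_vector_field (F F' : M -> M) X : smooth_map F -> smooth_map F' ->
  cancel F' F -> cancel F F' -> vector_field X -> vector_field (push F F' X).
Proof.
move=> sF sF' FK FK' [X1 X2]; split=> [p|f sf]; last first.
  exact: smooth_fun_comp sF' _ (X2 _ (smooth_fun_comp sF sf)).
split; last first.
  move=> f nf; apply: (X1 (F' p)).2 => sf; apply: nf.
  rewrite (_ : f = (f \o F) \o F'); first exact: smooth_fun_comp.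
  by apply/funext => x /=; rewrite FK.
have [d ad dp] := atlas_cover p.
have [|w Hw] := tangent_comp sF (X1 (F' p)) ad; first by rewrite FK.
by exists d, w; split=> // f sf; rewrite /push /= Hw // FK.
Qed.

Lemma push_bracket (F F' : M -> M) X Y : cancel F F' ->
  push F F' (bracket X Y) = bracket (push F F' X) (push F F' Y).
Proof.
move=> FK'; rewrite /bracket /push; apply/funext => f; apply/funext => p.
have E (h : M -> R) : (h \o F') \o F = h by apply/funext => x /=; rewrite FK'.
by rewrite !E.
Qed.

Lemma pushD (F F' : M -> M) X Y : push F F' (X + Y) = push F F' X + push F F' Y.
Proof. by []. Qed.

Lemma pushZ (F F' : M -> M) (a : R) X : push F F' (a *: X) = a *: push F F' X.
Proof. by []. Qed.

Lemma push_sum (F F' : M -> M) (I : Type) (r : seq I) (X : I -> operator R M) :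
  push F F' (\sum_(i <- r) X i) = \sum_(i <- r) push F F' (X i).
Proof. by elim: r => [|i r IH]; rewrite ?big_nil ?big_cons // pushD IH. Qed.

Lemma bracketC X Y : bracket X Y = - bracket Y X.
Proof. by apply/funext => f; rewrite /bracket fctE opprB. Qed.

Lemma bracketDr X Y Z : vector_field X -> vector_field Y -> vector_field Z ->
  bracket X (Y + Z) = bracket X Y + bracket X Z.
Proof.
move=> vX vY vZ; apply/funext => f.
rewrite -[LHS]/(X (Y f + Z f) - (Y (X f) + Z (X f))).
rewrite -[RHS]/(X (Y f) - Y (X f) + (X (Z f) - Z (X f))).
have [sf|nf] := pselect (smooth_fun f).
  by rewrite (vf_add vX) ?opprD 1?addrACA //; exact: vf_smooth.
by rewrite (vf_nonsmooth vX nf) (vf_nonsmooth vY nf) (vf_nonsmooth vZ nf)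
  addr0 (vf0 vX) (vf0 vY) (vf0 vZ) !(subr0, addr0).
Qed.

Lemma bracketZr (a : R) X Y : vector_field X -> vector_field Y ->
  bracket X (a *: Y) = a *: bracket X Y.
Proof.
move=> vX vY; apply/funext => f.
rewrite -[LHS]/(X (a *: Y f) - a *: Y (X f)).
rewrite -[RHS]/(a *: (X (Y f) - Y (X f))).
have [sf|nf] := pselect (smooth_fun f).
  by rewrite (vf_scale a vX) ?scalerBr //; exact: vf_smooth.
by rewrite (vf_nonsmooth vX nf) (vf_nonsmooth vY nf) scaler0 (vf0 vX) (vf0 vY)
  scaler0 subr0 scaler0.
Qed.

Lemma bracketMr f X Y : smooth_fun f -> vector_field X -> vector_field Y ->
  bracket X (fscale f Y) = fscale (X f) Y + fscale f (bracket X Y).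
Proof.
move=> sf vX vY; apply/funext => g.
rewrite -[LHS]/(X (f * Y g) - f * Y (X g)).
rewrite -[RHS]/(X f * Y g + f * (X (Y g) - Y (X g))).
have [sg|ng] := pselect (smooth_fun g); last first.
  by rewrite (vf_nonsmooth vX ng) (vf_nonsmooth vY ng) mulr0 (vf0 vX) (vf0 vY)
    !mulr0 subr0 mulr0 addr0.
rewrite vf_mul //; last exact: vf_smooth.
by rewrite mulrBr addrCA addrA [_ * X f]mulrC.
Qed.

Lemma bracket_jacobi X Y Z : vector_field X -> vector_field Y ->
  vector_field Z ->
  bracket (bracket X Y) Z = bracket X (bracket Y Z) - bracket Y (bracket X Z).
Proof.
move=> vX vY vZ; apply/funext => f.
rewrite -[LHS]/(X (Y (Z f)) - Y (X (Z f)) - Z (X (Y f) - Y (X f))).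
rewrite -[RHS]/(X (Y (Z f) - Z (Y f)) - (Y (Z (X f)) - Z (Y (X f))) -
  (Y (X (Z f) - Z (X f)) - (X (Z (Y f)) - Z (X (Y f))))).
have [sf|nf] := pselect (smooth_fun f); last first.
  rewrite (vf_nonsmooth vX nf) (vf_nonsmooth vY nf) (vf_nonsmooth vZ nf).
  by rewrite !(vf0 vX, vf0 vY, vf0 vZ, subr0).
have s2 U V : vector_field U -> vector_field V -> smooth_fun (U (V f)).
  by move=> vU vV; apply: vf_smooth => //; exact: vf_smooth.
rewrite (vf_sub vX (s2 _ _ vY vZ) (s2 _ _ vZ vY)) (vf_sub vY (s2 _ _ vX vZ) (s2 _ _ vZ vX)).
rewrite (vf_sub vZ (s2 _ _ vX vY) (s2 _ _ vY vX)).
apply/funext => p; rewrite !fctE.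
have key (a b c d e g : R) : a - b - (c - d) = a - e - (g - d) - (b - g - (e - c)) by ring.
exact: key.
Qed.

End VectorFields.

(** * Lie groups *)

Section Slices.
Variable R : realType.
Implicit Types U V W : normedModType R.

(** Partial derivatives are directional derivatives of the product along (0, w) or (w, 0). This
    serves both to restrict smoothness of the multiplication to translations and to compare mixed
    derivatives. *)
Lemma derive_slicel U V W (f : U * V -> W) (u0 : U) (v w : V) :
  'D_w (fun v' => f (u0, v')) v = 'D_(0, w) f (u0, v).
Proof.
rewrite /derive (_ : (fun h : R => _) =
  (fun h => h^-1 *: ((f \o shift (u0, v)) (h *: (0, w)) - f (u0, v)))) //.
apply/funext => h /=; congr (_ *: (f _ - _)).
by rewrite -[RHS]/(h *: 0 + u0, h *: w + v) scaler0 add0r.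
Qed.

Lemma derive_slicer U V W (f : U * V -> W) (u w : U) (v0 : V) :
  'D_w (fun u' => f (u', v0)) u = 'D_(w, 0) f (u, v0).
Proof.
rewrite /derive (_ : (fun h : R => _) =
  (fun h => h^-1 *: ((f \o shift (u, v0)) (h *: (w, 0)) - f (u, v0)))) //.
apply/funext => h /=; congr (_ *: (f _ - _)).
by rewrite -[RHS]/(h *: w + u, h *: 0 + v0) scaler0 add0r.
Qed.

Lemma Ck_slicel U V W k (f : U * V -> W) (u0 : U) (v : V) :
  Ck k [set (u0, v)] f -> Ck k [set v] (fun v' => f (u0, v')).
Proof.
elim: k f => [|k IH] f.
  move=> H _ ->; apply: (@continuous_comp _ _ _ (fun v' => (u0, v')) f); last exact: H.
  by apply: cvg_pair; [exact: cst_continuous|exact: cvg_id].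
move=> [H1 H2]; split=> [_ ->|w].
  apply: (@differentiable_comp _ _ _ _ (fun v' => (u0, v')) f); last exact: H1.
  by apply: differentiable_pair; [exact: differentiable_cst|exact: (@ex_diff _ _ _ _ _ id)].
rewrite (_ : 'D_w _ = fun v' => 'D_(0, w) f (u0, v'));
  first exact: IH (H2 (0, w)).
by apply/funext => v'; exact: derive_slicel.
Qed.

Lemma Ck_slicer U V W k (f : U * V -> W) (u : U) (v0 : V) :
  Ck k [set (u, v0)] f -> Ck k [set u] (fun u' => f (u', v0)).
Proof.
elim: k f => [|k IH] f.
  move=> H _ ->; apply: (@continuous_comp _ _ _ (fun u' => (u', v0)) f); last exact: H.
  by apply: cvg_pair; [exact: cvg_id|exact: cst_continuous].
move=> [H1 H2]; split=> [_ ->|w].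
  apply: (@differentiable_comp _ _ _ _ (fun u' => (u', v0)) f); last exact: H1.
  by apply: differentiable_pair; [exact: (@ex_diff _ _ _ _ _ id)|exact: differentiable_cst].
rewrite (_ : 'D_w _ = fun u' => 'D_(w, 0) f (u', v0));
  first exact: IH (H2 (w, 0)).
by apply/funext => u'; exact: derive_slicer.
Qed.

End Slices.

Section LieGroups.
Variables (R : realType) (n : nat) (G : lieGroupType R n).
Implicit Types (a p x : G) (f : G -> R) (X Y : operator R G).

(** In a chart around [a], left translation is the slice of the multiplication through the
    coordinates of [a]. *)
Lemma smooth_map_mull a : smooth_map (fun x : G => (a * x)%g).
Proof.
split.
  move=> x; apply: (@continuous_comp _ _ _ (fun x => (a, x)) (fun xy : G * G => (xy.1 * xy.2)%g)).
    by apply: cvg_pair; [exact: cst_continuous|exact: cvg_id].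
  exact: mulg_continuous.
move=> c d ac ad k; have [e ae ea] := atlas_cover a.
apply/CkP => _ [x [cx dx] <-].
have /CkP/(_ (chart_map e a, chart_map c x)) := mulg_smooth e c d ae ac ad k.
rewrite /= !chart_mapK // => H.
have {H} := Ck_slicel (H _); rewrite /= !chart_mapK //.
by apply; split=> //; exact: chart_imgP.
Qed.

Lemma smooth_map_mulr a : smooth_map (fun x : G => (x * a)%g).
Proof.
split.
  move=> x; apply: (@continuous_comp _ _ _ (fun x => (x, a)) (fun xy : G * G => (xy.1 * xy.2)%g)).
    by apply: cvg_pair; [exact: cvg_id|exact: cst_continuous].
  exact: mulg_continuous.
move=> c d ac ad k; have [e ae ea] := atlas_cover a.
apply/CkP => _ [x [cx dx] <-].
have /CkP/(_ (chart_map c x, chart_map e a)) := mulg_smooth c e d ac ae ad k.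
rewrite /= !chart_mapK // => H.
have {H} := Ck_slicer (H _); rewrite /= !chart_mapK //.
by apply; split=> //; exact: chart_imgP.
Qed.

Lemma ltrans_vector_field a X : vector_field X -> vector_field (ltrans a X).
Proof.
apply: push_vector_field; [exact: smooth_map_mull|exact: smooth_map_mull| |].
  exact: mulVKg.
exact: mulKg.
Qed.

Lemma rtrans_vector_field a X : vector_field X -> vector_field (rtrans a X).
Proof.
apply: push_vector_field; [exact: smooth_map_mulr|exact: smooth_map_mulr| |].
  exact: mulgVK.
exact: mulgK.
Qed.

Lemma mulg_near_smooth f p x (c d : chart R n G) k : smooth_fun f ->
  atlas c -> atlas d -> chart_dom c p -> chart_dom d x ->
  Ck_near k (fun uv : 'rV[R]_n * 'rV[R]_n => f (chart_inv c uv.1 * chart_inv d uv.2)%g)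
    (chart_map c p, chart_map d x).
Proof.
move=> sf ac ad cp dx; have [e ae ex] := atlas_cover (p * x)%g.
pose m (uv : 'rV[R]_n * 'rV[R]_n) := (chart_inv c uv.1 * chart_inv d uv.2)%g.
have cm : {for (chart_map c p, chart_map d x), continuous m}.
  apply: (@continuous_comp _ _ _ (fun uv => (chart_inv c uv.1, chart_inv d uv.2))
     (fun xy : G * G => (xy.1 * xy.2)%g)); last exact: mulg_continuous.
  apply: cvg_pair.
    apply: (@continuous_comp _ _ _ fst (chart_inv c)); first exact: cvg_fst.
    exact: chart_inv_continuous.
  apply: (@continuous_comp _ _ _ snd (chart_inv d)); first exact: cvg_snd.
  exact: chart_inv_continuous.
have dm : \forall uv \near (chart_map c p, chart_map d x), chart_dom e (m uv).
  by apply: cm; rewrite /m /= !chart_mapK //; exact: near_chart_dom.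
have sm : Ck_near k (chart_map e \o m) (chart_map c p, chart_map d x).
  have /CkP H := mulg_smooth c d e ac ad ae k.
  have i1 : \forall uv \near (chart_map c p, chart_map d x), chart_img c uv.1.
    by apply: cvg_fst; exact: near_chart_img.
  have i2 : \forall uv \near (chart_map c p, chart_map d x), chart_img d uv.2.
    by apply: cvg_snd; exact: near_chart_img.
  move: dm i1 i2; apply: filterS3 => uv ? ? ?.
  by apply: H.
have H : Ck_near k ((f \o chart_inv e) \o (chart_map e \o m))
    (chart_map c p, chart_map d x).
  apply: Ck_near_comp => //=.
  by rewrite /m /= !chart_mapK //; apply: smooth_fun_near.
have E : \forall uv \near (chart_map c p, chart_map d x),
    ((f \o chart_inv e) \o (chart_map e \o m)) uv = f (m uv).
  by move: dm; apply: filterS => uv Huv /=; rewrite chart_mapK.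
move: H (near_join E); apply: filterS2 => uv Huv Euv; exact: near_eq_Ck Huv.
Qed.

(* For f in C^oo(G), X(Y f)(p) and Y(X f)(p) are the mixed derivatives of
   (v, u) |-> f (v u) at (p, 1) taken in the two possible orders. *)
Lemma bracket_left_right X Y : vector_field X -> vector_field Y ->
  (forall a, ltrans a X = X) -> (forall a, rtrans a Y = Y) -> bracket X Y = 0.
Proof.
move=> vX vY lX rY; apply/funext => f.
rewrite -[LHS]/(X (Y f) - Y (X f)).
have [sf|nf] := pselect (smooth_fun f); last first.
  by rewrite (vf_nonsmooth vX nf) (vf_nonsmooth vY nf) (vf0 vX) (vf0 vY) subr0.
apply/eqP; rewrite subr_eq0; apply/eqP/funext => p.
have XE g q : X g q = X (fun x => g (q * x)%g) 1%g.
  by rewrite -{1}(lX q) /ltrans /push /= mulVg.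
have YE g q x : Y g (q * x)%g = Y (fun y => g (y * x)%g) q.
  by rewrite -{1}(rY x) /rtrans /push /= mulgK.
have [c ac cp] := atlas_cover p; have [d ad d1] := atlas_cover (1 : G)%g.
have [w Hw] := tangent_chart (vX.1 1%g) ad d1.
have [w' Hw'] := tangent_chart (vY.1 p) ac cp.
pose Phi (uv : 'rV[R]_n * 'rV[R]_n) := f (chart_inv c uv.1 * chart_inv d uv.2)%g.
have H1 u : (X f \o chart_inv c) u = 'D_(0, w) Phi (u, chart_map d 1%g).
  rewrite /= XE Hw; last exact: smooth_fun_comp (smooth_map_mull _) _ sf.
  by rewrite -derive_slicel.
have H2 v : ((Y f \o (fun x => p * x)%g) \o chart_inv d) v =
    'D_(w', 0) Phi (chart_map c p, v).
  rewrite /= YE Hw'; last exact: smooth_fun_comp (smooth_map_mulr _) _ sf.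
  by rewrite -derive_slicer.
have -> : X (Y f) p = 'D_(0, w) ('D_(w', 0) Phi) (chart_map c p, chart_map d 1%g).
  rewrite XE Hw; last first.
    exact: smooth_fun_comp (smooth_map_mull _) _ (vf_smooth vY sf).
  by rewrite (funext H2) -derive_slicel.
have -> : Y (X f) p = 'D_(w', 0) ('D_(0, w) Phi) (chart_map c p, chart_map d 1%g).
  rewrite Hw'; last exact: vf_smooth.
  by rewrite (funext H1) -derive_slicer.
apply: derive_comm; exact: mulg_near_smooth.
Qed.

End LieGroups.

(** * Left invariant metrics *)

Section Metric.
Variables (R : realType) (n : nat) (M : manifoldType R n) (g : tensor2 R M).
Hypothesis rg : riemannian_metric g.
Implicit Types (f : M -> R) (X Y Z : operator R M).

Lemma metric_smooth X Y : vector_field X -> vector_field Y -> smooth_fun (g X Y).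
Proof. by case: rg => H _ _ _; exact: H. Qed.

Lemma metricC X Y : vector_field X -> vector_field Y -> g X Y = g Y X.
Proof. by case: rg => _ H _ _; exact: H. Qed.

Lemma metricMDl f X Y Z : smooth_fun f -> vector_field X -> vector_field Y ->
  vector_field Z -> g (fscale f X + Y) Z = f * g X Z + g Y Z.
Proof. by case: rg => _ _ H _; exact: H. Qed.

Lemma metricDl X Y Z : vector_field X -> vector_field Y -> vector_field Z ->
  g (X + Y) Z = g X Z + g Y Z.
Proof.
move=> vX vY vZ; have := metricMDl (smooth_fun_cst (M := M) 1) vX vY vZ.
by rewrite fscale_cst scale1r mul1r.
Qed.

Lemma metric0l Z : vector_field Z -> g 0 Z = 0.
Proof.
move=> vZ; have := metricDl (vector_field0 M) (vector_field0 M) vZ.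
by rewrite addr0 => /eqP; rewrite addrC -subr_eq subrr eq_sym => /eqP.
Qed.

Lemma metricMl f X Z : smooth_fun f -> vector_field X -> vector_field Z ->
  g (fscale f X) Z = f * g X Z.
Proof.
move=> sf vX vZ; have := metricMDl sf vX (vector_field0 M) vZ.
by rewrite addr0 metric0l // addr0.
Qed.

Lemma metricZl (a : R) X Z : vector_field X -> vector_field Z ->
  g (a *: X) Z = a *: g X Z.
Proof. by move=> vX vZ; have := metricMl (smooth_fun_cst (M := M) a) vX vZ. Qed.

Lemma metricBl X Y Z : vector_field X -> vector_field Y -> vector_field Z ->
  g (X - Y) Z = g X Z - g Y Z.
Proof.
move=> vX vY vZ; rewrite -(scaleN1r Y) metricDl //; last exact: vector_fieldZ.
by rewrite metricZl // scaleN1r.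
Qed.

Lemma metricDr X Y Z : vector_field X -> vector_field Y -> vector_field Z ->
  g Z (X + Y) = g Z X + g Z Y.
Proof.
move=> vX vY vZ; have vXY := vector_fieldD vX vY.
by rewrite (metricC vZ vXY) metricDl // (metricC vX vZ) (metricC vY vZ).
Qed.

Lemma metricZr (a : R) X Z : vector_field X -> vector_field Z ->
  g Z (a *: X) = a *: g Z X.
Proof.
move=> vX vZ; have vaX := vector_fieldZ a vX.
by rewrite (metricC vZ vaX) metricZl // (metricC vX vZ).
Qed.

Lemma metric_suml (I : Type) (r : seq I) (X : I -> operator R M) Z :
  (forall i, vector_field (X i)) -> vector_field Z ->
  g (\sum_(i <- r) X i) Z = \sum_(i <- r) g (X i) Z.
Proof.
move=> vX vZ; elim: r => [|i r IH]; first by rewrite !big_nil metric0l.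
by rewrite !big_cons metricDl ?IH //; exact: vector_field_sum.
Qed.

Lemma metric_eq0 X : vector_field X -> g X X = 0 -> X = 0.
Proof.
case: rg => _ _ _ pos vX gXX; apply/funext => f; apply/funext => p.
have [//|Xf] := eqVneq (X f p) 0.
have : 0 < g X X p by apply: pos => //; exists f.
by rewrite gXX ltxx.
Qed.

End Metric.

(** * Levi-Civita connection and the Koszul formula *)

Section LeviCivita.
Variables (R : realType) (n : nat) (M : manifoldType R n) (g : tensor2 R M).
Variable D : operator R M -> operator R M -> operator R M.
Hypothesis (rg : riemannian_metric g) (lcD : levi_civita g D).
Implicit Types (f : M -> R) (X Y Z : operator R M).

Lemma connection_vf X Y : vector_field X -> vector_field Y -> vector_field (D X Y).
Proof. by case: lcD => -[H _ _ _] _ _; exact: H. Qed.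

Lemma connectionDl X Y Z : vector_field X -> vector_field Y -> vector_field Z ->
  D (X + Y) Z = D X Z + D Y Z.
Proof.
case: lcD => -[_ H _ _] _ _ vX vY vZ.
have := H (cst 1) X Y Z (smooth_fun_cst 1) vX vY vZ.
by rewrite !fscale_cst !scale1r.
Qed.

Lemma connection0l Z : vector_field Z -> D 0 Z = 0.
Proof.
move=> vZ; have := connectionDl (vector_field0 M) (vector_field0 M) vZ.
by rewrite addr0 => /eqP; rewrite addrC -subr_eq subrr eq_sym => /eqP.
Qed.

Lemma connectionZl (a : R) X Z : vector_field X -> vector_field Z ->
  D (a *: X) Z = a *: D X Z.
Proof.
case: lcD => -[_ H _ _] _ _ vX vZ.
have := H (cst a) X 0 Z (smooth_fun_cst a) vX (vector_field0 M) vZ.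
by rewrite !fscale_cst connection0l // !addr0.
Qed.

Lemma connectionDr X Y Z : vector_field X -> vector_field Y -> vector_field Z ->
  D X (Y + Z) = D X Y + D X Z.
Proof. by case: lcD => -[_ _ H _] _ _; exact: H. Qed.

Lemma connectionZr (a : R) X Y : vector_field X -> vector_field Y ->
  D X (a *: Y) = a *: D X Y.
Proof.
case: lcD => -[_ _ _ H] _ _ vX vY.
have := H (cst a) X Y (smooth_fun_cst a) vX vY.
rewrite fscale_cst (vf_cst _ vX) => ->.
rewrite (_ : fscale 0 Y = 0) ?add0r //.
by apply/funext => f; apply/funext => p; rewrite /fscale mul0r.
Qed.

Lemma torsion_free X Y : vector_field X -> vector_field Y ->
  D X Y - D Y X = bracket X Y.
Proof. by case: lcD => _ H _; exact: H. Qed.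

Lemma metric_compat X Y Z : vector_field X -> vector_field Y -> vector_field Z ->
  X (g Y Z) = g (D X Y) Z + g Y (D X Z).
Proof. by case: lcD => _ _ H; exact: H. Qed.

(** A commutator of operators is a priori of second order; since it equals D X Y - D Y X, it is a
    difference of two vector fields. *)
Lemma bracket_vector_field X Y : vector_field X -> vector_field Y ->
  vector_field (bracket X Y).
Proof.
by move=> vX vY; rewrite -torsion_free //; apply: vector_fieldB; exact: connection_vf.
Qed.

Lemma koszul X Y Z : vector_field X -> vector_field Y -> vector_field Z ->
  g (D X Y) Z *+ 2 = X (g Y Z) + Y (g Z X) - Z (g X Y)
    + g (bracket X Y) Z - g (bracket Y Z) X + g (bracket Z X) Y.
Proof.
move=> vX vY vZ; have vD := connection_vf.
rewrite -!torsion_free // !(metricBl rg) //; try exact: vD.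
rewrite (metric_compat vX vY vZ) (metric_compat vY vZ vX) (metric_compat vZ vX vY).
rewrite (metricC rg vY (vD _ _ vX vZ)).
rewrite (metricC rg vZ (vD _ _ vY vX)) (metricC rg vX (vD _ _ vZ vY)).
apply/funext => p; rewrite !fctE mulr2n.
have key (a b c d e f : R) :
  a + a = a + b + (c + d) - (e + f) + (a - d) - (c - f) + (e - b) by ring.
exact: key.
Qed.

End LeviCivita.

(** * The Lie algebra of left invariant fields *)

Section LieAlgebraClosure.
Variables (R : realType) (n : nat) (G : lieGroupType R n).
Implicit Types (a : G) (X Y Z : operator R G).
Local Notation lie := (lie_algebra G).

Lemma lie_vf X : lie X -> vector_field X.
Proof. by case. Qed.

Lemma lie0 : lie 0.
Proof. by split=> [|a]; [exact: vector_field0|]. Qed.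

Lemma lieD X Y : lie X -> lie Y -> lie (X + Y).
Proof.
move=> [vX lX] [vY lY]; split=> [|a]; first exact: vector_fieldD.
by rewrite -[LHS]/(ltrans a X + ltrans a Y) lX lY.
Qed.

Lemma lieZ (t : R) X : lie X -> lie (t *: X).
Proof.
move=> [vX lX]; split=> [|a]; first exact: vector_fieldZ.
by rewrite -[LHS]/(t *: ltrans a X) lX.
Qed.

Lemma lieB X Y : lie X -> lie Y -> lie (X - Y).
Proof. by move=> lX lY; rewrite -scaleN1r; apply: lieD => //; exact: lieZ. Qed.

Lemma lie_sum (I : Type) (r : seq I) (X : I -> operator R G) :
  (forall i, lie (X i)) -> lie (\sum_(i <- r) X i).
Proof. by move=> H; elim/big_ind: _ => //; [exact: lie0|exact: lieD]. Qed.

Lemma ltrans_bracket a X Y : ltrans a (bracket X Y) = bracket (ltrans a X) (ltrans a Y).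
Proof. by apply: push_bracket => x; exact: mulKg. Qed.

Lemma lie_bracket_of X Y : vector_field (bracket X Y) -> lie X -> lie Y ->
  lie (bracket X Y).
Proof. by move=> vB [vX lX] [vY lY]; split=> // a; rewrite ltrans_bracket lX lY. Qed.

Lemma ltransK a X : ltrans a (ltrans a^-1%g X) = X.
Proof.
apply/funext => f; apply/funext => x; rewrite /ltrans /push /= !invgK mulVKg.
by congr (X _ _); apply/funext => y /=; rewrite mulVKg.
Qed.

Lemma ltransE a X f x : ltrans a X f (a * x)%g = X (fun y => f (a * y)%g) x.
Proof. by rewrite /ltrans /push /= mulKg. Qed.

Lemma lieE X f a x : lie X -> X f (a * x)%g = X (fun y => f (a * y)%g) x.
Proof. by move=> [_ lX]; rewrite -{1}(lX a) ltransE. Qed.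

Lemma lie_eq0_at X (p : G) : lie X -> (forall f, smooth_fun f -> X f p = 0) -> X = 0.
Proof.
move=> lX H; apply/funext => f; apply/funext => x.
have [sf|nf] := pselect (smooth_fun f); last by rewrite (vf_nonsmooth (lie_vf lX) nf).
rewrite (_ : x = (x * p^-1 * p)%g); last by rewrite mulgVK.
by rewrite lieE // H //; exact: smooth_fun_comp (smooth_map_mull _) _ sf.
Qed.

End LieAlgebraClosure.

Section LeftInvariantMetric.
Variables (R : realType) (n : nat) (G : lieGroupType R n) (g : tensor2 R G).
Hypothesis lg : left_invariant_metric g.
Implicit Types (a : G) (X Y Z : operator R G).
Local Notation lie := (lie_algebra G).

Let rg : riemannian_metric g. Proof. by case: lg. Qed.

Lemma metric_lie X Y : lie X -> lie Y -> g X Y = cst (scal g X Y).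
Proof.
move=> [vX lX] [vY lY]; apply/funext => x; have [_ H] := lg.
by have := H x X Y vX vY 1%g; rewrite lX lY mulg1.
Qed.

Lemma scalC X Y : lie X -> lie Y -> scal g X Y = scal g Y X.
Proof. by move=> /lie_vf vX /lie_vf vY; rewrite /scal (metricC rg). Qed.

Lemma scalDl X Y Z : lie X -> lie Y -> lie Z ->
  scal g (X + Y) Z = scal g X Z + scal g Y Z.
Proof. by move=> /lie_vf vX /lie_vf vY /lie_vf vZ; rewrite /scal (metricDl rg). Qed.

Lemma scalZl (t : R) X Z : lie X -> lie Z -> scal g (t *: X) Z = t * scal g X Z.
Proof. by move=> /lie_vf vX /lie_vf vZ; rewrite /scal (metricZl rg). Qed.

Lemma scalBl X Y Z : lie X -> lie Y -> lie Z ->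
  scal g (X - Y) Z = scal g X Z - scal g Y Z.
Proof. by move=> /lie_vf vX /lie_vf vY /lie_vf vZ; rewrite /scal (metricBl rg). Qed.

Lemma scalDr X Y Z : lie X -> lie Y -> lie Z ->
  scal g Z (X + Y) = scal g Z X + scal g Z Y.
Proof. by move=> /lie_vf vX /lie_vf vY /lie_vf vZ; rewrite /scal (metricDr rg). Qed.

Lemma scalZr (t : R) X Z : lie X -> lie Z -> scal g Z (t *: X) = t * scal g Z X.
Proof. by move=> /lie_vf vX /lie_vf vZ; rewrite /scal (metricZr rg). Qed.

Lemma scal0l Z : lie Z -> scal g 0 Z = 0.
Proof. by move=> /lie_vf vZ; rewrite /scal (metric0l rg). Qed.

Lemma scal_suml (I : Type) (r : seq I) (X : I -> operator R G) Z :
  (forall i, lie (X i)) -> lie Z ->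
  scal g (\sum_(i <- r) X i) Z = \sum_(i <- r) scal g (X i) Z.
Proof.
move=> lX lZ; elim: r => [|i r IH]; first by rewrite !big_nil scal0l.
by rewrite !big_cons scalDl ?IH //; exact: lie_sum.
Qed.

Lemma scal_sumr (I : Type) (r : seq I) (X : I -> operator R G) Z :
  (forall i, lie (X i)) -> lie Z ->
  scal g Z (\sum_(i <- r) X i) = \sum_(i <- r) scal g Z (X i).
Proof.
move=> lX lZ; rewrite scalC //; last exact: lie_sum.
by rewrite scal_suml //; apply: eq_bigr => i _; exact: scalC.
Qed.

Lemma scal_eq0 X : lie X -> scal g X X = 0 -> X = 0.
Proof.
move=> lX s0; apply: (metric_eq0 rg (lie_vf lX)).
by rewrite metric_lie // s0.
Qed.

Lemma metric_ltrans a X Y : vector_field X -> vector_field Y ->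
  (fun y => g (ltrans a X) (ltrans a Y) (a * y)%g) = g X Y.
Proof. by move=> vX vY; apply/funext => x; case: lg => _ ->. Qed.

Variable D : operator R G -> operator R G -> operator R G.
Hypothesis lcD : levi_civita g D.

(** Left translation is an isometry that respects brackets and derivatives of functions, so it
    preserves every term of the Koszul formula. *)
Lemma koszul_ltrans a X Y Z x : vector_field X -> vector_field Y -> vector_field Z ->
  g (D (ltrans a X) (ltrans a Y)) (ltrans a Z) (a * x)%g = g (D X Y) Z x.
Proof.
move=> vX vY vZ; apply: (@pmulrnI _ 2%N) => //.
have vl U : vector_field U -> vector_field (ltrans a U) by exact: ltrans_vector_field.
have K A B C y : vector_field A -> vector_field B -> vector_field C ->
    g (D A B) C y *+ 2 = A (g B C) y + B (g C A) y - C (g A B) y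
    + g (bracket A B) C y - g (bracket B C) A y + g (bracket C A) B y.
  by move=> vA vB vC; exact: (congr1 (@^~ y) (koszul rg lcD vA vB vC)).
rewrite K ?K -?ltrans_bracket ?ltransE ?metric_ltrans //; try exact: vl.
have vB := bracket_vector_field lcD.
have E U V : vector_field U -> vector_field V ->
    g (ltrans a U) (ltrans a V) (a * x)%g = g U V x.
  by move=> vU vV; rewrite -[RHS](congr1 (@^~ x) (metric_ltrans a vU vV)).
by rewrite !E //; exact: vB.
Qed.

Lemma connection_lie X Y : lie X -> lie Y -> lie (D X Y).
Proof.
move=> [vX lX] [vY lY]; have vD := connection_vf lcD vX vY.
split=> // a; apply/eqP; rewrite -subr_eq0; apply/eqP.
have vlD := ltrans_vector_field a vD.
(* The difference is paired with itself, the second copy being written as the translate of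
   [ltrans a^-1 U] so that the equivariance of the Koszul formula applies. *)
pose U := ltrans a (D X Y) - D X Y.
have vU : vector_field U := vector_fieldB vlD vD.
apply: (metric_eq0 rg vU); rewrite -/U (metricBl rg) //.
have vU' := ltrans_vector_field a^-1%g vU.
apply/eqP; rewrite subr_eq0; apply/eqP/funext => y.
rewrite (_ : y = (a * (a^-1 * y))%g); last by rewrite mulVKg.
rewrite -(ltransK a U) -[LHS]/((fun y => g (ltrans a (D X Y)) (ltrans a (ltrans a^-1%g U)) (a * y)%g) _).
by rewrite metric_ltrans // -{2}(lX a) -{2}(lY a) koszul_ltrans.
Qed.

End LeftInvariantMetric.

(** * Expansion of vector fields in a left invariant frame *)

Section Frame.
Variables (R : realType) (n : nat) (G : lieGroupType R n) (g : tensor2 R G).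
Hypothesis lg : left_invariant_metric g.
Implicit Types (a : G) (X Y Z : operator R G).
Local Notation lie := (lie_algebra G).
Variable E : 'I_n -> operator R G.
Hypothesis hE : orthonormal_basis g lie E.

Let rg : riemannian_metric g. Proof. by case: lg. Qed.
Let lieE_ i : lie (E i). Proof. by case: hE. Qed.
Let vfE i : vector_field (E i). Proof. exact: lie_vf. Qed.

Lemma onb_scal i k : scal g (E i) (E k) = (i == k)%:R.
Proof. by case: hE. Qed.

Lemma onb_comb (c : 'I_n -> R) k : scal g (\sum_i c i *: E i) (E k) = c k.
Proof.
rewrite (scal_suml lg) //; last by move=> i; exact: lieZ.
rewrite (bigD1 k) //= (scalZl lg) // onb_scal eqxx mulr1 big1 ?addr0 // => i ik.
by rewrite (scalZl lg) // onb_scal (negbTE ik) mulr0.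
Qed.

Lemma onb_expand X : lie X -> X = \sum_i scal g X (E i) *: E i.
Proof.
case: hE => _ _ H /H[c ->]; apply: eq_bigr => i _; congr (_ *: _).
by rewrite -[LHS](onb_comb c i).
Qed.

Lemma lie_sumZ (c : 'I_n -> R) : lie (\sum_i c i *: E i).
Proof. by apply: lie_sum => i; exact: lieZ. Qed.

Lemma sum_opE (I : finType) (c : I -> R) (X : I -> operator R G) f p :
  (\sum_i c i *: X i) f p = \sum_i c i * X i f p.
Proof. by rewrite !fct_sumE. Qed.

(** A linear relation between the [E i] at one point spreads over the group by left invariance, and
    orthonormality then kills its coefficients. *)
Lemma frame_indep (c : 'I_n -> R) p :
  (forall f, smooth_fun f -> \sum_i c i * E i f p = 0) -> forall i, c i = 0.
Proof.
move=> H i; rewrite -(onb_comb c i) (_ : \sum_i c i *: E i = 0) ?(scal0l lg) //.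
apply: (@lie_eq0_at _ _ _ _ p); first exact: lie_sumZ.
by move=> f sf; rewrite sum_opE H.
Qed.

(** The frame has as many members as the charts have dimensions, so independence makes the matrix of
    its chart vectors invertible, and this inverse gives the coefficients. *)
Lemma frame_span V p : vector_field V ->
  exists c : 'I_n -> R, forall f, smooth_fun f -> V f p = \sum_i c i * E i f p.
Proof.
move=> vV; have [d ad dp] := atlas_cover p.
have [w Hw] : exists w : 'I_n -> 'rV[R]_n, forall i f, smooth_fun f ->
    E i f p = 'D_(w i) (f \o chart_inv d : 'rV[R]_n -> R) (chart_map d p).
  exists (fun i => sval (cid (tangent_chart ((vfE i).1 p) ad dp))) => i.
  exact: (svalP (cid (tangent_chart ((vfE i).1 p) ad dp))).
have [v Hv] := tangent_chart (vV.1 p) ad dp.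
have Dsum (c : 'I_n -> R) f : smooth_fun f ->
    'D_(\sum_i c i *: w i) (f \o chart_inv d : 'rV[R]_n -> R) (chart_map d p) =
    \sum_i c i * E i f p.
  move=> sf; have df := smooth_fun_diff sf ad dp.
  rewrite deriveE // linear_sum; apply: eq_bigr => i _.
  by rewrite Hw // deriveE // linearZ.
pose W := \matrix_i w i.
have WE (c : 'rV_n) : c *m W = \sum_i c ord0 i *: w i.
  by rewrite mulmx_sum_row; apply: eq_bigr => i _; rewrite rowK.
have : row_free W.
  apply: inj_row_free => c; rewrite WE => c0; apply/rowP => i; rewrite mxE.
  apply: (@frame_indep (fun i => c ord0 i) p) => f sf.
  by rewrite -Dsum // c0 derive0.
rewrite row_free_unit => uW.
exists (fun i => (v *m invmx W) ord0 i) => f sf.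
by rewrite Hv // -Dsum // -WE mulmxKV.
Qed.

(** As long as there are fewer than [n] functions, some nonzero combination of the [E i] annihilates
    all of them at [p]. As a tangent vector at [p] it is nonzero, so it detects a further function,
    which is appended. *)
Lemma separating_functions p k : (k <= n)%N ->
  exists f : 'I_k -> G -> R, (forall i, smooth_fun (f i)) /\
    row_free (\matrix_(j < k, i < n) E i (f j) p).
Proof.
elim: k => [|k IH] kn.
  exists (fun _ => cst 0); split; first by case.
  by rewrite -row_leq_rank.
have [f [sf rf]] := IH (ltnW kn).
set A := (\matrix_(_, _) _) in rf.
have [c c0 Ac] : exists2 c : 'cV[R]_n, c != 0 & A *m c = 0.
  have : kermx A^T != 0.
    rewrite kermx_eq0 /row_free mxrank_tr neq_ltn; apply/orP; left.
    exact: leq_ltn_trans (rank_leq_row _) kn.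
  move=> /rowV0Pn[v /sub_kermxP vA v0]; exists v^T.
    by apply: contra_neq v0 => /(congr1 trmx); rewrite trmxK trmx0.
  by apply: trmx_inj; rewrite trmx_mul trmxK vA trmx0.
have [h sh hc] : exists2 h, smooth_fun h & \sum_i c i ord0 * E i h p != 0.
  apply: contrapT => Hn; move/eqP: c0; apply; apply/colP => i; rewrite mxE.
  apply: (@frame_indep (fun i => c i ord0) p) => h sh.
  by apply/eqP; apply: contrapT => /negP hn; apply: Hn; exists h.
pose f' (j : 'I_(k + 1)) := match fintype.split j with inl j => f j | inr _ => h end.
rewrite -addn1; exists f'; split; first by move=> j; rewrite /f'; case: fintype.split.
rewrite (_ : \matrix_(_, _) _ = col_mx A (\row_i E i h p)); last first.
  apply/matrixP => j i; rewrite !mxE /f'; case: fintype.split => j'; rewrite !mxE //.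
apply: inj_row_free => u; rewrite -[u]hsubmxK mul_row_col => uA.
(* Multiplication by [c] kills the rows of [A] and leaves the last coefficient times the nonzero
   derivative of [h]. *)
have u2 : rsubmx u = 0.
  have := congr1 (fun x => x *m c) uA.
  rewrite mulmxDl mul0mx -!mulmxA Ac mulmx0 add0r => /rowP/(_ ord0).
  rewrite !mxE big_ord1 !mxE => /eqP; rewrite mulf_eq0 => /orP[/eqP u2|].
    by apply/rowP => i; rewrite !mxE (ord1 i) u2.
  rewrite (eq_bigr (fun i => c i ord0 * E i h p)) ?(negbTE hc) // => i _.
  by rewrite !mxE mulrC.
move: uA; rewrite u2 mul0mx addr0 => /eqP; rewrite mulmx_free_eq0 // => /eqP ->.
by rewrite row_mx0.
Qed.

Lemma smooth_det k (A : G -> 'M[R]_k) :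
  (forall i j, smooth_fun (fun x => A x i j)) -> smooth_fun (fun x => \det (A x)).
Proof.
move=> sA.
rewrite (_ : (fun x => _) = \sum_(s : 'S_k) ((-1) ^+ s) *: \prod_i (fun x => A x i (s i))).
  by apply: smooth_fun_sum => s _; apply: smooth_funZ; exact: smooth_fun_prod.
apply/funext => x; rewrite fct_sumE; apply: eq_bigr => s _.
by rewrite fctE fct_prodE.
Qed.

Lemma smooth_adj k (A : G -> 'M[R]_k) i j :
  (forall i j, smooth_fun (fun x => A x i j)) ->
  smooth_fun (fun x => (\adj (A x)) i j).
Proof.
move=> sA; rewrite (_ : (fun x => _) = (-1) ^+ (j + i) *:
   (fun x => \det (row' j (col' i (A x))))).
  apply: smooth_funZ; apply: smooth_det => a b.
  by rewrite (_ : (fun x => _) = fun x => A x (lift j a) (lift i b)) //;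
     apply/funext => x; rewrite !mxE.
by apply/funext => x; rewrite mxE.
Qed.

(** A metric is only known to be bilinear over smooth functions on global fields. The point is that
    g V (E i) at [p] is determined by the value of V at [p], so that it equals the coefficient of V
    there. *)
Lemma frame_expand V : vector_field V -> V = \sum_i fscale (g V (E i)) (E i).
Proof.
move=> vV.
suff key p (c : 'I_n -> R) : (forall f, smooth_fun f -> V f p = \sum_i c i * E i f p) ->
    forall i, g V (E i) p = c i.
  apply/funext => f; apply/funext => p; rewrite !fct_sumE.
  have [sf|nf] := pselect (smooth_fun f).
    have [c Hc] := frame_span p vV; rewrite Hc //; apply: eq_bigr => i _.
    by rewrite /fscale (key p c Hc).
  rewrite (vf_nonsmooth vV nf) big1 // => i _.
  by rewrite /fscale (vf_nonsmooth (vfE i) nf) mulr0.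
move=> Hc.
have [f [sf rf]] := separating_functions p (leqnn n).
pose A x := \matrix_(j, i) E i (f j) x.
pose b x := \col_j V (f j) x.
(* Using the adjugate instead of the inverse keeps the identity valid, and the coefficients smooth,
   at points where the determinant vanishes; it is divided out only at [p]. *)
have Ab x (c' : 'I_n -> R) : (forall f, smooth_fun f -> V f x = \sum_i c' i * E i f x) ->
    \adj (A x) *m b x = \det (A x) *: \col_i c' i.
  move=> Hc'; rewrite -mul_scalar_mx -mul_adj_mx -mulmxA; congr (_ *m _).
  apply/colP => j; rewrite !mxE Hc' //; apply: eq_bigr => i _.
  by rewrite !mxE mulrC.
have sA j i : smooth_fun (fun x => A x j i).
  rewrite (_ : (fun x => _) = E i (f j)); first exact: vf_smooth.
  by apply/funext => x; rewrite mxE.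
pose u i x := (\adj (A x) *m b x) i ord0.
have su i : smooth_fun (u i).
  rewrite (_ : u i = \sum_j (fun x => (\adj (A x)) i j) * V (f j)).
    apply: smooth_fun_sum => j _; apply: smooth_funM; last exact: vf_smooth.
    exact: smooth_adj.
  by apply/funext => x; rewrite /u mxE fct_sumE; apply: eq_bigr => j _; rewrite [b x _ _]mxE.
have sd : smooth_fun (fun x => \det (A x)) by exact: smooth_det.
have EV : fscale (fun x => \det (A x)) V = \sum_i fscale (u i) (E i).
  apply/funext => h; apply/funext => x; rewrite !fct_sumE /fscale.
  have [sh|nh] := pselect (smooth_fun h); last first.
    rewrite (vf_nonsmooth vV nh) mulr0 big1 // => i _.
    by rewrite (vf_nonsmooth (vfE i) nh) mulr0.
  have [c' Hc'] := frame_span x vV.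
  rewrite Hc' // mulr_sumr; apply: eq_bigr => i _.
  by rewrite /u (Ab x c' Hc') !mxE mulrA.
move=> m.
have := congr1 (fun X => g X (E m) p) EV.
rewrite /= (metricMl rg) // (metric_suml rg) //; last by move=> i; exact: vector_fieldM.
rewrite !fctE fct_sumE (bigD1 m) //= big1 => [|i im]; last first.
  rewrite (metricMl rg) // (metric_lie lg) // onb_scal (negbTE im) /=.
  by rewrite fctE mulr0.
rewrite (metricMl rg) // (metric_lie lg (lieE_ m) (lieE_ m)) onb_scal eqxx !fctE mulr1 addr0.
rewrite /u (Ab p c Hc) !mxE; apply: mulfI.
by move: rf; rewrite row_free_unit unitmxE unitfE.
Qed.

End Frame.

(** * Bi-invariant metrics *)

Section BiInvariant.
Variables (R : realType) (n : nat) (G : lieGroupType R n) (g : tensor2 R G).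
Hypothesis bg : bi_invariant_metric g.
Implicit Types (a : G) (X Y Z : operator R G).
Local Notation lie := (lie_algebra G).
Variable E : 'I_n -> operator R G.
Hypothesis hE : orthonormal_basis g lie E.
Hypothesis vfB : forall X Y, vector_field X -> vector_field Y ->
  vector_field (bracket X Y).

Let lg : left_invariant_metric g. Proof. by case: bg. Qed.
Let rg : riemannian_metric g. Proof. by case: lg. Qed.
Let lieE_ i : lie (E i). Proof. by case: hE. Qed.
Let vfE i : vector_field (E i). Proof. exact: lie_vf. Qed.

Lemma lie_bracket X Y : lie X -> lie Y -> lie (bracket X Y).
Proof. by move=> lX lY; apply: lie_bracket_of => //; apply: vfB; exact: lie_vf. Qed.

(** Inversion exchanges left and right translations, so this push-forward makes right invariant
    fields out of left invariant ones. *)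
Definition rinv (X : operator R G) : operator R G :=
  push (fun x : G => x^-1)%g (fun x : G => x^-1)%g X.

Lemma rinvK X : rinv (rinv X) = X.
Proof.
apply/funext => f; apply/funext => x; rewrite /rinv /push /= invgK.
by congr (X _ _); apply/funext => y /=; rewrite invgK.
Qed.

Lemma rinv_vf X : vector_field X -> vector_field (rinv X).
Proof. by apply: push_vector_field; [exact: invg_smooth|exact: invg_smooth|exact: invgK|exact: invgK]. Qed.

Lemma rtrans_rinv a X : lie X -> rtrans a (rinv X) = rinv X.
Proof.
move=> lX; apply/funext => f; apply/funext => x; rewrite /rtrans /rinv /push /=.
rewrite invgM invgK lieE //; congr (X _ _); apply/funext => y /=.
by rewrite invgM mulgVK.
Qed.

Lemma rtrans_eq0_at X : vector_field X -> (forall a, rtrans a X = X) ->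
  (forall f, smooth_fun f -> X f 1%g = 0) -> X = 0.
Proof.
move=> vX rX H; apply/funext => f; apply/funext => x.
have [sf|nf] := pselect (smooth_fun f); last by rewrite (vf_nonsmooth vX nf).
rewrite -(rX x) /rtrans /push /= mulgV H //.
exact: smooth_fun_comp (smooth_map_mulr _) _ sf.
Qed.

Lemma metric_rtrans_cst X Y : vector_field X -> vector_field Y ->
  (forall a, rtrans a X = X) -> (forall a, rtrans a Y = Y) ->
  g X Y = cst (g X Y 1%g).
Proof.
move=> vX vY rX rY; apply/funext => x; have [_ H] := bg.
by have := H x X Y vX vY 1%g; rewrite rX rY mul1g.
Qed.

(* The right invariant fields [Q k] commute with [X], and the functions
   [g (Q k) (Q l)] are constant; expanding the [Q k] in the frame [E] and
   differentiating these constants along [X] gives the skewness of [ad X]. *)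
Lemma ad_skew_frame X i k : lie X ->
  scal g (bracket X (E i)) (E k) + scal g (bracket X (E k)) (E i) = 0.
Proof.
move=> lX; have vX := lie_vf lX.
pose Q i := rinv (E i).
have vQ l : vector_field (Q l) by exact: rinv_vf.
have rQ l a : rtrans a (Q l) = Q l by exact: rtrans_rinv.
pose q l m := g (Q l) (E m).
have sq l m : smooth_fun (q l m) by exact: metric_smooth.
have QE l : Q l = \sum_m fscale (q l m) (E m) by exact: (frame_expand lg hE (vQ l)).
pose s m m' := scal g (bracket X (E m)) (E m').
have gQ V l : vector_field V -> g V (Q l) = \sum_m q l m * g V (E m).
  move=> vV; rewrite (metricC rg) // {1}QE (metric_suml rg) //; last first.
    by move=> m; exact: vector_fieldM.
  by apply: eq_bigr => m _; rewrite (metricMl rg) // (metricC rg).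
(* The relation [X, Q l] = 0, expanded in the frame, is paired with [Q l']. *)
have gXQ l l' : \sum_m X (q l m) * q l' m =
    - \sum_m q l m * \sum_m' q l' m' * cst (s m m').
  have : bracket X (Q l) = 0.
    by apply: bracket_left_right => //; case: lX.
  have -> : bracket X (Q l) = \sum_m (fscale (X (q l m)) (E m) + fscale (q l m) (bracket X (E m))).
    transitivity (\sum_m bracket X (fscale (q l m) (E m))); last first.
      by apply: eq_bigr => m _; exact: bracketMr.
    rewrite {1}QE; elim: (index_enum _) => [|m r IH].
      rewrite !big_nil; apply/funext => f.
      rewrite /bracket -[RHS]/(0 : G -> R).
      by rewrite -[LHS]/(X 0 - 0) (vf0 vX) subr0.
    rewrite !big_cons bracketDr ?IH //; first exact: vector_fieldM.
    by apply: vector_field_sum => m'; exact: vector_fieldM.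
  have vX1 m : vector_field (fscale (X (q l m)) (E m)).
    by apply: vector_fieldM => //; exact: vf_smooth.
  have vX2 m : vector_field (fscale (q l m) (bracket X (E m))).
    by apply: vector_fieldM => //; exact: vfB.
  move=> /(congr1 (fun V => g V (Q l'))).
  rewrite (metric0l rg) // (metric_suml rg) //; last first.
    by move=> m; exact: vector_fieldD.
  move=> /eqP; rewrite (eq_bigr (fun m => X (q l m) * q l' m +
       q l m * \sum_m' q l' m' * cst (s m m'))).
    by rewrite big_split addr_eq0 => /eqP.
  move=> m _; rewrite (metricDl rg) // !(metricMl rg) //; last 2 first.
  - exact: vfB.
  - exact: vf_smooth.
  rewrite (metricC rg (vfE m) (vQ l')); congr (_ + _ * _).
  rewrite gQ; last exact: vfB.
  apply: eq_bigr => m' _; congr (_ * _).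
  by rewrite (metric_lie lg) //; exact: lie_bracket.
pose P := \matrix_(l, m) q l m 1%g.
pose S := \matrix_(m, m') (s m m' + s m' m).
suff S0 : S = 0 by have := congr1 (fun A : 'M[R]_n => A i k) S0; rewrite !mxE.
(* This is the vanishing derivative along [X] of the constant g (Q l) (Q l'), the sum over m of
   [q l m * q l' m], evaluated at the neutral element. *)
have PSP : P *m S *m P^T = 0.
  apply/matrixP => l l'.
  have : X (g (Q l) (Q l')) = 0.
    by rewrite (metric_rtrans_cst (vQ l) (vQ l') (rQ l) (rQ l')) (vf_cst _ vX).
  rewrite gQ // vf_sum //; last by move=> m; apply: smooth_funM; exact: sq.
  rewrite (eq_bigr (fun m => q l' m * X (q l m) + q l m * X (q l' m))); last first.
    by move=> m _; rewrite vf_mul //; exact: sq.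
  rewrite big_split /=.
  rewrite (eq_bigr (fun m => X (q l m) * q l' m)); last by move=> m _; rewrite mulrC.
  rewrite [X in _ + X](eq_bigr (fun m => X (q l' m) * q l m)); last first.
    by move=> m _; rewrite mulrC.
  rewrite !gXQ -opprD => /eqP; rewrite oppr_eq0 => /eqP/(congr1 (@^~ 1%g)).
  rewrite !fctE !fct_sumE => H; rewrite [RHS]mxE -[RHS]H.
  rewrite mxE (eq_bigr (fun m' => \sum_m (q l m 1%g * s m m' * q l' m' 1%g + q l m 1%g * s m' m * q l' m' 1%g))).
    rewrite exchange_big /=.
    under eq_bigr do rewrite big_split /=.
    rewrite big_split /=; congr (_ + _).
      apply: eq_bigr => m _; rewrite !fctE fct_sumE mulr_sumr.
      by apply: eq_bigr => m' _; rewrite !fctE; ring.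
    rewrite exchange_big /=; apply: eq_bigr => m _; rewrite !fctE fct_sumE mulr_sumr.
    by apply: eq_bigr => m' _; rewrite !fctE; ring.
  move=> m' _; rewrite !mxE mulr_suml; apply: eq_bigr => m _; rewrite !mxE; ring.
(* A combination of the right invariant fields [Q l] vanishing at the neutral element vanishes
   everywhere, and inversion turns it back into a combination of the [E l]. *)
have uP : P \in unitmx.
  rewrite -row_free_unit; apply: inj_row_free => c cP.
  have Z0 : \sum_l c ord0 l *: Q l = 0.
    apply: rtrans_eq0_at; first by apply: vector_field_sum => l; exact: vector_fieldZ.
      move=> a; rewrite /rtrans push_sum; apply: eq_bigr => l _.
      by rewrite pushZ -/(rtrans a _) rQ.
    move=> f sf; rewrite sum_opE.
    transitivity (\sum_m (c *m P) ord0 m * E m f 1%g); last first.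
      by rewrite cP big1 // => m _; rewrite mxE mul0r.
    under [RHS]eq_bigr do rewrite mxE mulr_suml.
    rewrite exchange_big /=; apply: eq_bigr => l _.
    rewrite {1}QE !fct_sumE mulr_sumr; apply: eq_bigr => m _.
    by rewrite mxE /fscale mulrA.
  have : \sum_l c ord0 l *: E l = 0.
    rewrite -[LHS]rinvK /rinv [push _ _ (\sum_l _)]push_sum.
    by rewrite (_ : \sum_l _ = \sum_l c ord0 l *: Q l) // Z0.
  move=> c0; apply/rowP => l; rewrite mxE -(onb_comb lg hE (fun l => c ord0 l) l).
  by rewrite c0 (scal0l lg).
have uPT : P^T \in unitmx by rewrite unitmx_tr.
have := congr1 (fun A => invmx P *m (A *m invmx P^T)) PSP.
by rewrite mulmxK // mulKmx // mul0mx mulmx0.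
Qed.

Lemma ad_skew X Y Z : lie X -> lie Y -> lie Z ->
  scal g (bracket X Y) Z = - scal g Y (bracket X Z).
Proof.
move=> lX lY lZ; have vX := lie_vf lX.
have bE V : lie V -> bracket X V = \sum_i scal g V (E i) *: bracket X (E i).
  move=> lV; rewrite {1}(onb_expand lg hE lV).
  elim: (index_enum _) => [|m r IH].
    rewrite !big_nil; apply/funext => f.
    by rewrite /bracket -[LHS]/(X 0 - 0) (vf0 vX) subr0.
  rewrite !big_cons bracketDr ?bracketZr ?IH //; first exact: vector_fieldZ.
  by apply: vector_field_sum => m'; exact: vector_fieldZ.
have lb i : lie (bracket X (E i)) by exact: lie_bracket.
rewrite (bE Y) // (bE Z) // (scal_suml lg) //; last by move=> i; exact: lieZ.
rewrite (scal_sumr lg) //; last by move=> i; exact: lieZ.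
transitivity (\sum_i \sum_k scal g Y (E i) * scal g Z (E k) * scal g (bracket X (E i)) (E k)).
  apply: eq_bigr => i _; rewrite (scalZl lg) // {1}(onb_expand lg hE lZ).
  rewrite (scal_sumr lg) //; last by move=> k; exact: lieZ.
  by rewrite mulr_sumr; apply: eq_bigr => k _; rewrite (scalZr lg) // mulrA.
rewrite exchange_big -sumrN; apply: eq_bigr => k _ /=.
rewrite (scalZr lg) // {2}(onb_expand lg hE lY) (scal_suml lg) //; last first.
  by move=> i; exact: lieZ.
rewrite mulr_sumr -sumrN; apply: eq_bigr => i _; rewrite (scalZl lg) //.
have /eqP := ad_skew_frame i k lX; rewrite addr_eq0 => /eqP ->.
by rewrite (scalC lg (lieE_ i) (lb k)) mulrN [_ * scal g Z _]mulrC mulrA.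
Qed.

End BiInvariant.

(** * The adjoint action by isometries and automorphisms *)

Section Adjoint.
Variables (R : realType) (n : nat) (G : lieGroupType R n).
Implicit Types (a : G) (X Y Z : operator R G).
Local Notation lie := (lie_algebra G).

Lemma lie_rtrans a X : lie X -> lie (rtrans a X).
Proof.
move=> lX; split=> [|b]; first by apply: rtrans_vector_field; exact: lie_vf.
apply/funext => f; apply/funext => x; rewrite /ltrans /rtrans /push /=.
rewrite -mulgA (lieE _ b^-1%g _ lX); congr (X _ _); apply/funext => y /=.
by rewrite mulgA mulVKg.
Qed.

(** The left factor of a conjugation acts trivially on left invariant fields. What is left is a
    right translation, so right invariance of the metric makes [Ad a] an isometry of the Lie
    algebra. *)
Lemma Ad_rtrans a X : lie X -> Ad a X = rtrans a^-1%g X.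
Proof.
move=> lX; apply/funext => f; apply/funext => x; rewrite /Ad /rtrans /push /= invgK.
by rewrite (_ : (x * a)%g = a * (a^-1 * x * a))%g ?lieE // !mulgA mulgV mul1g.
Qed.

Lemma lie_Ad a X : lie X -> lie (Ad a X).
Proof. by move=> lX; rewrite Ad_rtrans //; exact: lie_rtrans. Qed.

Lemma Ad_bracket a X Y : Ad a (bracket X Y) = bracket (Ad a X) (Ad a Y).
Proof.
by apply: push_bracket => x; rewrite !mulgA mulVg mul1g mulgVK.
Qed.

Lemma scal_Ad (g : tensor2 R G) a X Y : bi_invariant_metric g -> lie X -> lie Y ->
  scal g (Ad a X) (Ad a Y) = scal g X Y.
Proof.
move=> [lg bg] lX lY; rewrite !Ad_rtrans //.
have := bg a^-1%g X Y (lie_vf lX) (lie_vf lY) 1%g.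
by rewrite (metric_lie lg) //; exact: lie_rtrans.
Qed.

End Adjoint.

(** * The Lie algebra of the torus *)

Section TorusSubalgebra.
Variables (R : realType) (n k : nat) (G : lieGroupType R n) (H : lieGroupType R k).
Variable iota : H -> G.
Local Notation h := (sub_lie_algebra iota).

Lemma sub_lie_algebra0 : h 0.
Proof. by split; [exact: lie0|exists 0 => //; exact: lie0]. Qed.

Lemma sub_lie_algebraD X Y : h X -> h Y -> h (X + Y).
Proof.
move=> [lX [X' lX' XX']] [lY [Y' lY' YY']]; split; first exact: lieD.
exists (X' + Y'); first exact: lieD.
by move=> f sf; rewrite -[LHS]/(X' (f \o iota) + Y' (f \o iota)) XX' // YY'.
Qed.

Lemma sub_lie_algebraZ (t : R) X : h X -> h (t *: X).
Proof.
move=> [lX [X' lX' XX']]; split; first exact: lieZ.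
exists (t *: X'); first exact: lieZ.
by move=> f sf; rewrite -[LHS]/(t *: X' (f \o iota)) XX'.
Qed.

(** In a commutative group a left invariant field is also right invariant, and left and right
    invariant fields commute. *)
Lemma commutative_bracket (Y1 Y2 : operator R H) : (forall x y : H, (x * y = y * x)%g) ->
  lie_algebra H Y1 -> lie_algebra H Y2 -> bracket Y1 Y2 = 0.
Proof.
move=> cH [v1 l1] [v2 l2]; apply: bracket_left_right => // a.
rewrite -[RHS](l2 a); apply/funext => f; apply/funext => x.
rewrite /rtrans /ltrans /push /= cH; congr (Y2 _ _).
by apply/funext => y /=; rewrite cH.
Qed.

(** Brackets of [iota]-related fields are [iota]-related, so the bracket vanishes at the image of
    the neutral element, hence everywhere by left invariance. *)
Lemma sub_lie_algebra_abelian X Y : (forall x y : H, (x * y = y * x)%g) ->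
  vector_field (bracket X Y) -> h X -> h Y -> bracket X Y = 0.
Proof.
move=> cH vB [lX [X' lX' XX']] [lY [Y' lY' YY']].
apply: (@lie_eq0_at _ _ _ _ (iota 1%g)); first exact: lie_bracket_of.
move=> f sf.
have E1 : (X (Y f)) \o iota = X' (Y' (f \o iota)).
  by rewrite YY' // XX' //; apply: vf_smooth => //; exact: lie_vf.
have E2 : (Y (X f)) \o iota = Y' (X' (f \o iota)).
  by rewrite XX' // YY' //; apply: vf_smooth => //; exact: lie_vf.
have := congr1 (fun V => V (f \o iota) 1%g) (commutative_bracket cH lX' lY').
by rewrite /bracket -[LHS]/(X' (Y' (f \o iota)) 1%g - Y' (X' (f \o iota)) 1%g) -E1 -E2.
Qed.

End TorusSubalgebra.

(** * Matrix form of the Ricci tensor *)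

Section RicciMatrix.
Variables (R : realFieldType) (n r : nat) (ad : 'cV[R]_n -> 'M[R]_n).
Implicit Types x y u v : 'cV[R]_n.
Hypothesis adD : forall x y : 'cV[R]_n, ad (x + y) = ad x + ad y.
Hypothesis adZ : forall (t : R) (x : 'cV[R]_n), ad (t *: x) = t *: ad x.
Hypothesis adC : forall x y, ad x *m y = - (ad y *m x).
Hypothesis adT : forall x, (ad x)^T = - ad x.
Hypothesis adJ : forall x y, ad (ad x *m y) = ad x *m ad y - ad y *m ad x.
Variables (Z j : 'I_r -> 'cV[R]_n).
Hypothesis ZZ : forall i k, (Z i)^T *m Z k = ((i == k)%:R)%:M.
Hypothesis adZZ : forall i k, ad (Z i) *m Z k = 0.
Hypothesis adZj : forall i k, ad (Z i) *m j k = 0.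
Hypothesis jZ : forall i k, (j i)^T *m Z k = 0.

(** This is the expansion of lambda(x) in the orthonormal [Z k], where the coefficient of [Z k]
    equals the scalar product of x with j_{Z_k}. *)
Definition lam_mx : 'M[R]_n := \sum_k Z k *m (j k)^T.
Local Notation L := lam_mx.
Local Notation J := (lam_mx^T).

Definition mixed_mx : 'M[R]_n := \sum_k ad (j k) *m ad (Z k).
Definition square_mx : 'M[R]_n := \sum_k ad (j k) *m ad (j k).
Local Notation N := mixed_mx.
Local Notation M := square_mx.

(* The bracket of the Lie algebra transported by Id + lambda. *)
Definition lam_ad (x : 'cV[R]_n) : 'M[R]_n :=
  (1%:M + L) *m ad ((1%:M - L) *m x) *m (1%:M - L).

Lemma mxtraceB p (A B : 'M[R]_p) : \tr (A - B) = \tr A - \tr B.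
Proof. exact: linearB. Qed.

Lemma mxtraceN p (A : 'M[R]_p) : \tr (- A) = - \tr A.
Proof. exact: linearN. Qed.

Lemma trmx_sum (I : Type) (s : seq I) p q (A : I -> 'M[R]_(p, q)) :
  (\sum_(i <- s) A i)^T = \sum_(i <- s) (A i)^T.
Proof. exact: linear_sum. Qed.

Lemma adN (x : 'cV[R]_n) : ad (- x) = - ad x.
Proof. by rewrite -scaleN1r adZ scaleN1r. Qed.

Lemma ad0 : ad 0 = 0.
Proof. by rewrite -(scale0r (0 : 'cV[R]_n)) adZ scale0r. Qed.

Lemma ad_sum (I : Type) (s : seq I) (x : I -> 'cV[R]_n) :
  ad (\sum_(i <- s) x i) = \sum_(i <- s) ad (x i).
Proof. by elim: s => [|i s IH]; rewrite ?big_nil ?ad0 // !big_cons adD IH. Qed.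

Lemma lam_trE : J = \sum_k j k *m (Z k)^T.
Proof.
by rewrite /lam_mx trmx_sum; apply: eq_bigr => k _; rewrite trmx_mul trmxK.
Qed.

Lemma adjZ i k : ad (j i) *m Z k = 0.
Proof. by rewrite adC adZj oppr0. Qed.

Lemma ad_comm i k : ad (j i) *m ad (Z k) = ad (Z k) *m ad (j i).
Proof.
by have := adJ (j i) (Z k); rewrite adjZ ad0 => /esym/eqP; rewrite subr_eq0 => /eqP.
Qed.

Lemma lamE x : L *m x = \sum_k Z k *m ((j k)^T *m x).
Proof. by rewrite /lam_mx mulmx_suml; apply: eq_bigr => k _; rewrite mulmxA. Qed.

Lemma col_mul1 (c : 'cV[R]_n) (t : 'M[R]_1) : c *m t = t ord0 ord0 *: c.
Proof. by rewrite {1}(mx11_scalar t) mul_mx_scalar. Qed.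

Lemma ad_lam x : ad (L *m x) = \sum_k ((j k)^T *m x) ord0 ord0 *: ad (Z k).
Proof. by rewrite lamE ad_sum; apply: eq_bigr => k _; rewrite col_mul1 adZ. Qed.

(** The matrix [ad (Z k)] is skew and kills every [j i], so its columns are orthogonal to the [j i].
    The relations up to [lam_tr_adj] likewise follow from [Z, Z] = [Z, j] = 0, directly or after
    transposition. *)
Lemma lam_adZ k : L *m ad (Z k) = 0.
Proof.
rewrite /lam_mx mulmx_suml big1 // => i _; rewrite -mulmxA.
by rewrite -[_ *m ad _]trmxK trmx_mul trmxK adT mulNmx adZj oppr0 trmx0 mulmx0.
Qed.

Lemma adZ_lam k : ad (Z k) *m L = 0.
Proof. by rewrite /lam_mx mulmx_sumr big1 // => i _; rewrite mulmxA adZZ mul0mx. Qed.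

Lemma adZ_lam_tr k : ad (Z k) *m J = 0.
Proof. by rewrite lam_trE mulmx_sumr big1 // => i _; rewrite mulmxA adZj mul0mx. Qed.

Lemma lam_tr_adZ k : J *m ad (Z k) = 0.
Proof. by rewrite -[LHS]trmxK trmx_mul trmxK adT mulNmx adZ_lam oppr0 trmx0. Qed.

Lemma adj_lam k : ad (j k) *m L = 0.
Proof. by rewrite /lam_mx mulmx_sumr big1 // => i _; rewrite mulmxA adjZ mul0mx. Qed.

Lemma lam_tr_adj k : J *m ad (j k) = 0.
Proof. by rewrite -[LHS]trmxK trmx_mul trmxK adT mulNmx adj_lam oppr0 trmx0. Qed.

Lemma lam_lam : L *m L = 0.
Proof.
rewrite {1}/lam_mx mulmx_suml big1 // => i _; rewrite /lam_mx mulmx_sumr big1 // => k _.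
by rewrite -mulmxA (mulmxA _ (Z k)) jZ mul0mx mulmx0.
Qed.

Lemma lam_unipotent : (1%:M - L) *m (1%:M + L) = 1%:M.
Proof. by rewrite mulmxDr mulmx1 mulmxBl mul1mx lam_lam subr0 subrK. Qed.

(** The columns of the right factor are multiples of the [Z k], on which [ad x] acts as [- ad (Z k)]
    applied to [x]; the left factor kills the range of [ad (Z k)]. The next two lemmas use the same
    exchange, the last one with the [j k] in place of the [Z k]. *)
Lemma lam_ad_lam x : L *m ad x *m L = 0.
Proof.
rewrite /lam_mx mulmx_sumr big1 // => k _; rewrite mulmxA -(mulmxA _ (ad x)) adC.
by rewrite mulmxN mulmxA lam_adZ mul0mx oppr0 mul0mx.
Qed.

Lemma lam_tr_ad_lam x : J *m ad x *m L = 0.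
Proof.
rewrite /lam_mx mulmx_sumr big1 // => k _; rewrite mulmxA -(mulmxA _ (ad x)) adC.
by rewrite mulmxN mulmxA lam_tr_adZ mul0mx oppr0 mul0mx.
Qed.

Lemma lam_tr_ad_lam_tr x : J *m ad x *m J = 0.
Proof.
rewrite {2}lam_trE mulmx_sumr big1 // => k _; rewrite mulmxA -(mulmxA _ (ad x)) adC.
by rewrite mulmxN mulmxA lam_tr_adj mul0mx oppr0 mul0mx.
Qed.

Lemma adlam_lam x : ad (L *m x) *m L = 0.
Proof.
rewrite ad_lam mulmx_suml big1 // => k _.
by rewrite -scalemxAl adZ_lam scaler0.
Qed.

Lemma lam_adlam x : L *m ad (L *m x) = 0.
Proof.
rewrite ad_lam mulmx_sumr big1 // => k _.
by rewrite -scalemxAr lam_adZ scaler0.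
Qed.

Lemma adlam_lam_tr x : ad (L *m x) *m J = 0.
Proof.
rewrite ad_lam mulmx_suml big1 // => k _.
by rewrite -scalemxAl adZ_lam_tr scaler0.
Qed.

Lemma lam_tr_adlam x : J *m ad (L *m x) = 0.
Proof.
rewrite ad_lam mulmx_sumr big1 // => k _.
by rewrite -scalemxAr lam_tr_adZ scaler0.
Qed.

Lemma lam_tr_lam : J *m L = \sum_k j k *m (j k)^T.
Proof.
rewrite lam_trE mulmx_suml; apply: eq_bigr => k _.
rewrite /lam_mx mulmx_sumr (bigD1 k) //= big1 => [|i ik].
  by rewrite -mulmxA (mulmxA _ (Z k)) ZZ eqxx mul1mx addr0.
by rewrite -mulmxA (mulmxA _ (Z i)) ZZ eq_sym (negbTE ik) mul_scalar_mx scale0r mulmx0.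
Qed.

Lemma lam_adE x : lam_ad x = (ad x - ad (L *m x)) + (L *m ad x - ad x *m L).
Proof.
rewrite /lam_ad mulmxBl mul1mx adD adN.
rewrite mulmxDl mul1mx [L *m (_ - _)]mulmxBr lam_adlam subr0.
by rewrite mulmxBr mulmx1 mulmxDl mulmxBl adlam_lam subr0 lam_ad_lam addr0 addrA.
Qed.

(** Since L L = 0, the inverse of 1 - L is 1 + L, so [lam_ad x] is conjugate to
    [ad ((1%:M - L) *m x)] by a matrix independent of [x]. *)
Lemma trace_lam_ad x y :
  \tr (lam_ad x *m lam_ad y) = \tr ((ad x - ad (L *m x)) *m (ad y - ad (L *m y))).
Proof.
have E u : ad u - ad (L *m u) = ad ((1%:M - L) *m u) by rewrite mulmxBl mul1mx adD adN.
rewrite !E /lam_ad -!mulmxA (mulmxA (1%:M - L)) lam_unipotent mul1mx.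
by rewrite mxtrace_mulC -!mulmxA lam_unipotent mulmx1.
Qed.

Lemma trace_ad x : \tr (ad x) = 0.
Proof.
have := congr1 mxtrace (adT x); rewrite mxtrace_tr mxtraceN => /eqP.
by rewrite -subr_eq0 opprK -mulr2n mulrn_eq0 => /eqP.
Qed.

(** This is unimodularity of the transported bracket: [lam_ad x] is conjugate to a skew matrix. *)
Lemma trace_lam_ad1 x : \tr (lam_ad x) = 0.
Proof.
by rewrite /lam_ad -mulmxA mxtrace_mulC -mulmxA lam_unipotent mulmx1 trace_ad.
Qed.

(** Write [lam_ad] as a skew part P plus V = L ad - ad L, and its transpose as - P plus U = J ad -
    ad J. The products of skew parts cancel between the two traces, the cross terms P V and U P have
    equal traces and opposite signs, and only U V remains. *)
Lemma trace_lam_ad_tr x y :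
  \tr (lam_ad x *m lam_ad y) + \tr ((lam_ad x)^T *m lam_ad y) =
  - \tr (L *m J *m ad x *m ad y) - \tr (J *m L *m ad y *m ad x).
Proof.
have trA : (lam_ad x)^T = - (ad x - ad (L *m x)) + (J *m ad x - ad x *m J).
  have trB (A B : 'M[R]_n) : (A - B)^T = A^T - B^T by exact: linearB.
  rewrite lam_adE [LHS]linearD /= !trB !trmx_mul !adT mulNmx mulmxN !opprK opprB.
  by congr (_ + _); rewrite addrC.
rewrite trace_lam_ad trA lam_adE.
have PV : \tr ((ad x - ad (L *m x)) *m (L *m ad y - ad y *m L)) =
    \tr (L *m ad y *m ad x) - \tr (L *m ad x *m ad y).
  rewrite mulmxBl !mulmxBr !mxtraceB (mulmxA (ad (L *m x)) L) adlam_lam mul0mx.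
  rewrite mxtrace0 sub0r opprK [\tr (ad (L *m x) *m _)]mxtrace_mulC -(mulmxA (ad y) L).
  rewrite lam_adlam mulmx0 mxtrace0 addr0 [\tr (_ *m (L *m _))]mxtrace_mulC.
  by rewrite mulmxA [\tr (_ *m L)]mxtrace_mulC mulmxA.
have UP : \tr ((J *m ad x - ad x *m J) *m (ad y - ad (L *m y))) =
    \tr (L *m ad y *m ad x) - \tr (L *m ad x *m ad y).
  rewrite mulmxBl !mulmxBr !mxtraceB.
  rewrite -[ad x *m J *m ad (L *m y)]mulmxA lam_tr_adlam mulmx0 mxtrace0 subr0.
  rewrite [\tr (J *m ad x *m ad (L *m y))]mxtrace_mulC mulmxA adlam_lam_tr mul0mx.
  rewrite mxtrace0 subr0; congr (_ - _); rewrite -mxtrace_tr !trmx_mul !adT trmxK.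
    by rewrite !mulNmx mulmxN opprK mulmxA mxtrace_mulC mulmxA.
  by rewrite mulNmx !mulmxN opprK mxtrace_mulC.
have UV : \tr ((J *m ad x - ad x *m J) *m (L *m ad y - ad y *m L)) =
    - \tr (L *m J *m ad x *m ad y) - \tr (J *m L *m ad y *m ad x).
  rewrite mulmxBl !mulmxBr !mxtraceB.
  rewrite (mulmxA (J *m ad x) L) lam_tr_ad_lam mul0mx mxtrace0 sub0r.
  rewrite -(mulmxA (ad x) J (ad y *m L)) (mulmxA J (ad y)) lam_tr_ad_lam mulmx0.
  rewrite mxtrace0 subr0; congr (- _ - _).
    by rewrite !mulmxA mxtrace_mulC !mulmxA.
  by rewrite mxtrace_mulC !mulmxA mxtrace_mulC !mulmxA.
have E (P U P' V : 'M[R]_n) : \tr ((- P + U) *m (P' + V)) =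
    - \tr (P *m P') - \tr (P *m V) + \tr (U *m P') + \tr (U *m V).
  by rewrite mulmxDl !mulmxDr !mulNmx !mxtraceD !mxtraceN !addrA.
by rewrite E PV UP UV; ring.
Qed.

(** This is the matrix of the bilinear form sending (y, v) to the scalar product of x with the
    transported bracket of y and v, as [lam_SE] shows. *)
Definition lam_S x : 'M[R]_n := ad x *m L + J *m ad x - ad (x + J *m x).

Lemma form_tr (A : 'M[R]_n) x y : x^T *m (A *m y) = y^T *m (A^T *m x).
Proof.
have -> : y^T *m (A^T *m x) = (x^T *m (A *m y))^T.
  by rewrite !trmx_mul trmxK mulmxA.
by apply/matrixP => a b; rewrite [RHS]mxE !ord1.
Qed.

Lemma ad_tri x y v : x^T *m (ad y *m v) = - (y^T *m (ad x *m v)).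
Proof.
by rewrite adC mulmxN (form_tr (ad v)) adT mulNmx mulmxN opprK (adC v) mulmxN.
Qed.

Lemma lam_SE x y v : x^T *m (lam_ad y *m v) = y^T *m (lam_S x *m v).
Proof.
rewrite lam_adE.
have -> : x^T *m ((ad y - ad (L *m y) + (L *m ad y - ad y *m L)) *m v) =
    x^T *m (ad y *m v) - x^T *m (ad (L *m y) *m v) + ((J *m x)^T *m (ad y *m v)
    - x^T *m (ad y *m (L *m v))).
  by rewrite trmx_mul trmxK !(mulmxDl, mulmxBl, mulmxDr, mulmxBr, mulNmx, mulmxN) !mulmxA.
have -> : y^T *m (lam_S x *m v) = y^T *m (ad x *m (L *m v)) +
    (L *m y)^T *m (ad x *m v) - y^T *m (ad x *m v) - y^T *m (ad (J *m x) *m v).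
  rewrite /lam_S adD trmx_mul opprD addrA.
  by rewrite !(mulmxDl, mulmxBl, mulmxDr, mulmxBr, mulNmx, mulmxN) !mulmxA.
rewrite (ad_tri x y) (ad_tri x (L *m y)) (ad_tri (J *m x) y) (ad_tri x y (L *m v)).
move: (y^T *m _) (_ *m _) (y^T *m _) (y^T *m _) => a b c d.
by apply/matrixP => p q; rewrite !mxE; ring.
Qed.

Definition qform (A : 'M[R]_n) x y : R := \tr (x^T *m (A *m y)).

Lemma qform_tr (A : 'M[R]_n) x y : qform A x y = qform A^T y x.
Proof. by rewrite /qform form_tr. Qed.

Lemma qformD (A B : 'M[R]_n) x y : qform (A + B) x y = qform A x y + qform B x y.
Proof. by rewrite /qform mulmxDl mulmxDr mxtraceD. Qed.

Lemma qformZ t (A : 'M[R]_n) x y : qform (t *: A) x y = t * qform A x y.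
Proof. by rewrite /qform -scalemxAl -scalemxAr mxtraceZ. Qed.

Lemma mixed_tr : N^T = N.
Proof.
rewrite /mixed_mx trmx_sum; apply: eq_bigr => k _.
by rewrite trmx_mul !adT mulNmx mulmxN opprK ad_comm.
Qed.

Lemma lam_mixed : L *m N = 0.
Proof.
rewrite /mixed_mx mulmx_sumr big1 // => k _.
by rewrite ad_comm mulmxA lam_adZ mul0mx.
Qed.

(** By cyclicity the trace is the sum of the scalar products of j_k with [u, [y, Z_k]]; antisymmetry
    and skewness of [ad] move the brackets onto [j k] and [Z k]. *)
Lemma trace_ad_lam u y : \tr (ad u *m ad y *m L) = qform N u y.
Proof.
rewrite /qform /mixed_mx /lam_mx mulmx_sumr mulmx_suml mulmx_sumr !linear_sum /=.
apply: eq_bigr => k _; rewrite mulmxA mxtrace_mulC -!mulmxA (adC y) mulmxN.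
by rewrite mulmxN (ad_tri (j k) u) opprK.
Qed.

(** Of the nine products, the one without L and J as explicit factors gives the Killing trace. The
    four products of it with one explicit L or J each give the form of N, the two with both give the
    trace with L J, and those with L twice or J twice vanish. *)
Lemma trace_lam_S x y : \tr (lam_S x *m lam_S y) =
  \tr (ad (x + J *m x) *m ad (y + J *m y)) - qform N x y *+ 4 +
  \tr (L *m J *m ad x *m ad y) *+ 2.
Proof.
have E u v : \tr (ad u *m J *m ad v) = qform N u v.
  rewrite -trace_ad_lam -mxtrace_tr !trmx_mul !adT trmxK mulNmx !mulmxN opprK.
  by rewrite mxtrace_mulC [RHS]mxtrace_mulC mulmxA.
have F u v : qform N (u + J *m u) v = qform N u v.
  rewrite /qform linearD mulmxDl mxtraceD /= trmx_mul trmxK -mulmxA (mulmxA L).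
  by rewrite lam_mixed mul0mx mulmx0 mxtrace0 addr0.
have E1 u v : \tr (ad (u + J *m u) *m (ad v *m L)) = qform N u v.
  by rewrite mulmxA trace_ad_lam F.
have E2 u v : \tr (ad (u + J *m u) *m (J *m ad v)) = qform N u v.
  by rewrite mulmxA E F.
have E3 : \tr (ad x *m L *m (J *m ad y)) = \tr (L *m J *m ad x *m ad y).
  rewrite -mxtrace_tr !trmx_mul !adT trmxK !(mulmxN, mulNmx) opprK.
  by rewrite -!mulmxA mxtrace_mulC !mulmxA.
have E4 : \tr (J *m ad x *m (ad y *m L)) = \tr (L *m J *m ad x *m ad y).
  by rewrite mulmxA mxtrace_mulC !mulmxA.
have E5 : \tr (ad x *m L *m (ad y *m L)) = 0.
  by rewrite -(mulmxA (ad x)) (mulmxA L) lam_ad_lam mulmx0 mxtrace0.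
have E6 : \tr (J *m ad x *m (J *m ad y)) = 0.
  by rewrite mulmxA lam_tr_ad_lam_tr mul0mx mxtrace0.
have E7 u v : \tr (ad u *m L *m ad (v + J *m v)) = qform N v u.
  by rewrite mxtrace_mulC E1.
have E8 u v : \tr (J *m ad u *m ad (v + J *m v)) = qform N v u.
  by rewrite mxtrace_mulC E2.
have Ns : qform N y x = qform N x y by rewrite qform_tr mixed_tr.
rewrite /lam_S !(mulmxBl, mulmxBr, mulmxDl, mulmxDr).
rewrite !(mxtraceB, mxtraceD, mulmxN, mulNmx, mxtraceN) opprK E1 E2 E3 E4 E5 E6 E7 E8 Ns; ring.
Qed.

Lemma trace_square x y : \tr (J *m L *m ad y *m ad x) = qform M x y.
Proof.
rewrite lam_tr_lam /qform /square_mx !mulmx_suml mulmx_sumr !linear_sum /=.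
apply: eq_bigr => k _.
rewrite -!mulmxA mxtrace_mulC -!mulmxA (adC x) !mulmxN (ad_tri (j k) y) opprK.
rewrite (mulmxA (ad (j k)) _ x) form_tr trmx_mul !adT.
by rewrite mulNmx mulmxN opprK -mulmxA.
Qed.

Definition killing_mx : 'M[R]_n :=
  \matrix_(i, k) \tr (ad (delta_mx i ord0) *m ad (delta_mx k ord0)).
Local Notation K := killing_mx.

Lemma killingE x y : \tr (ad x *m ad y) = qform K x y.
Proof.
rewrite {1}(matrix_sum_delta x) {1}(matrix_sum_delta y).
under eq_bigr do rewrite big_ord1; under [X in _ *m ad X]eq_bigr do rewrite big_ord1.
rewrite !ad_sum mulmx_suml linear_sum /qform /mxtrace big_ord1 mxE /=.
apply: eq_bigr => i _; rewrite mxE mulmx_sumr linear_sum mxE mulr_sumr /=.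
apply: eq_bigr => k _; rewrite !adZ -scalemxAl -scalemxAr !mxtraceZ mxE.
ring.
Qed.

Definition lam_ricci_mx : 'M[R]_n :=
  - 4^-1 *: ((1%:M + L) *m K *m (1%:M + J)) + N + 2^-1 *: M.

(** The left side is the Ricci form of a unimodular metric Lie algebra, applied to the transported
    bracket. The traces of L J ad x ad y in its two terms cancel; the remaining trace of J L ad y ad
    x is the form of M, with coefficient 2/4. *)
Lemma lam_ricciE x y :
  - (4^-1 * \tr (lam_S x *m lam_S y)) -
  4^-1 * \tr ((lam_ad x + (lam_ad x)^T) *m (lam_ad y + (lam_ad y)^T)) =
  qform lam_ricci_mx x y.
Proof.
have -> : \tr ((lam_ad x + (lam_ad x)^T) *m (lam_ad y + (lam_ad y)^T)) =
    (\tr (lam_ad x *m lam_ad y) + \tr ((lam_ad x)^T *m lam_ad y)) *+ 2.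
  rewrite mulmxDl !mulmxDr !mxtraceD -[\tr ((lam_ad x)^T *m (lam_ad y)^T)]mxtrace_tr.
  rewrite -[\tr (lam_ad x *m (lam_ad y)^T)]mxtrace_tr !trmx_mul !trmxK.
  rewrite [\tr (lam_ad y *m lam_ad x)]mxtrace_mulC [\tr (lam_ad y *m _)]mxtrace_mulC.
  ring.
rewrite trace_lam_ad_tr trace_square trace_lam_S killingE.
have -> : qform lam_ricci_mx x y = - 4^-1 * qform K (x + J *m x) (y + J *m y) +
    qform N x y + 2^-1 * qform M x y.
  have E u : u + J *m u = (1%:M + J) *m u by rewrite mulmxDl mul1mx.
  have T : ((1%:M + J) *m x)^T = x^T *m (1%:M + L).
    by rewrite trmx_mul linearD /= trmx1 trmxK.
  rewrite /lam_ricci_mx !qformD !qformZ; congr (_ * _ + _ + _).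
  by rewrite /qform !E T !mulmxA.
by field.
Qed.

End RicciMatrix.

(** * Comparison of the norms *)

Section RicciNorm.
Variables (R : realFieldType) (n r : nat) (ad : 'cV[R]_n -> 'M[R]_n).
Implicit Types x y u v : 'cV[R]_n.
Hypothesis adD : forall x y : 'cV[R]_n, ad (x + y) = ad x + ad y.
Hypothesis adZ : forall (t : R) (x : 'cV[R]_n), ad (t *: x) = t *: ad x.
Hypothesis adC : forall x y, ad x *m y = - (ad y *m x).
Hypothesis adT : forall x, (ad x)^T = - ad x.
Hypothesis adJ : forall x y, ad (ad x *m y) = ad x *m ad y - ad y *m ad x.
Variable Z : 'I_r -> 'cV[R]_n.
Hypothesis ZZ : forall i k, (Z i)^T *m Z k = ((i == k)%:R)%:M.
Hypothesis adZZ : forall i k, ad (Z i) *m Z k = 0.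
Local Notation K := (killing_mx ad).

Lemma killing_tr : K^T = K.
Proof. by apply/matrixP => i k; rewrite !mxE mxtrace_mulC. Qed.

Section OneMap.
Variable j : 'I_r -> 'cV[R]_n.
Hypothesis adZj : forall i k, ad (Z i) *m j k = 0.
Local Notation L := (lam_mx Z j).
Local Notation N := (mixed_mx ad Z j).
Local Notation M := (square_mx ad j).
Local Notation Q := (lam_ricci_mx ad Z j).
Local Notation v := (fun k => j k + Z k).

Lemma square_tr : M^T = M.
Proof.
rewrite /square_mx trmx_sum; apply: eq_bigr => k _.
by rewrite trmx_mul !adT mulNmx mulmxN opprK.
Qed.

Lemma lam_ricci_tr : Q^T = Q.
Proof.
have T1 : (1%:M + L)^T = 1%:M + L^T by rewrite linearD /= trmx1.
have T2 : (1%:M + L^T)^T = 1%:M + L by rewrite -T1 trmxK.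
have trD (A B : 'M[R]_n) : (A + B)^T = A^T + B^T by exact: linearD.
have trZ t (A : 'M[R]_n) : (t *: A)^T = t *: A^T by exact: linearZ.
rewrite /lam_ricci_mx !trD !trZ (mixed_tr adZ adC adT adJ adZj) square_tr.
by rewrite !trmx_mul T1 T2 killing_tr mulmxA.
Qed.

Lemma sum_sq_qform :
  \sum_i \sum_k qform Q (delta_mx i ord0) (delta_mx k ord0) ^+ 2 = \tr (Q *m Q).
Proof.
rewrite /mxtrace; apply: eq_bigr => i _; rewrite mxE; apply: eq_bigr => k _.
have -> : Q k i = Q i k by rewrite -{1}lam_ricci_tr mxE.
rewrite -expr2; congr (_ ^+ 2).
rewrite /qform trmx_delta -rowE -colE.
by rewrite /mxtrace big_ord1 !mxE.
Qed.

(** J N, N L, J M and M L all vanish, so against N and M the factors 1 + L and 1 + J around K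
    disappear. In the square of the Killing term they combine, by cyclicity, to (1 + J)(1 + L). *)
Lemma trace_ricci_sq : \tr (Q *m Q) =
  16^-1 * \tr (K *m ((1%:M + L^T) *m (1%:M + L)) *m K *m ((1%:M + L^T) *m (1%:M + L)))
  + \tr (N *m N) + 4^-1 * \tr (M *m M) - 2^-1 * \tr (K *m N) - 4^-1 * \tr (K *m M)
  + \tr (N *m M).
Proof.
set W := (1%:M + L) *m K *m (1%:M + L^T).
have JN : L^T *m N = 0.
  rewrite /mixed_mx mulmx_sumr big1 // => k _.
  by rewrite mulmxA (lam_tr_adj adC adT adZj) mul0mx.
have NL : N *m L = 0.
  rewrite /mixed_mx mulmx_suml big1 // => k _.
  by rewrite -mulmxA (adZ_lam j adZZ) mulmx0.
have JM : L^T *m M = 0.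
  rewrite /square_mx mulmx_sumr big1 // => k _.
  by rewrite mulmxA (lam_tr_adj adC adT adZj) mul0mx.
have ML : M *m L = 0.
  rewrite /square_mx mulmx_suml big1 // => k _.
  by rewrite -mulmxA (adj_lam adC adZj) mulmx0.
have WA (A : 'M[R]_n) : L^T *m A = 0 -> A *m L = 0 -> \tr (W *m A) = \tr (K *m A).
  move=> JA AL; rewrite /W -mulmxA [(1%:M + L^T) *m A]mulmxDl mul1mx JA addr0 -mulmxA mxtrace_mulC.
  by rewrite -mulmxA mulmxDr mulmx1 AL addr0.
have WW : \tr (W *m W) = \tr (K *m ((1%:M + L^T) *m (1%:M + L)) *m K *m
    ((1%:M + L^T) *m (1%:M + L))).
  by rewrite /W -!mulmxA mxtrace_mulC !mulmxA.
rewrite -WW /lam_ricci_mx -/W !mulmxDl !mulmxDr -!scalemxAl -!scalemxAr.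
rewrite !mxtraceD !mxtraceZ (mxtrace_mulC N W) (mxtrace_mulC M W) (mxtrace_mulC M N).
by rewrite (WA N JN NL) (WA M JM ML); field.
Qed.

(** Completing the square turns L + J + J L into rank one matrices of the vectors j_k + Z_k, minus a
    part independent of [j]. Traces against K then become quadratic expressions in these vectors. *)
Lemma lam_gramE : (1%:M + L^T) *m (1%:M + L) =
  1%:M + (\sum_k v k *m (v k)^T - \sum_k Z k *m (Z k)^T).
Proof.
rewrite mulmxDl mul1mx mulmxDr mulmx1 (lam_tr_lam j ZZ) lam_trE /lam_mx -addrA.
congr (_ + _); rewrite -sumrB -!big_split /=; apply: eq_bigr => k _.
have key (a b c d : 'M[R]_n) : a + (b + c) = c + b + (a + d) - d.
  by rewrite [in RHS]addrA addrK addrC [b + c]addrC.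
rewrite linearD /= mulmxDl !mulmxDr; exact: key.
Qed.

End OneMap.

Variables j j' : 'I_r -> 'cV[R]_n.
Hypothesis adZj : forall i k, ad (Z i) *m j k = 0.
Hypothesis adZj' : forall i k, ad (Z i) *m j' k = 0.

(** These conditions abstract the matrices of the maps Ad_a that fix h pointwise: orthogonal
    automorphisms of the Lie algebra fixing the [Z k]. *)
Definition symmetry (U : 'M[R]_n) : Prop :=
  [/\ U^T *m U = 1%:M, forall x, ad (U *m x) = U *m ad x *m U^T &
      forall k, U *m Z k = Z k].

(** This is the hypothesis on lambda and lambda' at Z = Z_i + s Z_k. The conjugating matrix may
    depend on i, k and s; the values s = 0, 1, -1 suffice for the polarizations below. *)
Definition equivalent_on_pairs (w w' : 'I_r -> 'cV[R]_n) : Prop :=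
  forall i k (s : R), exists2 U, symmetry U & w i + s *: w k = U *m (w' i + s *: w' k).

Hypothesis jj' : equivalent_on_pairs j j'.

Lemma equivalent_single w w' i : equivalent_on_pairs w w' ->
  exists2 U, symmetry U & w i = U *m w' i.
Proof. by move=> ww; have [U sU] := ww i i 0; rewrite !scale0r !addr0; exists U. Qed.

Lemma equivalent_shift : equivalent_on_pairs (fun k => j k + Z k) (fun k => j' k + Z k).
Proof.
move=> i k s; have [U sU E] := jj' i k s; exists U => //.
rewrite /= !scalerDr addrACA E [in RHS]addrACA [in RHS]mulmxDr; congr (_ + _).
by case: sU => _ _ UZ; rewrite mulmxDr -scalemxAr !UZ.
Qed.

Lemma polarize (w w' : 'I_r -> 'cV[R]_n) (b : 'cV[R]_n -> 'cV[R]_n -> R) :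
  equivalent_on_pairs w w' ->
  (forall x y u, b (x + y) u = b x u + b y u) -> (forall x y, b x y = b y x) ->
  (forall U x y, symmetry U -> b (U *m x) (U *m y) = b x y) ->
  forall i k, b (w i) (w k) = b (w' i) (w' k).
Proof.
move=> ww bD bC bU i k.
have [U sU E] := ww i k 1; have [U1 sU1 E1] := equivalent_single i ww.
have [U2 sU2 E2] := equivalent_single k ww.
have sq x y : b (x + y) (x + y) = b x x + b x y *+ 2 + b y y.
  by rewrite bD !(bC _ (x + y)) !bD (bC y x) mulr2n !addrA.
have Ew : w i + w k = U *m (w' i + w' k) by move: E; rewrite !scale1r.
have q1 : b (w i) (w i) = b (w' i) (w' i) by rewrite E1 bU.
have q2 : b (w k) (w k) = b (w' k) (w' k) by rewrite E2 bU.
have := sq (w i) (w k); rewrite Ew bU // sq q1 q2 => /addIr/addrI/eqP.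
by rewrite eqr_pMn2r // => /eqP.
Qed.

Lemma symmetry_orth U : symmetry U -> U *m U^T = 1%:M.
Proof. by case=> /mulmx1C. Qed.

Lemma conj_mul U (A B : 'M[R]_n) : symmetry U ->
  (U *m A *m U^T) *m (U *m B *m U^T) = U *m (A *m B) *m U^T.
Proof. by case=> UU _ _; rewrite !mulmxA -(mulmxA (U *m A)) UU mulmx1. Qed.

Lemma conj_tr U (A : 'M[R]_n) : symmetry U -> \tr (U *m A *m U^T) = \tr A.
Proof. by case=> UU _ _; rewrite mxtrace_mulC mulmxA UU mul1mx. Qed.

Lemma symmetry_adZ U k : symmetry U -> ad (Z k) = U *m ad (Z k) *m U^T.
Proof. by case=> _ adU UZ; rewrite -adU UZ. Qed.

Lemma qform_mx (A B : 'M[R]_n) : (forall x y, qform A x y = qform B x y) -> A = B.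
Proof.
move=> H; apply/matrixP => i k; have := H (delta_mx i ord0) (delta_mx k ord0).
by rewrite /qform !trmx_delta -!rowE -!colE /mxtrace !big_ord1 !mxE.
Qed.

Lemma symmetry_killing U : symmetry U -> U^T *m K *m U = K.
Proof.
move=> sU; apply: qform_mx => x y; rewrite -(killingE adD adZ).
rewrite -[RHS](conj_tr _ sU) -conj_mul //; case: (sU) => _ adU _; rewrite -!adU.
by rewrite (killingE adD adZ) /qform trmx_mul !mulmxA.
Qed.

Lemma symmetry_killingE U : symmetry U -> K = U *m K *m U^T.
Proof.
move=> sU; rewrite -{2}(symmetry_killing sU) !mulmxA symmetry_orth // mul1mx.
by rewrite -mulmxA symmetry_orth // mulmx1.
Qed.

Lemma qform_conj U (A : 'M[R]_n) x y : symmetry U ->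
  qform (U *m A *m U^T) (U *m x) (U *m y) = qform A x y.
Proof.
case=> UU _ _; rewrite /qform trmx_mul !mulmxA -(mulmxA x^T U^T) UU mulmx1.
by rewrite -(mulmxA _ U^T U) UU mulmx1.
Qed.

Lemma qformDl (A : 'M[R]_n) x y u : qform A (x + y) u = qform A x u + qform A y u.
Proof. by rewrite /qform linearD mulmxDl mxtraceD. Qed.

Lemma qform_sym (A : 'M[R]_n) x y : A^T = A -> qform A x y = qform A y x.
Proof. by move=> AT; rewrite qform_tr AT. Qed.

Lemma adZ_comm i k : ad (Z i) *m ad (Z k) = ad (Z k) *m ad (Z i).
Proof.
by have := adJ (Z i) (Z k); rewrite adZZ (ad0 adZ) => /esym/eqP; rewrite subr_eq0 => /eqP.
Qed.

(** Each summand contains a single [j k], besides K and [Z k], which every symmetry preserves; a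
    different conjugation may thus be used for each k. The next lemma is similar. *)
Lemma trace_killing_mixed : \tr (K *m mixed_mx ad Z j) = \tr (K *m mixed_mx ad Z j').
Proof.
rewrite /mixed_mx !mulmx_sumr !linear_sum /=; apply: eq_bigr => k _.
have [U sU E] := equivalent_single k jj'; rewrite -[RHS](conj_tr _ sU) -!conj_mul //.
by rewrite -symmetry_killingE // -symmetry_adZ // E; case: sU => _ ->.
Qed.

Lemma trace_killing_square : \tr (K *m square_mx ad j) = \tr (K *m square_mx ad j').
Proof.
rewrite /square_mx !mulmx_sumr !linear_sum /=; apply: eq_bigr => k _.
have [U sU E] := equivalent_single k jj'; rewrite -[RHS](conj_tr _ sU) -!conj_mul //.
by rewrite -symmetry_killingE // E; case: sU => _ ->.
Qed.

(** The [ad (Z k)] commute with the [ad (j i)], so they can be collected on the right. With them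
    fixed, the trace is a form in the two [j] vectors, symmetric because transposition reverses the
    product and the [ad (Z k)] commute with each other; hence it can be polarized. *)
Lemma trace_mixed_sq :
  \tr (mixed_mx ad Z j *m mixed_mx ad Z j) = \tr (mixed_mx ad Z j' *m mixed_mx ad Z j').
Proof.
pose b l m x y := \tr (ad x *m ad y *m (ad (Z l) *m ad (Z m))).
have bE (w : 'I_r -> 'cV[R]_n) : (forall i k, ad (Z i) *m w k = 0) ->
    \tr (mixed_mx ad Z w *m mixed_mx ad Z w) = \sum_i \sum_k b i k (w i) (w k).
  move=> wZ; rewrite /mixed_mx mulmx_suml linear_sum; apply: eq_bigr => i _ /=.
  rewrite mulmx_sumr linear_sum; apply: eq_bigr => k _ /=; congr (\tr _).
  rewrite !mulmxA; congr (_ *m _); rewrite -!mulmxA; congr (_ *m _).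
  by rewrite -(ad_comm adZ adC adJ wZ).
rewrite !bE //; apply: eq_bigr => l _; apply: eq_bigr => m _.
apply: polarize => //.
- by move=> x y u; rewrite /b adD !mulmxDl mxtraceD.
- move=> x y; rewrite /b -mxtrace_tr !trmx_mul !adT !(mulNmx, mulmxN) !opprK.
  by rewrite mxtrace_mulC adZ_comm.
move=> U x y sU; rewrite /b -[RHS](conj_tr _ sU) -!conj_mul // -!symmetry_adZ //.
by case: sU => _ adU _; rewrite !adU.
Qed.

(* All terms of degree two in [w k] in the cubic form [x |-> tr (z ad(x)^3)]
   agree, because the trace is cyclic and [z] commutes with the [ad (w i)]. *)
Lemma trace_cubic (w : 'I_r -> 'cV[R]_n) l i k :
  (forall i k, ad (Z i) *m w k = 0) ->
  let f x := \tr (ad (Z l) *m (ad x *m (ad x *m ad x))) in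
  f (w i + 1 *: w k) + f (w i + -1 *: w k) =
  f (w i) *+ 2 + \tr (ad (Z l) *m (ad (w i) *m (ad (w k) *m ad (w k)))) *+ 6.
Proof.
move=> wZ f; rewrite /f scale1r scaleN1r !adD (adN adZ).
have cz m : ad (w m) *m ad (Z l) = ad (Z l) *m ad (w m) by apply: (ad_comm adZ adC adJ wZ).
set A := ad (w i); set B := ad (w k); set z := ad (Z l).
have rot (X Y T : 'M[R]_n) : T *m z = z *m T ->
    \tr (z *m (X *m (Y *m T))) = \tr (z *m (T *m (X *m Y))).
  by move=> Tz; rewrite !mulmxA mxtrace_mulC !mulmxA Tz.
have e1 : \tr (z *m (B *m (A *m B))) = \tr (z *m (A *m (B *m B))).
  by rewrite (rot A B B) ?cz.
have e2 : \tr (z *m (B *m (B *m A))) = \tr (z *m (A *m (B *m B))).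
  by rewrite (rot B B A) ?cz.
rewrite !(mulmxDl, mulmxDr, mulNmx, mulmxN) !(mxtraceD, mxtraceN, opprK) e1 e2.
ring.
Qed.

(** The values of the invariant cubic form f at j_i + j_k, j_i - j_k and j_i agree for the two maps.
    The symmetric combination removes the odd powers of j_k and leaves 6 times the required
    trace. *)
Lemma trace_mixed_square :
  \tr (mixed_mx ad Z j *m square_mx ad j) = \tr (mixed_mx ad Z j' *m square_mx ad j').
Proof.
have E (w : 'I_r -> 'cV[R]_n) : (forall i k, ad (Z i) *m w k = 0) ->
    \tr (mixed_mx ad Z w *m square_mx ad w) =
    \sum_i \sum_k \tr (ad (Z i) *m (ad (w i) *m (ad (w k) *m ad (w k)))).
  move=> wZ; rewrite /mixed_mx mulmx_suml linear_sum; apply: eq_bigr => i _ /=.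
  rewrite /square_mx mulmx_sumr linear_sum; apply: eq_bigr => k _ /=; congr (\tr _).
  by rewrite mulmxA (ad_comm adZ adC adJ wZ) !mulmxA.
rewrite !E //; apply: eq_bigr => i _; apply: eq_bigr => k _.
pose f x := \tr (ad (Z i) *m (ad x *m (ad x *m ad x))).
have fU U x : symmetry U -> f (U *m x) = f x.
  move=> sU; rewrite /f -[RHS](conj_tr _ sU) -!conj_mul // -symmetry_adZ //.
  by case: sU => _ adU _; rewrite !adU.
have [U1 s1 E1] := jj' i k 1; have [U2 s2 E2] := jj' i k (-1).
have [U3 s3 E3] := equivalent_single i jj'.
have C w (wZ : forall i k, ad (Z i) *m w k = 0) :
    f (w i + 1 *: w k) + f (w i + -1 *: w k) =
    f (w i) *+ 2 + \tr (ad (Z i) *m (ad (w i) *m (ad (w k) *m ad (w k)))) *+ 6.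
  exact: trace_cubic.
have q : f (j i) = f (j' i) by rewrite E3 fU.
have := C j adZj; rewrite E1 E2 !fU // (C j' adZj') q => /addrI/eqP.
by rewrite eqr_pMn2r // => /eqP.
Qed.

(** After expansion in the vectors v_k = j_k + Z_k only values of K K on one v_k, and squares of
    values of K on (v_k, v_l) or (v_k, Z_l), depend on [j]. The first and last kinds need one
    symmetry, which fixes the [Z l]; the middle kind is polarized. *)
Lemma trace_gram :
  let P w := (1%:M + (lam_mx Z w)^T) *m (1%:M + lam_mx Z w) in
  \tr (K *m P j *m K *m P j) = \tr (K *m P j' *m K *m P j').
Proof.
move=> P.
pose T w := \sum_k (w k + Z k) *m (w k + Z k)^T - \sum_k Z k *m (Z k)^T : 'M[R]_n.
have E w : P w = 1%:M + T w by exact: lam_gramE.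
have X (A : 'M[R]_n) : \tr (K *m (1%:M + A) *m K *m (1%:M + A)) =
    \tr (K *m K) + \tr (K *m K *m A) *+ 2 + \tr (K *m A *m K *m A).
  rewrite !(mulmxDr, mulmx1, mulmxDl) !mxtraceD [\tr (K *m A *m K)]mxtrace_mulC.
  by rewrite [K *m (K *m A)]mulmxA mulr2n !addrA.
have S1 (A : 'M[R]_n) (c : 'I_r -> 'cV[R]_n) :
    \tr (A *m \sum_k c k *m (c k)^T) = \sum_k qform A (c k) (c k).
  rewrite mulmx_sumr linear_sum; apply: eq_bigr => k _ /=.
  by rewrite mulmxA mxtrace_mulC.
have S2 (c d : 'I_r -> 'cV[R]_n) :
    \tr (K *m (\sum_k c k *m (c k)^T) *m K *m (\sum_k d k *m (d k)^T)) =
    \sum_k \sum_l qform K (c k) (d l) ^+ 2.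
  rewrite exchange_big S1; apply: eq_bigr => l _ /=.
  rewrite {1}/qform mulmx_sumr !mulmx_suml mulmx_sumr linear_sum; apply: eq_bigr => k _ /=.
  rewrite /qform; set t := (c k)^T *m (K *m d l).
  have -> : (d l)^T *m (K *m (c k *m (c k)^T) *m K *m d l) = t^T *m t.
    by rewrite /t !trmx_mul killing_tr trmxK !mulmxA.
  rewrite (mx11_scalar t) tr_scalar_mx -scalar_mxM !mxtrace_scalar.
  by rewrite !mulr1n expr2.
have X1 w : \tr (K *m K *m T w) = \sum_k qform (K *m K) (w k + Z k) (w k + Z k) -
    \sum_k qform (K *m K) (Z k) (Z k).
  by rewrite /T mulmxBr mxtraceB !S1.
have X2 w : \tr (K *m T w *m K *m T w) =
    \sum_k \sum_l qform K (w k + Z k) (w l + Z l) ^+ 2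
    - (\sum_k \sum_l qform K (w k + Z k) (Z l) ^+ 2) *+ 2
    + \sum_k \sum_l qform K (Z k) (Z l) ^+ 2.
  rewrite -!S2 /T; set A := \sum_k _; set B := \sum_k _.
  rewrite !(mulmxBr, mulmxBl) !mxtraceB.
  have -> : \tr (K *m B *m K *m A) = \tr (K *m A *m K *m B).
    by rewrite -!mulmxA mxtrace_mulC -!mulmxA mxtrace_mulC -!mulmxA.
  ring.
have KU U : symmetry U -> U *m (K *m K) *m U^T = K *m K.
  by move=> sU; rewrite -conj_mul // -!symmetry_killingE.
have vv := equivalent_shift.
rewrite (E j) (E j') (X (T j)) (X (T j')) (X1 j) (X1 j') (X2 j) (X2 j'); congr (_ + (_ - _) *+ 2 + (_ - _ *+ 2 + _)).
- apply: eq_bigr => k _; have [U sU ->] := equivalent_single k vv.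
  by rewrite -(KU U sU) qform_conj // KU.
- apply: eq_bigr => k _; apply: eq_bigr => l _; congr (_ ^+ 2).
  apply: (polarize vv); [exact: qformDl| |].
    by move=> x y; apply: qform_sym; exact: killing_tr.
  by move=> U x y sU; rewrite {1}(symmetry_killingE sU) qform_conj.
apply: eq_bigr => k _; apply: eq_bigr => l _; congr (_ ^+ 2).
have [U sU ->] := equivalent_single k vv; case: (sU) => _ _ UZ.
by rewrite {1}(symmetry_killingE sU) -{1}(UZ l) qform_conj.
Qed.

Lemma trace_square_sq (w : 'I_r -> 'cV[R]_n) :
  \tr (square_mx ad w *m square_mx ad w) =
  \sum_i \sum_k \tr (ad (w i) *m ad (w i) *m ad (w k) *m ad (w k)).
Proof.
rewrite /square_mx mulmx_suml linear_sum; apply: eq_bigr => i _ /=.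
rewrite mulmx_sumr linear_sum; apply: eq_bigr => k _ /=.
by rewrite mulmxA.
Qed.

Lemma lam_ricci_norm_diff :
  \sum_i \sum_k qform (lam_ricci_mx ad Z j) (delta_mx i ord0) (delta_mx k ord0) ^+ 2 -
  \sum_i \sum_k qform (lam_ricci_mx ad Z j') (delta_mx i ord0) (delta_mx k ord0) ^+ 2 =
  4^-1 * (\sum_i \sum_k \tr (ad (j i) *m ad (j i) *m ad (j k) *m ad (j k)) -
          \sum_i \sum_k \tr (ad (j' i) *m ad (j' i) *m ad (j' k) *m ad (j' k))).
Proof.
rewrite (sum_sq_qform adZj) (sum_sq_qform adZj').
rewrite (trace_ricci_sq adZj) (trace_ricci_sq adZj') trace_gram.
rewrite trace_killing_mixed trace_killing_square trace_mixed_sq trace_mixed_square.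
rewrite -!trace_square_sq; ring.
Qed.

End RicciNorm.

(** * Ricci tensor in an orthonormal frame *)

Section OrthonormalFrames.
Variables (R : realType) (n : nat) (G : lieGroupType R n) (g : tensor2 R G).
Hypothesis lg : left_invariant_metric g.
Implicit Types (X Y Z : operator R G).
Local Notation lie := (lie_algebra G).

Definition lie_bilinear (b : operator R G -> operator R G -> R) : Prop :=
  (forall (t : R) X Y Z, lie X -> lie Y -> lie Z ->
     b (t *: X + Y) Z = t * b X Z + b Y Z) /\
  (forall (t : R) X Y Z, lie X -> lie Y -> lie Z ->
     b Z (t *: X + Y) = t * b Z X + b Z Y).

Lemma lie_bilinear_sum b m (c c' : 'I_m -> R) (X : 'I_m -> operator R G) :
  lie_bilinear b -> (forall i, lie (X i)) ->
  b (\sum_i c i *: X i) (\sum_i c' i *: X i) = \sum_i \sum_k c i * c' k * b (X i) (X k).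
Proof.
move=> [bl br] lX.
have b0l Z : lie Z -> b 0 Z = 0.
  move=> lZ; have := bl 1 0 0 Z (lie0 G) (lie0 G) lZ.
  by rewrite scaler0 addr0 mul1r => /eqP; rewrite addrC -subr_eq subrr eq_sym => /eqP.
have b0r Z : lie Z -> b Z 0 = 0.
  move=> lZ; have := br 1 0 0 Z (lie0 G) (lie0 G) lZ.
  by rewrite scaler0 addr0 mul1r => /eqP; rewrite addrC -subr_eq subrr eq_sym => /eqP.
have lS (s : seq 'I_m) (d : 'I_m -> R) : lie (\sum_(i <- s) d i *: X i).
  by apply: lie_sum => i; exact: lieZ.
have sl (s : seq 'I_m) (d : 'I_m -> R) Z : lie Z ->
    b (\sum_(i <- s) d i *: X i) Z = \sum_(i <- s) d i * b (X i) Z.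
  move=> lZ; elim: s => [|i s IH]; first by rewrite !big_nil b0l.
  by rewrite !big_cons bl // IH.
have sr (s : seq 'I_m) (d : 'I_m -> R) Z : lie Z ->
    b Z (\sum_(i <- s) d i *: X i) = \sum_(i <- s) d i * b Z (X i).
  move=> lZ; elim: s => [|i s IH]; first by rewrite !big_nil b0r.
  by rewrite !big_cons br // IH.
rewrite sl //; apply: eq_bigr => i _; rewrite sr // mulr_sumr.
by apply: eq_bigr => k _; rewrite mulrA.
Qed.

(** The sum is the trace of [b] with respect to [g]: the matrix between two orthonormal bases is
    orthogonal. *)
Lemma onb_change (F F0 : 'I_n -> operator R G) b : lie_bilinear b ->
  orthonormal_basis g lie F -> orthonormal_basis g lie F0 ->
  \sum_i b (F i) (F i) = \sum_i b (F0 i) (F0 i).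
Proof.
move=> bb oF oF0.
have lF i : lie (F i) by case: oF.
have lF0 i : lie (F0 i) by case: oF0.
pose o i p := scal g (F i) (F0 p).
have oo p q : \sum_i o i p * o i q = (p == q)%:R.
  rewrite -(onb_scal oF0 p q) {1}(onb_expand lg oF (lF0 p)) (scal_suml lg) //; last first.
    by move=> i; exact: lieZ.
  by apply: eq_bigr => i _; rewrite (scalZl lg) // (scalC lg (lF0 p)).
transitivity (\sum_i \sum_p \sum_q o i p * o i q * b (F0 p) (F0 q)).
  apply: eq_bigr => i _; rewrite -lie_bilinear_sum //.
  by rewrite -(onb_expand lg oF0 (lF i)).
rewrite exchange_big /=; apply: eq_bigr => p _; rewrite exchange_big (bigD1 p) //=.
rewrite -mulr_suml oo eqxx mul1r big1 ?addr0 // => q qp.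
by rewrite -mulr_suml oo eq_sym (negbTE qp) mul0r.
Qed.

End OrthonormalFrames.

Section Ricci.
Variables (R : realType) (n : nat) (G : lieGroupType R n) (g : tensor2 R G).
Hypothesis lg : left_invariant_metric g.
Variable D : operator R G -> operator R G -> operator R G.
Hypothesis lcD : levi_civita g D.
Implicit Types (X Y Z : operator R G).
Local Notation lie := (lie_algebra G).

Let rg : riemannian_metric g. Proof. by case: lg. Qed.
Let lD X Y : lie X -> lie Y -> lie (D X Y). Proof. exact: (connection_lie lg lcD). Qed.
Let lB X Y : lie X -> lie Y -> lie (bracket X Y).
Proof. exact: (lie_bracket (bracket_vector_field lcD)). Qed.

Lemma scal_koszul X Y Z : lie X -> lie Y -> lie Z ->
  scal g (D X Y) Z *+ 2 =
  scal g (bracket X Y) Z - scal g (bracket Y Z) X + scal g (bracket Z X) Y.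
Proof.
move=> lX lY lZ; have [[vX vY] vZ] := (lie_vf lX, lie_vf lY, lie_vf lZ).
have : scal g (D X Y) Z *+ 2 = X (g Y Z) 1%g + Y (g Z X) 1%g - Z (g X Y) 1%g
    + scal g (bracket X Y) Z - scal g (bracket Y Z) X + scal g (bracket Z X) Y.
  exact: (congr1 (@^~ 1%g) (koszul rg lcD vX vY vZ)).
rewrite (metric_lie lg lY lZ) (metric_lie lg lZ lX) (metric_lie lg lX lY).
by rewrite (vf_cst _ vX) (vf_cst _ vY) (vf_cst _ vZ) addr0 subr0 add0r.
Qed.

Lemma connection_linl (t : R) X Y Z : lie X -> lie Y -> lie Z ->
  D (t *: X + Y) Z = t *: D X Z + D Y Z.
Proof.
move=> /lie_vf vX /lie_vf vY /lie_vf vZ.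
by rewrite (connectionDl lcD) ?(connectionZl lcD) //; exact: vector_fieldZ.
Qed.

Lemma connection_linr (t : R) X Y Z : lie X -> lie Y -> lie Z ->
  D Z (t *: X + Y) = t *: D Z X + D Z Y.
Proof.
move=> /lie_vf vX /lie_vf vY /lie_vf vZ.
by rewrite (connectionDr lcD) ?(connectionZr lcD) //; exact: vector_fieldZ.
Qed.

Lemma bracket_linr (t : R) X Y Z : lie X -> lie Y -> lie Z ->
  bracket Z (t *: X + Y) = t *: bracket Z X + bracket Z Y.
Proof.
move=> /lie_vf vX /lie_vf vY /lie_vf vZ.
by rewrite bracketDr ?bracketZr //; exact: vector_fieldZ.
Qed.

Lemma bracket_linl (t : R) X Y Z : lie X -> lie Y -> lie Z ->
  bracket (t *: X + Y) Z = t *: bracket X Z + bracket Y Z.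
Proof.
move=> lX lY lZ.
by rewrite bracketC bracket_linr // (bracketC X) (bracketC Y) opprD scalerN.
Qed.

Lemma lie_curvature X Y Z : lie X -> lie Y -> lie Z -> lie (curvature D X Y Z).
Proof.
by move=> lX lY lZ; apply: lieB; [apply: lieB|]; do ?[exact: lD | apply: lD => // | exact: lB].
Qed.

Lemma curvature_lin1 (t : R) X X' Y Z : lie X -> lie X' -> lie Y -> lie Z ->
  curvature D (t *: X + X') Y Z = t *: curvature D X Y Z + curvature D X' Y Z.
Proof.
move=> lX lX' lY lZ; rewrite /curvature bracket_linl // !connection_linl //; try exact: lB; try exact: lD.
rewrite connection_linr //; try exact: lD.
have key (a b c d e h : operator R G) :
    t *: a + b - (t *: c + d) - (t *: e + h) = t *: (a - c - e) + (b - d - h).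
  by rewrite !scalerBr !opprD (addrACA (t *: a) b) (addrACA (t *: a - t *: c)).
exact: key.
Qed.

Lemma curvature_antisym X Y Z : lie X -> lie Y -> lie Z ->
  curvature D Y X Z = - curvature D X Y Z.
Proof.
move=> lX lY lZ; rewrite /curvature (bracketC Y X).
have -> : D (- bracket X Y) Z = - D (bracket X Y) Z.
  by rewrite -scaleN1r (connectionZl lcD (-1) (lie_vf (lB lX lY)) (lie_vf lZ)) scaleN1r.
by rewrite opprK opprB opprB addrC.
Qed.

Lemma curvature_lin3 (t : R) X Y Z Z' : lie X -> lie Y -> lie Z -> lie Z' ->
  curvature D X Y (t *: Z + Z') = t *: curvature D X Y Z + curvature D X Y Z'.
Proof.
move=> lX lY lZ lZ'; rewrite /curvature !connection_linr //; try exact: lB; try exact: lD.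
have key (a b c d e h : operator R G) :
    t *: a + b - (t *: c + d) - (t *: e + h) = t *: (a - c - e) + (b - d - h).
  by rewrite !scalerBr !opprD (addrACA (t *: a) b) (addrACA (t *: a - t *: c)).
exact: key.
Qed.

Definition ric (F : 'I_n -> operator R G) Y Z : R :=
  \sum_i scal g (curvature D (F i) Y Z) (F i).

Lemma ricci_cst F Y Z x : (forall i, lie (F i)) -> lie Y -> lie Z ->
  ricci g D F Y Z x = ric F Y Z.
Proof.
move=> lF lY lZ; rewrite /ricci fct_sumE; apply: eq_bigr => i _.
by rewrite (metric_lie lg) //; exact: lie_curvature.
Qed.

Lemma ric_bilinear F : (forall i, lie (F i)) -> lie_bilinear (ric F).
Proof.
move=> lF; split=> t X Y Z lX lY lZ; rewrite /ric mulr_sumr -big_split;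
  apply: eq_bigr => i _ /=.
  rewrite curvature_antisym //; last by apply: lieD => //; exact: lieZ.
  rewrite curvature_lin1 // opprD -scalerN -!curvature_antisym //.
  by rewrite (scalDl lg) ?(scalZl lg) //; try apply: lieZ; exact: lie_curvature.
rewrite curvature_lin3 //.
by rewrite (scalDl lg) ?(scalZl lg) //; try apply: lieZ; exact: lie_curvature.
Qed.

Lemma ric_frame F F0 Y Z : orthonormal_basis g lie F -> orthonormal_basis g lie F0 ->
  lie Y -> lie Z -> ric F Y Z = ric F0 Y Z.
Proof.
move=> oF oF0 lY lZ.
apply: (@onb_change _ _ _ g lg F F0 (fun X X' => scal g (curvature D X Y Z) X')) => //.
split=> t X X' V lX lX' lV.
  by rewrite curvature_lin1 // (scalDl lg) ?(scalZl lg) //; try apply: lieZ; exact: lie_curvature.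
have lC : lie (curvature D V Y Z) by exact: lie_curvature.
by rewrite (scalDr lg) ?(scalZr lg) //; exact: lieZ.
Qed.

(** The frame is exchanged three times: in the trace defining the Ricci form, then in each argument
    of its square, the square being a bilinear form on the diagonal in that argument. *)
Lemma normsq_frame F F0 x : orthonormal_basis g lie F -> orthonormal_basis g lie F0 ->
  normsq F (ricci g D F) x = \sum_i \sum_k ric F0 (F0 i) (F0 k) ^+ 2.
Proof.
move=> oF oF0.
have lF i : lie (F i) by case: oF.
have lF0 i : lie (F0 i) by case: oF0.
have [bl br] := ric_bilinear lF0.
rewrite /normsq fct_sumE.
transitivity (\sum_i \sum_k ric F0 (F i) (F k) * ric F0 (F i) (F k)).
  apply: eq_bigr => i _; rewrite fct_sumE; apply: eq_bigr => k _.
  by rewrite fctE ricci_cst // (ric_frame oF oF0) // expr2.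
transitivity (\sum_i \sum_k ric F0 (F i) (F0 k) * ric F0 (F i) (F0 k)).
  apply: eq_bigr => i _.
  apply: (@onb_change _ _ _ g lg F F0 (fun X X' => ric F0 (F i) X * ric F0 (F i) X')) => //.
  by split=> t X Y V lX lY lV; rewrite br //; ring.
apply: (@onb_change _ _ _ g lg F F0 (fun X X' => \sum_k ric F0 X (F0 k) * ric F0 X' (F0 k))) => //.
split=> t X Y V lX lY lV; rewrite mulr_sumr -big_split; apply: eq_bigr => k _ /=.
  by rewrite bl //; ring.
by rewrite bl //; ring.
Qed.

Section StructureConstants.
Variable F : 'I_n -> operator R G.
Hypothesis oF : orthonormal_basis g lie F.
Hypothesis unimodular : forall i, \sum_k scal g (bracket (F i) (F k)) (F k) = 0.
Let lF i : lie (F i). Proof. by case: oF. Qed.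
Local Notation c i k m := (scal g (bracket (F i) (F k)) (F m)).

Definition ad_mx i : 'M[R]_n := \matrix_(m, k) c i k m.
(** Entry (m, k) is the component along [F i] of [F m, F k], so this is the matrix of a skew form
    and not of [ad (F i)]. *)
Definition coad_mx i : 'M[R]_n := \matrix_(m, k) c m k i.
(** Column i contains D (F i) (F k): the matrix belongs to the endomorphism sending X to D X (F k),
    with the differentiated field fixed. *)
Definition nabla_mx k : 'M[R]_n := \matrix_(m, i) scal g (D (F i) (F k)) (F m).

Lemma structure_antisym i k m : c i k m = - c k i m.
Proof.
have lb : lie (bracket (F k) (F i)) by exact: lB.
by rewrite bracketC -scaleN1r (scalZl lg) // mulN1r.
Qed.

Lemma nabla_mxE k :
  nabla_mx k = 2^-1 *: (coad_mx k - (ad_mx k + (ad_mx k)^T)).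
Proof.
apply/matrixP => m i; rewrite !mxE.
have /(canRL (mulfK _)) -> : scal g (D (F i) (F k)) (F m) * 2 =
    c i k m - c k m i + c m i k.
- by rewrite -scal_koszul // mulr_natr.
- by rewrite (structure_antisym i k); field.
- by rewrite pnatr_eq0.
Qed.

Lemma nabla_expand i k : D (F i) (F k) = \sum_m nabla_mx k m i *: F m.
Proof.
rewrite {1}(onb_expand lg oF (lD (lF i) (lF k))); apply: eq_bigr => m _.
by rewrite mxE.
Qed.

Lemma coad_mx_tr k : (coad_mx k)^T = - coad_mx k.
Proof. by apply/matrixP => m i; rewrite !mxE structure_antisym. Qed.

Lemma nabla_skew i k m : scal g (D (F i) (F k)) (F m) = - scal g (D (F i) (F m)) (F k).
Proof.
have E p q : scal g (D (F i) (F p)) (F q) * 2 = c i p q - c p q i + c q i p.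
  by rewrite -scal_koszul // mulr_natr.
apply: (@mulIf _ 2); first by rewrite pnatr_eq0.
rewrite mulNr !E (structure_antisym m i) (structure_antisym k i) (structure_antisym m k).
ring.
Qed.

Lemma scal_connection_sum X (d : 'I_n -> R) m : lie X ->
  scal g (D X (\sum_p d p *: F p)) (F m) = \sum_p d p * scal g (D X (F p)) (F m).
Proof.
move=> lX.
have -> : D X (\sum_p d p *: F p) = \sum_p d p *: D X (F p).
  elim: (index_enum _) => [|p s IH].
    rewrite !big_nil.
    have := connection_linr 1 (lie0 G) (lie0 G) lX.
    rewrite scaler0 addr0 scale1r => /eqP; rewrite -subr_eq subrr eq_sym.
    by move=> /eqP.
  rewrite !big_cons connection_linr ?IH //.
  by apply: lie_sum => q; exact: lieZ.
rewrite (scal_suml lg) //; last by move=> p; apply: lieZ; exact: lD.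
by apply: eq_bigr => p _; rewrite (scalZl lg) //; exact: lD.
Qed.

Lemma connection_sum_scal (d : 'I_n -> R) Y m : lie Y ->
  scal g (D (\sum_p d p *: F p) Y) (F m) = \sum_p d p * scal g (D (F p) Y) (F m).
Proof.
move=> lY.
have -> : D (\sum_p d p *: F p) Y = \sum_p d p *: D (F p) Y.
  elim: (index_enum _) => [|p s IH].
    by rewrite !big_nil (connection0l lcD) //; exact: lie_vf.
  rewrite !big_cons connection_linl ?IH //.
  by apply: lie_sum => q; exact: lieZ.
rewrite (scal_suml lg) //; last by move=> p; apply: lieZ; exact: lD.
by apply: eq_bigr => p _; rewrite (scalZl lg) //; exact: lD.
Qed.

Lemma ric_nabla i k : ric F (F i) (F k) =
  \tr ((nabla_mx k)^T *m (nabla_mx i + ad_mx i)) + \tr (nabla_mx k *m ad_mx i).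
Proof.
(* Left invariant fields have zero divergence: by the Koszul formula the divergence of [F m] is
   minus the trace of its adjoint map, which vanishes by unimodularity. *)
have T1 : \sum_p scal g (D (F p) (D (F i) (F k))) (F p) = 0.
  under eq_bigr do rewrite nabla_expand scal_connection_sum //.
  rewrite exchange_big big1 // => m _ /=; rewrite -mulr_sumr.
  have E p : scal g (D (F p) (F m)) (F p) = - c m p p.
    apply: (@mulIf _ 2); first by rewrite pnatr_eq0.
    rewrite mulr_natr scal_koszul // (structure_antisym p m) (structure_antisym p p).
    have : c p p m = 0.
      have := structure_antisym p p m; lra.
    by rewrite (structure_antisym p p) => E; lra.
  by under eq_bigr do rewrite E; rewrite sumrN unimodular oppr0 mulr0.
(* D (F i) is skew, and torsion-freeness replaces D (F i) (F p) by D (F p) (F i) + [F i, F p], which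
   is column p of [nabla_mx i + ad_mx i]. *)
have T2 p : scal g (D (F i) (D (F p) (F k))) (F p) =
    - \sum_m (nabla_mx k)^T p m * (nabla_mx i + ad_mx i) m p.
  rewrite nabla_expand scal_connection_sum // -sumrN; apply: eq_bigr => m _.
  rewrite [(nabla_mx k)^T _ _]mxE nabla_skew mulrN; congr (- (_ * _)).
  rewrite !mxE -(scalDl lg) //; [|exact: lD|exact: lB].
  have /eqP := torsion_free lcD (lie_vf (lF i)) (lie_vf (lF p)).
  by rewrite subr_eq addrC => /eqP ->.
have T3 p : scal g (D (bracket (F p) (F i)) (F k)) (F p) =
    - \sum_m nabla_mx k p m * ad_mx i m p.
  rewrite (onb_expand lg oF (lB (lF p) (lF i))) connection_sum_scal // -sumrN.
  apply: eq_bigr => m _; rewrite !mxE (structure_antisym p i) mulNr mulrC //.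
rewrite /ric /curvature.
transitivity (\sum_p (scal g (D (F p) (D (F i) (F k))) (F p)
    - scal g (D (F i) (D (F p) (F k))) (F p)
    - scal g (D (bracket (F p) (F i)) (F k)) (F p))).
  apply: eq_bigr => p _.
  have l1 := lD (lF p) (lD (lF i) (lF k)); have l2 := lD (lF i) (lD (lF p) (lF k)).
  have l3 := lD (lB (lF p) (lF i)) (lF k).
  by rewrite (scalBl lg (lieB l1 l2) l3) // (scalBl lg l1 l2).
rewrite !sumrB T1 sub0r /mxtrace; congr (_ + _); rewrite -sumrN; apply: eq_bigr => p _.
  by rewrite T2 opprK mxE.
by rewrite T3 opprK mxE.
Qed.

(** This is the classical formula for unimodular groups. As [coad_mx] is skew, the first term is 1/4
    of the sum over p, q of the products of the components of [F_p, F_q] along F_i and F_k. The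
    second is -1/2 of the sum over p of the scalar products of [F_i, F_p] and [F_k, F_p], minus half
    the Killing form. *)
Lemma ric_mx i k : ric F (F i) (F k) =
  - (4^-1 * \tr (coad_mx i *m coad_mx k)) -
  4^-1 * \tr ((ad_mx i + (ad_mx i)^T) *m (ad_mx k + (ad_mx k)^T)).
Proof.
rewrite ric_nabla !nabla_mxE.
set A := ad_mx i; set B := ad_mx k; set S := coad_mx i; set T := coad_mx k.
have ST : S^T = - S by exact: coad_mx_tr.
have TT : T^T = - T by exact: coad_mx_tr.
have trD (U V : 'M[R]_n) : (U + V)^T = U^T + V^T by exact: linearD.
have trZ t (U : 'M[R]_n) : (t *: U)^T = t *: U^T by exact: linearZ.
have trB (U V : 'M[R]_n) : (U - V)^T = U^T - V^T by exact: linearB.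
have e1 : \tr (T *m A^T) = - \tr (T *m A).
  by rewrite -mxtrace_tr trmx_mul trmxK TT mulmxN mxtraceN mxtrace_mulC.
have e2 : \tr (B^T *m S) = - \tr (B *m S).
  by rewrite -mxtrace_tr trmx_mul trmxK ST mulNmx mxtraceN mxtrace_mulC.
have e3 : \tr (B^T *m A) = \tr (B *m A^T).
  by rewrite -mxtrace_tr trmx_mul trmxK mxtrace_mulC.
have e4 : \tr (B^T *m A^T) = \tr (B *m A).
  by rewrite -mxtrace_tr trmx_mul !trmxK mxtrace_mulC.
rewrite (mxtrace_mulC S T) (mxtrace_mulC (A + A^T)) trZ trB trD trmxK TT.
rewrite -!(scalemxAl, scalemxAr) mulmxDr -!(scalemxAl, scalemxAr).
rewrite !(mxtraceZ, mxtraceD, mxtraceB, mxtraceN, mulmxDl, mulmxDr, mulNmx, mulmxN, opprK).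
by rewrite e1 e2 e3 e4; field.
Qed.

End StructureConstants.

End Ricci.

(** * Coordinates *)

Section Coordinates.
Variables (R : realType) (n : nat) (G : lieGroupType R n) (g0 : tensor2 R G).
Hypothesis bg : bi_invariant_metric g0.
Hypothesis vfB : forall X Y : operator R G, vector_field X -> vector_field Y ->
  vector_field (bracket X Y).
Variable E : 'I_n -> operator R G.
Hypothesis oE : orthonormal_basis g0 (lie_algebra G) E.
Implicit Types (X Y W : operator R G) (x y : 'cV[R]_n).
Local Notation lie := (lie_algebra G).

Let lg : left_invariant_metric g0. Proof. by case: bg. Qed.
Let lE i : lie (E i). Proof. by case: oE. Qed.
Let lB X Y : lie X -> lie Y -> lie (bracket X Y). Proof. exact: (lie_bracket vfB). Qed.

Definition coords X : 'cV[R]_n := \col_m scal g0 X (E m).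
Definition of_coords x : operator R G := \sum_i x i ord0 *: E i.
Definition ad_coords x : 'M[R]_n := \sum_i x i ord0 *: ad_mx g0 E i.
Definition op_mx (A : operator R G -> operator R G) : 'M[R]_n :=
  \matrix_(m, k) scal g0 (A (E k)) (E m).

Lemma lie_of_coords x : lie (of_coords x).
Proof. by apply: lie_sum => i; exact: lieZ. Qed.

Lemma coordsK X : lie X -> of_coords (coords X) = X.
Proof.
move=> lX; rewrite [RHS](onb_expand lg oE lX); apply: eq_bigr => i _.
by rewrite mxE.
Qed.

Lemma of_coordsK x : coords (of_coords x) = x.
Proof. by apply/colP => m; rewrite mxE (onb_comb lg oE). Qed.

Lemma coordsD X Y : lie X -> lie Y -> coords (X + Y) = coords X + coords Y.
Proof. by move=> lX lY; apply/colP => m; rewrite !mxE (scalDl lg). Qed.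

Lemma coordsZ (t : R) X : lie X -> coords (t *: X) = t *: coords X.
Proof. by move=> lX; apply/colP => m; rewrite !mxE (scalZl lg). Qed.

Lemma coordsB X Y : lie X -> lie Y -> coords (X - Y) = coords X - coords Y.
Proof. by move=> lX lY; apply/colP => m; rewrite !mxE (scalBl lg). Qed.

Lemma coords0 : coords 0 = 0.
Proof. by apply/colP => m; rewrite !mxE (scal0l lg). Qed.

Lemma coordsE i : coords (E i) = delta_mx i ord0.
Proof. by apply/colP => m; rewrite !mxE (onb_scal oE) eqxx andbT eq_sym. Qed.

Lemma coords_scal X Y : lie X -> lie Y -> (coords X)^T *m coords Y = (scal g0 X Y)%:M.
Proof.
move=> lX lY; rewrite [LHS]mx11_scalar; congr (_%:M); rewrite mxE.
rewrite -[in RHS](coordsK lY) /of_coords (scal_sumr lg) //; last first.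
  by move=> i; exact: lieZ.
by apply: eq_bigr => i _; rewrite (scalZr lg) // !mxE mulrC.
Qed.

Lemma op_mxE (A : operator R G -> operator R G) X :
  (forall Y, lie Y -> lie (A Y)) ->
  (forall (t : R) Y W, lie Y -> lie W -> A (t *: Y + W) = t *: A Y + A W) ->
  lie X -> coords (A X) = op_mx A *m coords X.
Proof.
move=> lA linA lX; have A0 : A 0 = 0.
  have := linA 1 0 0 (lie0 G) (lie0 G).
  by rewrite scaler0 addr0 scale1r => /eqP; rewrite -subr_eq subrr eq_sym => /eqP.
have -> : A X = \sum_i coords X i ord0 *: A (E i).
  rewrite -{1}(coordsK lX) /of_coords; elim: (index_enum _) => [|i s IH].
    by rewrite !big_nil.
  by rewrite !big_cons linA ?IH //; apply: lie_sum => k; exact: lieZ.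
apply/colP => m; rewrite !mxE (scal_suml lg) //; last by move=> i; apply: lieZ; exact: lA.
by apply: eq_bigr => i _; rewrite (scalZl lg) ?mxE 1?mulrC //; exact: lA.
Qed.

Lemma op_mx_bracket X : lie X -> op_mx (bracket X) = ad_coords (coords X).
Proof.
move=> lX; apply/matrixP => m k; rewrite mxE summxE.
rewrite -{1}(coordsK lX) bracketC /of_coords.
have -> : bracket (E k) (\sum_i coords X i ord0 *: E i) =
    \sum_i coords X i ord0 *: bracket (E k) (E i).
  elim: (index_enum _) => [|i s IH].
    rewrite !big_nil.
    have := bracket_linr 1 (lie0 G) (lie0 G) (lE k).
    by rewrite scaler0 addr0 scale1r => /eqP; rewrite -subr_eq subrr eq_sym => /eqP.
  by rewrite !big_cons bracket_linr ?IH //; apply: lie_sum => p; exact: lieZ.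
rewrite -sumrN (scal_suml lg) //; last first.
  by move=> i; rewrite -scalerN -bracketC; apply: lieZ; exact: lB.
by apply: eq_bigr => i _; rewrite -scalerN -bracketC (scalZl lg) ?mxE //; exact: lB.
Qed.

Lemma coords_bracket X Y : lie X -> lie Y ->
  coords (bracket X Y) = ad_coords (coords X) *m coords Y.
Proof.
move=> lX lY; rewrite -op_mx_bracket // -op_mxE // => [V lV|t V V' lV lV'].
  exact: lB.
exact: bracket_linr.
Qed.

Lemma coords_inj q (A B : 'M[R]_(q, n)) :
  (forall X, lie X -> A *m coords X = B *m coords X) -> A = B.
Proof.
move=> H; apply/matrixP => i k; have := H _ (lE k).
by rewrite coordsE -!colE => /colP/(_ i); rewrite !mxE.
Qed.

Lemma ad_coordsD x y : ad_coords (x + y) = ad_coords x + ad_coords y.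
Proof. by rewrite /ad_coords -big_split; apply: eq_bigr => i _; rewrite mxE scalerDl. Qed.

Lemma ad_coordsZ (t : R) x : ad_coords (t *: x) = t *: ad_coords x.
Proof. by rewrite /ad_coords scaler_sumr; apply: eq_bigr => i _; rewrite mxE scalerA. Qed.

Lemma ad_coordsC x y : ad_coords x *m y = - (ad_coords y *m x).
Proof.
rewrite -(of_coordsK x) -(of_coordsK y).
have lx := lie_of_coords x; have ly := lie_of_coords y.
rewrite -!coords_bracket // bracketC -scaleN1r coordsZ ?scaleN1r //; exact: lB.
Qed.

Lemma ad_coords_tr x : (ad_coords x)^T = - ad_coords x.
Proof.
rewrite /ad_coords trmx_sum -sumrN; apply: eq_bigr => i _.
rewrite linearZ -scalerN; congr (_ *: _); apply/matrixP => m k; rewrite !mxE.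
rewrite (ad_skew bg oE vfB) // (scalC lg) //; exact: lB.
Qed.

Lemma ad_coordsJ x y : ad_coords (ad_coords x *m y) =
  ad_coords x *m ad_coords y - ad_coords y *m ad_coords x.
Proof.
apply: coords_inj => X lX; rewrite mulmxBl -!mulmxA.
rewrite -(of_coordsK x) -(of_coordsK y).
have lx := lie_of_coords x; have ly := lie_of_coords y.
have [lxy [lxX lyX]] := (lB lx ly, (lB lx lX, lB ly lX)).
rewrite -!coords_bracket // -coordsB //; [|exact: lB|exact: lB].
by rewrite bracket_jacobi //; exact: lie_vf.
Qed.

Lemma trace_op_mx (A : operator R G -> operator R G) : trace g0 E A = \tr (op_mx A).
Proof. by apply: eq_bigr => i _; rewrite mxE. Qed.

Lemma trace_ad4 X Y : lie X -> lie Y ->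
  trace g0 E (ad X \o ad X \o ad Y \o ad Y) =
  \tr (ad_coords (coords X) *m ad_coords (coords X) *m ad_coords (coords Y)
       *m ad_coords (coords Y)).
Proof.
move=> lX lY; rewrite trace_op_mx; congr (\tr _); apply/matrixP => m k.
transitivity (coords ((ad X \o ad X \o ad Y \o ad Y) (E k)) m ord0).
  by rewrite !mxE.
have [l1 l2] := (lB lY (lE k), lB lY (lB lY (lE k))); have l3 := lB lX l2.
by rewrite /= /ad !coords_bracket // coordsE !mulmxA -colE mxE.
Qed.

Variable h : set (operator R G).
Hypothesis h_lie : forall X, h X -> lie X.
Hypothesis h0 : h 0.
Hypothesis h_abelian : forall X Y, h X -> h Y -> bracket X Y = 0.
Variables (r : nat) (Z : 'I_r -> operator R G).
Hypothesis oZ : orthonormal_basis g0 h Z.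

Let hZ i : h (Z i). Proof. by case: oZ. Qed.
Let lZ i : lie (Z i). Proof. exact: h_lie. Qed.
Local Notation z := (fun i => coords (Z i)).

Lemma coords_onb i k : (coords (Z i))^T *m coords (Z k) = ((i == k)%:R)%:M.
Proof. by rewrite coords_scal //; case: oZ => _ ->. Qed.

Lemma ad_coords_abelian i k : ad_coords (coords (Z i)) *m coords (Z k) = 0.
Proof. by rewrite -coords_bracket // h_abelian // coords0. Qed.

Section Map.
Variables l j : operator R G -> operator R G.
Hypothesis lin_l : linear_into l h.
Hypothesis l_kernel : forall X Y, h X ->
  orthogonal_complement g0 (centralizer h) Y -> l (X + Y) = 0.
Hypothesis hj : transpose_of g0 l j.
Local Notation w := (fun i => coords (j (Z i))).

Let hl X : lie X -> h (l X). Proof. by case: lin_l => _; exact. Qed.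
Let ll X : lie X -> lie (l X). Proof. by move=> /hl /h_lie. Qed.
Let lj X : lie X -> lie (j X). Proof. by case: hj => H _; exact: H. Qed.
Let jl X Y : lie X -> lie Y -> scal g0 (j X) Y = scal g0 X (l Y).
Proof. by case: hj => _; exact. Qed.

Lemma map_h X : h X -> l X = 0.
Proof.
move=> hX; rewrite -(addr0 X) l_kernel //; split; first exact: lie0.
by move=> Y [lY _]; rewrite (scal0l lg).
Qed.

(** By skewness, the scalar product of [X, Y] with V is minus that of Y with [X, V], which is zero
    when V centralizes h; thus [h, Lie(G)] lies in the orthogonal complement of the centralizer,
    where [l] vanishes. *)
Lemma map_bracket X Y : h X -> lie Y -> l (bracket X Y) = 0.
Proof.
move=> hX lY; rewrite -(add0r (bracket _ _)) l_kernel //.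
split; first by apply: lB => //; exact: h_lie.
move=> V [lV cV]; rewrite (ad_skew bg oE vfB) //; last exact: h_lie.
by rewrite bracketC cV // oppr0 (scalC lg lY (lie0 G)) (scal0l lg) // oppr0.
Qed.

(** With B = [Z_i, j(Z_k)], the squared norm of B is minus the scalar product of j(Z_k) with
    [Z_i, B], hence of Z_k with l([Z_i, B]) up to sign, and [l] kills brackets with h. *)
Lemma transpose_centralizes i k : bracket (Z i) (j (Z k)) = 0.
Proof.
have lb : lie (bracket (Z i) (j (Z k))) by apply: lB => //; exact: lj.
apply: (scal_eq0 lg) => //.
by rewrite (ad_skew bg oE vfB) ?jl ?map_bracket ?(scalC lg (lZ k) (lie0 G)) //;
  rewrite ?(scal0l lg) ?oppr0 //; try exact: lB; exact: lj.
Qed.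

Lemma coords_centralizes i k : ad_coords (coords (Z i)) *m coords (j (Z k)) = 0.
Proof. by rewrite -coords_bracket //; [rewrite transpose_centralizes coords0|exact: lj]. Qed.

Lemma coords_transpose_orth i k : (coords (j (Z i)))^T *m coords (Z k) = 0.
Proof.
rewrite coords_scal //; last exact: lj.
rewrite jl // map_h // (scalC lg) //; last exact: lie0.
by rewrite (scal0l lg) // raddf0.
Qed.

Lemma coords_map X : lie X -> coords (l X) = lam_mx z w *m coords X.
Proof.
move=> lX; rewrite lamE.
have -> : l X = \sum_k scal g0 (l X) (Z k) *: Z k.
  have [_ oZZ gen] := oZ; have [c Hc] := gen _ (hl lX).
  rewrite Hc; apply: eq_bigr => k _; congr (_ *: _).
  rewrite (scal_suml lg) //; last by move=> i; exact: lieZ.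
  rewrite (bigD1 k) //= (scalZl lg) // oZZ eqxx mulr1 big1 ?addr0 // => i ik.
  by rewrite (scalZl lg) // oZZ (negbTE ik) mulr0.
have -> : coords (\sum_k scal g0 (l X) (Z k) *: Z k) =
    \sum_k scal g0 (l X) (Z k) *: coords (Z k).
  elim: (index_enum _) => [|k s IH]; first by rewrite !big_nil coords0.
  rewrite !big_cons coordsD ?IH ?coordsZ //; first exact: lieZ.
  by apply: lie_sum => i; exact: lieZ.
apply: eq_bigr => k _; rewrite coords_scal //; last exact: lj.
by rewrite mul_mx_scalar jl // (scalC lg) //; exact: ll.
Qed.

Variable gl : tensor2 R G.
Hypothesis hgl : metric_of (fun X Y => scal g0 (X + l X) (Y + l Y)) gl.
Local Notation F0 := (fun i => E i - l (E i)).

Let lgl : left_invariant_metric gl. Proof. by case: hgl. Qed.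
Let lF0 i : lie (E i - l (E i)). Proof. by apply: lieB => //; exact: ll. Qed.

Lemma mapB X Y : lie X -> lie Y -> l (X - Y) = l X - l Y.
Proof.
case: lin_l => lin _ lX lY.
have := lin (-1) Y X lY lX; rewrite !scaleN1r => H.
by rewrite addrC H addrC.
Qed.

(** As [l] has values in h and vanishes there, Id - l inverts Id + l. The fields E_i - l(E_i) are
    therefore the preimage of the frame [E] under the isometry Id + l from g_lambda to g_0. *)
Lemma lam_frame_section i : F0 i + l (F0 i) = E i.
Proof.
by rewrite mapB ?(map_h (hl (lE i))) ?subr0 ?subrK //; exact: ll.
Qed.

Lemma lam_scal X i : lie X -> scal gl X (F0 i) = scal g0 (X + l X) (E i).
Proof. by move=> lX; case: hgl => _ ->; rewrite ?lam_frame_section. Qed.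

Lemma lam_frame_onb : orthonormal_basis gl lie F0.
Proof.
split=> [//|i k|X lX].
  by rewrite lam_scal // lam_frame_section (onb_scal oE).
have lY : lie (X + l X) by apply: lieD => //; exact: ll.
exists (fun i => scal g0 (X + l X) (E i)).
have -> : \sum_i scal g0 (X + l X) (E i) *: (E i - l (E i)) = (X + l X) - l (X + l X).
  rewrite {2 3}(onb_expand lg oE lY).
  have lin := lin_l.1; have l00 : l 0 = 0 by exact: map_h.
  elim: (index_enum _) => [|i s IH]; first by rewrite !big_nil l00 subr0.
  rewrite !big_cons lin //; last by apply: lie_sum => k; exact: lieZ.
  by rewrite IH scalerBr opprD addrACA.
have -> : l (X + l X) = l X + l (l X).
  by have := lin_l.1 1 X (l X) lX (ll lX); rewrite !scale1r.
by rewrite (map_h (hl lX)) addr0 addrK.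
Qed.

(** Components in the new frame for g_lambda are components in [E] for g_0 after applying Id + l.
    This accounts for the left factor of [lam_ad]; the two factors 1 - L come from the arguments of
    the bracket. *)
Lemma lam_ad_mx i : ad_mx gl F0 i = lam_ad ad_coords z w (delta_mx i ord0).
Proof.
apply/matrixP => m k; rewrite mxE lam_scal; last exact: lB.
set B := bracket _ _; have lB' : lie B by exact: lB.
transitivity (coords (B + l B) m ord0); first by rewrite mxE.
have cF p : coords (E p - l (E p)) = (1%:M - lam_mx z w) *m delta_mx p ord0.
  by rewrite mulmxBl mul1mx coordsB ?coords_map ?coordsE //; exact: ll.
rewrite coordsD ?coords_map //; last exact: ll.
rewrite -[X in X + _]mul1mx -mulmxDl /B coords_bracket // !cF.
have colK (A : 'M[R]_n) : A m k = (A *m (delta_mx k ord0 : 'cV[R]_n)) m ord0.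
  by rewrite -colE mxE.
by rewrite [RHS]colK /lam_ad -!mulmxA.
Qed.

Lemma lam_coad_mx i : coad_mx gl F0 i = lam_S ad_coords z w (delta_mx i ord0).
Proof.
apply/matrixP => m k.
transitivity (ad_mx gl F0 m i k); first by rewrite !mxE.
have SE := lam_SE ad_coordsD ad_coordsZ ad_coordsC ad_coords_tr ad_coords_abelian
  coords_centralizes (delta_mx i ord0) (delta_mx m ord0) (delta_mx k ord0).
move: SE; rewrite !trmx_delta -!rowE -!colE => /matrixP/(_ ord0 ord0).
by rewrite lam_ad_mx !mxE.
Qed.

Variable D : operator R G -> operator R G -> operator R G.
Hypothesis lcD : levi_civita gl D.

Lemma lam_normsq F (p : G) : orthonormal_basis gl lie F ->
  normsq F (ricci gl D F) p = \sum_i \sum_k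
    qform (lam_ricci_mx ad_coords z w) (delta_mx i ord0) (delta_mx k ord0) ^+ 2.
Proof.
move=> oF; rewrite (normsq_frame lgl lcD p oF lam_frame_onb).
have uni i : \sum_k scal gl (bracket (F0 i) (F0 k)) (F0 k) = 0.
  transitivity (\tr (ad_mx gl F0 i)); first by apply: eq_bigr => k _; rewrite mxE.
  rewrite lam_ad_mx; apply: trace_lam_ad1; [exact: ad_coords_tr|].
  exact: coords_transpose_orth.
apply: eq_bigr => i _; apply: eq_bigr => k _; congr (_ ^+ 2).
rewrite (ric_mx lgl lcD lam_frame_onb uni) !lam_coad_mx !lam_ad_mx.
apply: lam_ricciE.
- exact: ad_coordsD.
- exact: ad_coordsZ.
- exact: ad_coordsC.
- exact: ad_coords_tr.
- exact: ad_coordsJ.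
- exact: coords_onb.
- exact: ad_coords_abelian.
- exact: coords_centralizes.
- exact: coords_transpose_orth.
Qed.

End Map.

(** Orthogonality comes from the bi-invariance of the metric, and compatibility with [ad_coords]
    from [Ad a] being an automorphism of the bracket. *)
Lemma Ad_symmetry a : (forall X, h X -> Ad a X = X) ->
  symmetry ad_coords z (op_mx (Ad a)).
Proof.
move=> aZ.
have cA X : lie X -> coords (Ad a X) = op_mx (Ad a) *m coords X.
  by apply: op_mxE => // Y; exact: lie_Ad.
set O := op_mx (Ad a) in cA *.
have OO : O^T *m O = 1%:M.
  apply/matrixP => i k; rewrite !mxE -(onb_scal oE i k).
  have [li lk] := (lie_Ad a (lE i), lie_Ad a (lE k)).
  have := coords_scal li lk; rewrite (scal_Ad a bg) //.
  move=> /matrixP/(_ ord0 ord0); rewrite !mxE mulr1n => <-.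
  by apply: eq_bigr => m _; rewrite !mxE.
split=> // [x|k]; last by rewrite -cA // aZ.
suff H : ad_coords (O *m x) *m O = O *m ad_coords x.
  by rewrite -H -mulmxA (mulmx1C OO) mulmx1.
apply: coords_inj => X lX; rewrite -!mulmxA -cA // -(of_coordsK x).
have lx := lie_of_coords x; have [lax laX] := (lie_Ad a lx, lie_Ad a lX).
by rewrite -cA // -!coords_bracket // -cA ?Ad_bracket //; exact: lB.
Qed.

End Coordinates.

Theorem theorem3p14
  (R : realType) (n k r : nat)
  (* the compact Lie group G and its bi-invariant metric *)
  (G : lieGroupType R n) (compactG : compact [set: G])
  (g0 : tensor2 R G) (hg0 : bi_invariant_metric g0)
  (* the torus H in G, with Lie algebra h, and the subspace u *)
  (H : lieGroupType R k) (torusH : torus H)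
  (iota : H -> G) (subHG : lie_subgroup iota)
  (h : set (operator R G)) (def_h : h = sub_lie_algebra iota)
  (u : set (operator R G))
  (def_u : u = orthogonal_complement g0 (centralizer h))
  (Z : 'I_r -> operator R G) (hZ : orthonormal_basis g0 h Z)
  (* the linear maps lambda, lambda' and their transposes j, j' *)
  (l l' : operator R G -> operator R G)
  (lin_l : linear_into l h) (lin_l' : linear_into l' h)
  (l0 : forall X Y, h X -> u Y -> l (X + Y) = 0)
  (l0' : forall X Y, h X -> u Y -> l' (X + Y) = 0)
  (hll' : forall W, h W -> exists a : G,
     (forall X, lie_algebra G X -> scal g0 (l' X) W = scal g0 (l (Ad a X)) W) /\
     (forall X, h X -> Ad a X = X))
  (j j' : operator R G -> operator R G)
  (hj : transpose_of g0 l j) (hj' : transpose_of g0 l' j')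
  (* the metrics g_lambda, g_lambda' and their Levi-Civita connections *)
  (gl gl' : tensor2 R G)
  (hgl : metric_of (fun X Y => scal g0 (X + l X) (Y + l Y)) gl)
  (hgl' : metric_of (fun X Y => scal g0 (X + l' X) (Y + l' Y)) gl')
  (D D' : operator R G -> operator R G -> operator R G)
  (hD : levi_civita gl D) (hD' : levi_civita gl' D')
  (* orthonormal bases of the Lie algebra, used for traces and norms *)
  (E F F' : 'I_n -> operator R G)
  (hE : orthonormal_basis g0 (lie_algebra G) E)
  (hF : orthonormal_basis gl (lie_algebra G) F)
  (hF' : orthonormal_basis gl' (lie_algebra G) F') :
  forall x : G,
    normsq F (ricci gl D F) x - normsq F' (ricci gl' D' F') x =
    4^-1 *
      (\sum_i \sum_m trace g0 E
         (ad (j (Z i)) \o ad (j (Z i)) \o ad (j (Z m)) \o ad (j (Z m)))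
     - \sum_i \sum_m trace g0 E
         (ad (j' (Z i)) \o ad (j' (Z i)) \o ad (j' (Z m)) \o ad (j' (Z m)))).
Proof.
move=> p.
have vfB := bracket_vector_field hD.
have [lg0 _] := hg0; have [_ _ commH] := torusH.
have h_lie X : h X -> lie_algebra G X by rewrite def_h => -[].
have h0 : h 0 by rewrite def_h; exact: sub_lie_algebra0.
have hDZ (t : R) X Y : h X -> h Y -> h (X + t *: Y).
  rewrite def_h => hX hY; apply: sub_lie_algebraD => //; exact: sub_lie_algebraZ.
have h_ab X Y : h X -> h Y -> bracket X Y = 0.
  move=> hX hY; have vXY := vfB _ _ (lie_vf (h_lie _ hX)) (lie_vf (h_lie _ hY)).
  by move: hX hY; rewrite def_h; exact: sub_lie_algebra_abelian.
have hZ_ i : h (Z i) by case: hZ.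
have lZ i : lie_algebra G (Z i) by exact: h_lie.
have lE i : lie_algebra G (E i) by case: hE.
have [lj jl] := hj; have [lj' jl'] := hj'.
have ll X : lie_algebra G X -> lie_algebra G (l X) by move=> /(lin_l.2) /h_lie.
have ll' X : lie_algebra G X -> lie_algebra G (l' X) by move=> /(lin_l'.2) /h_lie.
rewrite def_u in l0 l0'.
rewrite (lam_normsq hg0 vfB hE h_lie h0 h_ab hZ lin_l l0 hj hgl hD p hF).
rewrite (lam_normsq hg0 vfB hE h_lie h0 h_ab hZ lin_l' l0' hj' hgl' hD' p hF').
pose z i := coords g0 E (Z i).
pose w i := coords g0 E (j (Z i)); pose w' i := coords g0 E (j' (Z i)).
have ww' : equivalent_on_pairs (ad_coords g0 E) z w w'.
  (* The hypothesis is used at W = Z_i + s Z_m, which lies in h; by linearity of the scalar product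
     j_W pairs with every vector as j(Z_i) + s j(Z_m) does. *)
  move=> i m s; have [a [aW aZ]] := hll' _ (hDZ s _ _ (hZ_ i) (hZ_ m)).
  have sO := Ad_symmetry hg0 vfB hE h_lie hZ aZ.
  exists (op_mx g0 E (Ad a)) => //; set O := op_mx _ _ _ in sO *.
  have cA X : lie_algebra G X -> coords g0 E (Ad a X) = O *m coords g0 E X.
    by apply: (op_mxE hg0 hE) => // Y; exact: lie_Ad.
  (* The identity lambda'_W = lambda_W o Ad_a dualizes to j'_W = (Ad_a)^T j_W, which is checked by
     pairing both sides with an arbitrary [X]. *)
  suff -> : w' i + s *: w' m = O^T *m (w i + s *: w m).
    by rewrite mulmxA (symmetry_orth sO) mul1mx.
  apply: trmx_inj; apply: (coords_inj hE) => X lX.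
  have lW : lie_algebra G (Z i + s *: Z m) by apply: h_lie; exact: hDZ.
  have lA := lie_Ad a lX; have [lsZ lsZ'] := (lieZ s (lZ m), lieZ s (lj' _ (lZ m))).
  have E1 : (w' i + s *: w' m)^T *m coords g0 E X =
      (scal g0 (Z i + s *: Z m) (l' X))%:M.
    rewrite /w' -(coordsZ hg0) -?(coordsD hg0) //; try exact: lj'.
    rewrite (coords_scal hg0 hE) //; last by apply: lieD => //; exact: lj'.
    rewrite !(scalDl lg0, scalZl lg0) ?jl' //; try exact: lj'; exact: ll'.
  have E2 : (w i + s *: w m)^T *m coords g0 E (Ad a X) =
      (scal g0 (Z i + s *: Z m) (l (Ad a X)))%:M.
    have lsj := lieZ s (lj _ (lZ m)).
    rewrite /w -(coordsZ hg0) -?(coordsD hg0) //; try exact: lj.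
    rewrite (coords_scal hg0 hE) //; last by apply: lieD => //; exact: lj.
    rewrite !(scalDl lg0, scalZl lg0) ?jl //; try exact: lj; exact: ll.
  rewrite E1 trmx_mul trmxK -mulmxA -cA // E2.
  by rewrite (scalC lg0 lW (ll' _ lX)) (scalC lg0 lW (ll _ lA)) aW.
have cen := coords_centralizes hg0 vfB hE h_lie h0 hZ l0 hj.
have cen' := coords_centralizes hg0 vfB hE h_lie h0 hZ l0' hj'.
have key := lam_ricci_norm_diff (ad_coordsD g0 E) (ad_coordsZ g0 E)
  (ad_coordsC hg0 vfB hE) (ad_coords_tr hg0 vfB hE) (ad_coordsJ hg0 vfB hE)
  (coords_onb hg0 hE h_lie hZ) (ad_coords_abelian hg0 vfB hE h_lie h_ab hZ) cen cen' ww'.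
rewrite key; congr (_ * (_ - _)); apply: eq_bigr => i _; apply: eq_bigr => m _.
  by rewrite (trace_ad4 hg0 vfB hE) //; exact: lj.
by rewrite (trace_ad4 hg0 vfB hE) //; exact: lj'.
Qed.
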